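(* For any $0<c_2<1$ and for all $0<c_1<c_1^*(c_2)$, the problem $\textsc{3uni-HDS}_{c_1,c_2}$ is NP-complete.
   Context: A hypergraph $H=(V,E)$ is $3$-uniform if $E\subseteq \binom{V}{3}$; the degree $d(v)$ of a vertex is the number of hyperedges containing it. A degree sequence is a finite sequence of non-negative integers. For $c_1,c_2>0$, $\mathcal{D}_{c_1,c_2}$ is the class of degree sequences such that each $D=(d_1,\dots,d_n)\in\mathcal{D}_{c_1,c_2}$ of length $n$ satisfies $\sum_i d_i\equiv 0\pmod 3$ and $c_1\binom{n-1}{2}\le d_i\le c_2\binom{n-1}{2}$ for all $i$. $\textsc{3uni-HDS}_{c_1,c_2}$ is the decision problem: INPUT: $D=(d_1,\dots,d_n)\in\mathcal{D}_{c_1,c_2}$. OUTPUT: ''Yes'' if there is a $3$-uniform hypergraph on vertices $v_1,\dots,v_n$ with $d(v_i)=d_i$ for all $i$, and ''No'' otherwise. For $c_2\in(0,1)$, $c_1^*(c_2):=\max_{\alpha\in(0,1)} C\left(\alpha,\frac{c_2}{2}\right)$, where $$C(\alpha,d)=\begin{cases}0 & d\le \frac{\alpha^2}{2},\\ \frac{\alpha}{1-\alpha}\left(\frac{2d-\alpha^2}{2}\right) & \frac{\alpha^2}{2}<d\le \alpha\left(1-\frac{\alpha}{2}\right),\\ \frac{2\alpha}{1-\alpha}(2d-\alpha^2)-3\alpha^2 & d>\alpha\left(1-\frac{\alpha}{2}\right).\end{cases}$$ *)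

(* Defs.v *)
From mathcomp Require Import all_boot all_order all_algebra.
From mathcomp Require Import all_classical all_reals all_analysis.
From mathcomp Require Import ring lra.
Import Order.TTheory GRing.Theory Num.Theory.
Import numFieldNormedType.Exports.

Set Implicit Arguments.
Unset Strict Implicit.
Unset Printing Implicit Defensive.

(* Deterministic multitape Turing machines. *)

(* The tape alphabet is the blank [None], the input bits [Some (inl b)] and
   finitely many further symbols [Some (inr g)]. *)
Definition cell (G : finType) : Type := option (bool + G).

(* A two-way infinite tape: the cells to the left of the head, nearest first,
   and the cells from the head on; all the cells not listed are blank. *)
Record tape (G : finType) :=
  Tape { tleft : seq (cell G); tright : seq (cell G) }.

Inductive move := MoveL | MoveN | MoveR.

Section Tape.
Variable G : finType.
Implicit Types (t : tape G) (s : seq (cell G)).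

Definition tape_of_bits (w : seq bool) : tape G :=
  Tape [::] [seq Some (inl b) | b <- w].

Definition tread t : cell G := head None (tright t).

Definition twrite (a : cell G) t : tape G :=
  Tape (tleft t) (a :: behead (tright t)).

Definition tmove (m : move) t : tape G :=
  match m with
  | MoveL => Tape (behead (tleft t)) (head None (tleft t) :: tright t)
  | MoveN => t
  | MoveR => Tape (tread t :: tleft t) (behead (tright t))
  end.

Fixpoint leading_bits s : seq bool :=
  if s is Some (inl b) :: s' then b :: leading_bits s' else [::].

End Tape.

Record TM := {
  state : finType;
  symb : finType;
  extra : nat; (* the machine has [extra.+1] tapes *)
  start : state;
  halting : pred state;
  trans : state -> {ffun 'I_extra.+1 -> cell symb} ->
            state * {ffun 'I_extra.+1 -> cell symb * move}
}.

Definition config (M : TM) : Type :=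
  (state M * {ffun 'I_(extra M).+1 -> tape (symb M)})%type.

Definition init (M : TM) (w : seq bool) : config M :=
  (start M, [ffun i => tape_of_bits (symb M) (if i == ord0 then w else [::])]).

Definition step (M : TM) (c : config M) : config M :=
  if halting c.1 then c else
  let: (q, act) := trans c.1 [ffun i => tread (c.2 i)] in
  (q, [ffun i => tmove (act i).2 (twrite (act i).1 (c.2 i))]).

(* The output is the maximal block of bits starting at the head of tape 0. *)
Definition output (M : TM) (c : config M) : seq bool :=
  leading_bits (tright (c.2 ord0)).

(* [M] computes [f] with at most [T n] steps on the inputs of length [n]:
   halted configurations are fixed by [step]. *)
Definition computes_in (M : TM) (T : nat -> nat) (f : seq bool -> seq bool) :=
  forall w, let c := iter (T (size w)) (@step M) (init M w) in
  halting c.1 /\ output c = f w.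

(* Every polynomial is bounded by one of these. *)
Definition poly_bound (k n : nat) : nat := k * n ^ k + k.

Definition polytime (f : seq bool -> seq bool) :=
  exists (M : TM) (k : nat), computes_in M (poly_bound k) f.

(* Decision problems; [is_yes] is only ever consulted on words satisfying
   [is_input], so that a problem may come with a promise on its inputs.
   The languages are the problems for which all the words are inputs. *)
Record problem := Problem {
  is_input : seq bool -> Prop;
  is_yes : seq bool -> Prop
}.

Definition self_delimit (w : seq bool) : seq bool :=
  flatten [seq [:: true; b] | b <- w] ++ [:: false].

Definition encode_pair (w y : seq bool) : seq bool := self_delimit w ++ y.

Definition in_NP (P : problem) :=
  exists (V : seq bool -> bool) (k : nat),
    polytime (fun w => [:: V w]) /\
    forall w, is_input P w ->
      (is_yes P w <->
       exists2 y, size y <= poly_bound k (size w) & V (encode_pair w y)).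

Definition karp_reducible (Q P : problem) :=
  exists2 f, polytime f &
    forall w, is_input Q w ->
      is_input P (f w) /\ (is_yes Q w <-> is_yes P (f w)).

Definition NP_hard (P : problem) := forall Q, in_NP Q -> karp_reducible Q P.

Definition NP_complete (P : problem) := in_NP P /\ NP_hard P.

(* Binary representation, least significant bit first. *)
Fixpoint bits_rec (fuel n : nat) : seq bool :=
  if fuel is m.+1 then
    if n == 0 then [::] else odd n :: bits_rec m n./2
  else [::].

Definition bits (n : nat) : seq bool := bits_rec n n.

Definition encode_seq (D : seq nat) : seq bool :=
  flatten [seq self_delimit (bits d) | d <- D].

Lemma bits_inj : injective bits.
Proof.
pose val := foldr (fun (b : bool) n => b + n.*2) 0.
suff bitsK : cancel bits val by exact: can_inj bitsK.
move=> n; rewrite /bits; suff H m : n <= m -> val (bits_rec m n) = n by exact: H.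
elim: m n => [|m IHm] [|n] //= lenm.
rewrite IHm; first exact: (odd_double_half n.+1).
by rewrite leq_uphalf_double -addnn; exact: leq_trans lenm (leq_addr _ _).
Qed.

Lemma encode_seq_inj : injective encode_seq.
Proof.
have sd_inj w1 w2 r1 r2 :
    self_delimit w1 ++ r1 = self_delimit w2 ++ r2 -> w1 = w2 /\ r1 = r2.
  elim: w1 w2 => [|b1 w1 IHw] [|b2 w2] //=; first by case.
  by rewrite -/(self_delimit w1) -/(self_delimit w2) => -[-> /IHw[-> ->]].
elim=> [|d1 D1 IHD] [|d2 D2] //=; rewrite /encode_seq /=.
- by case: (bits d2).
- by case: (bits d1).
- by move=> /sd_inj[/bits_inj -> /IHD ->].
Qed.

(* 3-uniform hypergraphs on the vertices 0, ..., n-1, given by their edges. *)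
Definition uniform3 (n : nat) (E : {set {set 'I_n}}) : Prop :=
  forall e, e \in E -> #|e| = 3.

Definition degree (n : nat) (E : {set {set 'I_n}}) (v : 'I_n) : nat :=
  #|[pred e in E | v \in e]|.

Definition realizable (D : seq nat) : Prop :=
  exists E : {set {set 'I_(size D)}},
    uniform3 E /\ forall v, degree E v = nth 0 D v.

Local Open Scope ring_scope.

Section Threshold.
Variable R : realType.
Implicit Types alpha d : R.

Definition in_class (c1 c2 : R) (D : seq nat) : Prop :=
  (3 %| sumn D)%N /\
  forall d : nat, d \in D ->
    c1 * 'C((size D).-1, 2)%:R <= d%:R <= c2 * 'C((size D).-1, 2)%:R.

Definition HDS3 (c1 c2 : R) : problem := {|
  is_input w := exists2 D, in_class c1 c2 D & w = encode_seq D;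
  is_yes w := exists2 D, in_class c1 c2 D /\ realizable D & w = encode_seq D
|}.

Definition Cfun alpha d : R :=
  if d <= alpha ^+ 2 / 2 then 0
  else if d <= alpha * (1 - alpha / 2) then
    alpha / (1 - alpha) * ((2 * d - alpha ^+ 2) / 2)
  else 2 * alpha / (1 - alpha) * (2 * d - alpha ^+ 2) - 3 * alpha ^+ 2.

Local Open Scope classical_set_scope.

(* The supremum is a maximum for 0 < c2 < 1: see [c1star_max] below. *)
Definition c1star c2 : R := sup [set Cfun alpha (c2 / 2) | alpha in `]0, 1[].

Local Definition Cmid d alpha : R :=
  alpha * (1 - alpha)^-1 * ((2 * d - alpha * alpha) * 2^-1).
Local Definition Ctop d alpha : R :=
  2 * alpha * (1 - alpha)^-1 * (2 * d - alpha * alpha) - 3 * (alpha * alpha).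

Local Lemma CfunE alpha d : 0 < alpha -> alpha < 1 ->
  Cfun alpha d = Num.max 0 (Num.max (Cmid d alpha) (Ctop d alpha)).
Proof.
move=> a0 a1; have b0 : 0 < (1 - alpha)^-1 by rewrite invr_gt0; lra.
have E : Ctop d alpha - Cmid d alpha =
    3 / 2 * (alpha * (1 - alpha)^-1) * (2 * d - 2 * alpha + alpha * alpha).
  by rewrite /Ctop /Cmid; field; lra.
have q0 : 0 < alpha * (1 - alpha)^-1 by rewrite mulr_gt0.
rewrite /Cfun expr2; case: leP => [h1|h1].
  have m0 : Cmid d alpha <= 0 by rewrite /Cmid mulr_ge0_le0 ?(ltW q0) //; lra.
  have tm : Ctop d alpha <= Cmid d alpha.
    by rewrite -subr_le0 E mulr_ge0_le0 ?mulr_ge0 ?(ltW q0) //; nra.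
  by rewrite (max_l tm) (max_l m0).
have m0 : 0 <= Cmid d alpha by rewrite /Cmid mulr_ge0 ?(ltW q0) //; lra.
case: leP => [h2|h2].
  have tm : Ctop d alpha <= Cmid d alpha.
    by rewrite -subr_le0 E mulr_ge0_le0 ?mulr_ge0 ?(ltW q0) //; nra.
  by rewrite (max_l tm) (max_r m0).
have tm : Cmid d alpha <= Ctop d alpha.
  by rewrite -subr_ge0 E !mulr_ge0 ?(ltW q0) //; nra.
by rewrite (max_r tm) (max_r (le_trans m0 tm)).
Qed.

Lemma c1star_max c2 : 0 < c2 -> c2 < 1 ->
  exists2 alpha, 0 < alpha < 1 &
    c1star c2 = Cfun alpha (c2 / 2) /\
    forall beta, 0 < beta < 1 -> Cfun beta (c2 / 2) <= Cfun alpha (c2 / 2).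
Proof.
move=> c0 c1; set d := c2 / 2.
suff [a a01 aM] : exists2 a, 0 < a < 1 &
    forall b, 0 < b < 1 -> Cfun b d <= Cfun a d.
  exists a => //; split=> //; apply/eqP; rewrite eq_le; apply/andP; split.
    apply: ge_sup; first by exists (Cfun a d), a => //=; rewrite in_itv.
    by move=> x [b /=]; rewrite in_itv /= => /aM bM bx; rewrite -bx.
  apply: ub_le_sup; last by exists a => //=; rewrite in_itv.
  by exists (Cfun a d) => x [b /=]; rewrite in_itv /= => /aM bM bx; rewrite -bx.
pose m := (1 + c2) / 2.
pose g a : R := Num.max 0 (Num.max (Cmid d a) (Ctop d a)).
have Cm b : m <= b -> b < 1 -> Cfun b d = 0.
  by move=> mb b1; rewrite /Cfun ifT // /d; move: mb; rewrite /m; nra.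
have m0 : 0 < m by rewrite /m; lra.
have m1 : m < 1 by rewrite /m; lra.
have C0 b : 0 < b < 1 -> 0 <= Cfun b d.
  by case/andP => b0 b1; rewrite CfunE // le_max lexx.
have gc : {within `[0, m], continuous g}.
  apply: continuous_in_subspaceT => x; rewrite inE /= in_itv /= => /andP[x0 xm].
  have xn : 1 - x != 0 by rewrite gt_eqF //; lra.
  have ci : {for x, continuous (fun y : R => (1 - y)^-1)}.
    apply: continuousV => //; apply: continuousB; [exact: cst_continuous|exact: id].
  have cs : {for x, continuous (fun y : R => 2 * d - y * y)}.
    apply: continuousB; [exact: cst_continuous|apply: continuousM; exact: id].
  have cmid : {for x, continuous (Cmid d)}.
    apply: continuousM; first by apply: continuousM.
    by apply: continuousM => //; exact: cst_continuous.
  have ctop : {for x, continuous (Ctop d)}.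
    apply: continuousB.
      apply: continuousM => //; apply: continuousM => //.
      by apply: continuousM => //; exact: cst_continuous.
    by apply: continuousM; [exact: cst_continuous|apply: continuousM].
  have -> : g = (fun=> 0) \max (Cmid d \max Ctop d) by [].
  apply: continuous_max; first exact: cst_continuous.
  exact: continuous_max.
have [|a] := EVT_max _ gc; first by lra.
rewrite in_itv /= => /andP[a0 am] aM.
have gM b : 0 < b < 1 -> Cfun b d <= g a.
  move=> /andP[b0 b1]; have [mb|bm] := leP m b.
    by rewrite Cm // /g le_max lexx.
  by rewrite CfunE //; apply: aM; rewrite in_itv /=; lra.
have [a0'|an0] := eqVneq a 0.
  exists m => [|b /gM]; first by rewrite m0.
  rewrite (Cm m) //.
  by rewrite a0' /g /Cmid /Ctop !(mul0r, mulr0, subr0) !maxxx.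
have a_gt0 : 0 < a by rewrite lt_neqAle eq_sym an0.
have a_lt1 : a < 1 by exact: le_lt_trans m1.
by exists a => [|b /gM]; [rewrite a_gt0 | rewrite [Cfun a d]CfunE].
Qed.

End Threshold.

(* Main.v *)
Require Import Defs.
From mathcomp Require Import all_boot all_order all_algebra.
From mathcomp Require Import all_classical all_reals all_analysis.
From mathcomp Require Import zify ring lra.

Set Implicit Arguments.
Unset Strict Implicit.
Unset Printing Implicit Defensive.

(** Hardness. The computation of a polynomial-time verifier, with the tapes read
    relative to their heads, is a tiling of a grid of polynomial size, and a tiling
    is an exact cover with a prescribed number of sets. An exact cover is hidden in
    the ties of a threshold hypergraph. Give the vertices weights, and let the
    degrees be those of the triples of weight above a threshold, plus a vector [r]
    of degrees in the ties. A weighted sum of the degrees is then maximal, which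
    forces every realization to contain all the triples above the threshold and
    none below, so that the question is whether some set of ties has the degrees
    [r]. The weights are chosen such that the ties are the edges of one wheel for
    each set; a wheel has exactly two perfect covers, and they record whether the
    set is chosen.

    The gadget is a negligible part of the vertices. The others form two classes A
    and S of densities alpha and 1 - alpha. The triples inside A are above the
    threshold, those with two vertices in A and one in S are ties, of which a
    regular fraction rho is used, and the other ones are below. In units of
    n^2 / 2, the degrees are alpha^2 + 2 alpha (1 - alpha) rho in A, alpha^2 rho in
    S, and alpha^2 in the gadget. This reaches the values of [c1] below the second
    branch of C(alpha, c2 / 2). The third branch is the second one for the
    complementary hypergraphs, with [(1 - c2, 1 - c1)] instead of [(c1, c2)].

    Polynomial time. The functions computable in polynomial time with unary numbers
    are closed under bounded primitive recursion, and every degree in the reduction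
    is a bounded sum over all triples of vertices. *)

(** * Stack programs and their compilation to Turing machines *)

(** The origin of [c1star]: the bulk can be used when c1 < alpha^2 rho and alpha^2 + 2 alpha (1 -
    alpha) rho < c2 for some rho <= 1. Eliminating rho gives c1 < alpha (c2 - alpha^2) / (2 (1 -
    alpha)), which is the second branch at d = c2 / 2, and rho <= 1 is its range of d. For the
    complements, with 1 - alpha for alpha, the elimination gives the third branch.

    All the inequalities are strict, and the room is used twice: to make alpha and rho rational, so
    that the bulk is regular up to diagonal terms, and to absorb the gadget. Its g vertices change a
    degree by O(g n), which is negligible once the bulk has at least K0 g vertices, with K0
    depending on the gaps only.

    The number of sets of the cover is prescribed because [r] must be known without knowing the
    cover: a tip on the side of the unchosen sets has as its degree the number of those sets of its
    kind. Tips exist also for the sets which do not contain the element, since every wheel has to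
    close up around all the elements. *)

Definition store := nat -> seq bool.

Definition upd (sg : store) i v : store := fun j => if j == i then v else sg j.

Inductive prog :=
| Skip
| Push of nat & bool
| Pop of nat
| Seq of prog & prog
| If3 of nat & prog & prog & prog
| While of nat & prog.

(* [If3 i p q r] branches on the top of stack [i]: true, false, empty.
   [While] loops until the stack is empty. *)
Inductive run : prog -> store -> store -> nat -> Prop :=
| RunSkip sg : run Skip sg sg 0
| RunPush i b sg : run (Push i b) sg (upd sg i (b :: sg i)) 2
| RunPop i sg : run (Pop i) sg (upd sg i (behead (sg i))) 1
| RunSeq p q sg1 sg2 sg3 t1 t2 :
    run p sg1 sg2 t1 -> run q sg2 sg3 t2 -> run (Seq p q) sg1 sg3 (t1 + t2)
| RunIf3 i p q r sg sg' t :
    run (if sg i is b :: _ then if b then p else q else r) sg sg' t ->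
    run (If3 i p q r) sg sg' t.+2
| RunWhileNil i p sg : sg i = [::] -> run (While i p) sg sg 1
| RunWhileCons i p sg1 sg2 sg3 t1 t2 :
    sg1 i <> [::] -> run p sg1 sg2 t1 -> run (While i p) sg2 sg3 t2 ->
    run (While i p) sg1 sg3 (t1.+2 + t2).

Fixpoint stack_bound p : nat :=
  match p with
  | Skip => 0
  | Push i _ | Pop i => i
  | Seq p q => maxn (stack_bound p) (stack_bound q)
  | If3 i p q r =>
      maxn i (maxn (stack_bound p) (maxn (stack_bound q) (stack_bound r)))
  | While i p => maxn i (stack_bound p)
  end.

(* Pushing takes two machine steps: [IShift] opens a cell, [IWrite] fills it. *)
Inductive instr :=
| IShift of nat
| IWrite of nat & bool
| IPop of nat
| ICase of nat & nat & nat & nat.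

Definition goto l := ICase 0 l l l.

Fixpoint code_size p : nat :=
  match p with
  | Skip => 0
  | Push _ _ => 2
  | Pop _ => 1
  | Seq p q => code_size p + code_size q
  | If3 _ p q r => (code_size p + code_size q + code_size r).+4
  | While _ p => (code_size p).+2
  end.

Fixpoint compile o p : seq instr :=
  match p with
  | Skip => [::]
  | Push i b => [:: IShift i; IWrite i b]
  | Pop i => [:: IPop i]
  | Seq p q => compile o p ++ compile (o + code_size p) q
  | If3 i p q r =>
      let oq := o + (code_size p).+2 in
      let or := oq + (code_size q).+1 in
      let e := or + (code_size r).+1 in
      ICase i o.+1 oq or :: compile o.+1 p ++ goto e :: compile oq q ++
      goto e :: compile or r ++ [:: goto e]
  | While i p =>
      ICase i o.+1 o.+1 (o + (code_size p).+2) :: compile o.+1 p ++ [:: goto o]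
  end.

Lemma size_compile p o : size (compile o p) = code_size p.
Proof.
elim: p o => //= [p IHp q IHq|i p IHp q IHq r IHr|i p IHp] o.
- by rewrite size_cat IHp IHq.
- by rewrite !(size_cat, size_rcons) /= IHp !(size_cat, size_rcons) /= IHq !(size_cat, size_rcons) /= IHr; lia.
- by rewrite !size_cat IHp /=; lia.
Qed.

Ltac simp_sizes := do 6 rewrite ?(size_cat, size_compile) /=.

Section Machine.
Variables (K : nat) (code : seq instr).

Let L := size code.

Definition instr_act (ins : instr) (i : 'I_K.+1) (c : cell void) : cell void * move :=
  match ins with
  | IShift j => if (i : nat) == j then (c, MoveL) else (c, MoveN)
  | IWrite j b => if (i : nat) == j then (Some (inl b), MoveN) else (c, MoveN)
  | IPop j => if (i : nat) == j then (None, MoveR) else (c, MoveN)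
  | ICase _ _ _ _ => (c, MoveN)
  end.

Definition instr_next (ins : instr) (pc : nat) (rd : {ffun 'I_K.+1 -> cell void}) : nat :=
  if ins is ICase i a b c then
    match rd (inord i) with
    | Some (inl true) => a
    | Some (inl false) => b
    | _ => c
    end
  else pc.+1.

Definition stack_machine : TM := {|
  state := 'I_L.+1;
  symb := void;
  extra := K;
  start := ord0;
  halting := fun pc => (pc : nat) == L;
  trans := fun pc rd =>
    let ins := nth (goto 0) code pc in
    (inord (instr_next ins pc rd), [ffun i => instr_act ins i (rd i)])
|}.

(** Stack [i] is the right half of tape [i], with its top under the head. Nothing is said of the
    left halves, so that a shift to the left may uncover any symbol until [IWrite] overwrites it. *)
Definition represents (c : config stack_machine) (pc : nat)
    (f : nat -> nat -> cell void) :=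
  (c.1 : nat) = pc /\
  forall i : 'I_K.+1, forall k, nth None (tright (c.2 i)) k = f i k.

Definition cells_of (sg : store) : nat -> nat -> cell void :=
  fun i k => nth None [seq Some (inl b) | b <- sg i] k.

Lemma step_code c pc f : represents c pc f -> pc < L ->
  let ins := nth (goto 0) code pc in
  step c = (inord (instr_next ins pc [ffun i : 'I_K.+1 => f i 0]),
    [ffun i => let a := instr_act ins i (f i 0) in tmove a.2 (twrite a.1 (c.2 i))]).
Proof.
case: c => q ts [/= qE tE] ltpc.
rewrite /step /= qE ltn_eqF //.
have -> : [ffun i => tread (ts i)] = [ffun i : 'I_K.+1 => f i 0].
  by apply/ffunP => i; rewrite !ffunE -tE nth0.
by congr (_, _); apply/ffunP => i; rewrite !ffunE.
Qed.

Lemma tright_keep t (f : nat -> cell void) :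
  (forall k, nth None (tright t) k = f k) ->
  forall k, nth None (f 0 :: behead (tright t)) k = f k.
Proof. by move=> H [|k] //=; rewrite nth_behead H. Qed.

Lemma step_case c pc f i l1 l2 l3 l : represents c pc f -> pc < L -> i <= K ->
  nth (goto 0) code pc = ICase i l1 l2 l3 ->
  l = match f i 0 with
      | Some (inl true) => l1 | Some (inl false) => l2 | _ => l3 end ->
  l <= L -> represents (step c) l f.
Proof.
move=> rep ltpc leK ins lE leL; rewrite (step_code rep ltpc) ins; split=> [|j k] /=.
  have iE : (inord i : 'I_K.+1) = i :> nat by rewrite inordK.
  by rewrite ffunE iE -lE inordK.
by rewrite ffunE /=; apply: tright_keep; case: rep.
Qed.

Lemma step_shift c pc f i : represents c pc f -> pc < L ->
  nth (goto 0) code pc = IShift i ->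
  exists x, represents (step c) pc.+1
    (fun j k => if j == i then if k is k'.+1 then f j k' else x else f j k).
Proof.
move=> rep ltpc ins; rewrite (step_code rep ltpc) ins.
exists (if i <= K then head None (tleft (c.2 (inord i))) else None).
split=> [|j k] /=; first by rewrite inordK.
rewrite ffunE /=; case: eqP => [ji|_] /=; last by apply: tright_keep; case: rep.
case: k => [|k] /=; first by rewrite -ji leq_ord inord_val.
by apply: tright_keep; case: rep.
Qed.

Lemma step_write c pc f i b : represents c pc f -> pc < L ->
  nth (goto 0) code pc = IWrite i b ->
  represents (step c) pc.+1
    (fun j k => if j == i then if k is k'.+1 then f j k else Some (inl b)
                else f j k).
Proof.
move=> rep ltpc ins; rewrite (step_code rep ltpc) ins.
split=> [|j k] /=; first by rewrite inordK.
rewrite ffunE /=; case: eqP => [ji|_] /=; last by apply: tright_keep; case: rep.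
by case: k => [|k] //=; rewrite nth_behead; case: rep.
Qed.

Lemma step_pop c pc f i : represents c pc f -> pc < L ->
  nth (goto 0) code pc = IPop i ->
  represents (step c) pc.+1
    (fun j k => if j == i then f j k.+1 else f j k).
Proof.
move=> rep ltpc ins; rewrite (step_code rep ltpc) ins.
split=> [|j k] /=; first by rewrite inordK.
rewrite ffunE /=; case: eqP => [ji|_] /=; last by apply: tright_keep; case: rep.
by rewrite nth_behead; case: rep.
Qed.

Lemma eq_represents c pc f g : represents c pc f -> f =2 g -> represents c pc g.
Proof. by move=> [cE fE] fg; split=> // i k; rewrite fE fg. Qed.

(** The costs in [run] are the exact numbers of machine steps. The code of [p] sits at an arbitrary
    offset inside the whole code because its jumps are absolute. *)
Lemma run_compile p sg sg' t : run p sg sg' t -> forall c o s1 s2,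
  code = s1 ++ compile o p ++ s2 -> o = size s1 -> stack_bound p <= K ->
  represents c o (cells_of sg) ->
  represents (iter t (@step _) c) (o + code_size p) (cells_of sg').
Proof.
elim=> {p sg sg' t} /=.
- by move=> sg c o s1 s2 _ _ _; rewrite addn0.
- move=> i b sg c o s1 s2 cE oE leK rep.
  have szL : L = size s1 + (size s2).+2 by rewrite /L cE size_cat.
  have i0 : nth (goto 0) code o = IShift i by rewrite cE oE nth_cat ltnn subnn.
  have i1 : nth (goto 0) code o.+1 = IWrite i b.
    by rewrite cE oE nth_cat ltnNge leqnSn subSnn.
  have [|x rep1] := step_shift rep _ i0; first by lia.
  have := step_write rep1 _ i1; rewrite addn2 => rep2.
  apply: eq_represents; first by apply: rep2; lia.
  move=> j k; rewrite /cells_of /upd; case: eqP => [->|//].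
  by case: k.
- move=> i sg c o s1 s2 cE oE leK rep.
  have szL : L = size s1 + (size s2).+1 by rewrite /L cE size_cat.
  have i0 : nth (goto 0) code o = IPop i by rewrite cE oE nth_cat ltnn subnn.
  rewrite addn1; apply: eq_represents; first by apply: (step_pop rep) i0; lia.
  move=> j k; rewrite /cells_of /upd; case: eqP => [->|//].
  by case: (sg i) => [|b s] //=; rewrite nth_nil.
- move=> p q sg1 sg2 sg3 t1 t2 _ IHp _ IHq c o s1 s2 cE oE.
  rewrite geq_max => /andP[lep leq] rep.
  rewrite addnC iterD addnA; apply: (IHq _ _ (s1 ++ compile o p) s2) => //.
  + by rewrite cE !catA.
  + by rewrite size_cat size_compile oE.
  + by apply: (IHp _ _ s1 (compile (o + code_size p) q ++ s2)); rewrite // cE !catA.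
- move=> i p q r sg sg' t _ IH c o s1 s2 cE oE.
  rewrite !geq_max => /and4P[lei lep leq ler] rep.
  set oq := o + (code_size p).+2; set or := oq + (code_size q).+1.
  set e := or + (code_size r).+1.
  have eE : o + (code_size p + code_size q + code_size r).+4 = e.
    by rewrite /e /or /oq; lia.
  move: cE; rewrite -/oq -/or -/e => cE.
  have szL : L = e + size s2.
    by rewrite /L cE; simp_sizes; rewrite /e /or /oq; lia.
  have i0 : nth (goto 0) code o = ICase i o.+1 oq or.
    by rewrite cE oE nth_cat ltnn subnn.
  rewrite eE -iterS iterSr.
  (* Every branch, the last one included, ends with this jump: together with the test it makes the
     uniform overhead of two steps in [RunIf3]. *)
  have fin j c' : j < L -> nth (goto 0) code j = goto e ->
      represents c' j (cells_of sg') -> represents (step c') e (cells_of sg').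
    move=> jL jE rep'; apply: (step_case (i := 0)) rep' jL _ jE _ _ => //.
      by case: cells_of => // -[[]|].
    by lia.
  move: IH; rewrite /=; case sgi : (sg i) => [|[] si] /= IH.
  + have rep1 : represents (step c) or (cells_of sg).
      apply: step_case rep _ lei i0 _ _; [by lia| |by lia].
      by rewrite /cells_of sgi.
    have := IH _ _ (s1 ++ ICase i o.+1 oq or :: compile o.+1 p ++
      goto e :: compile oq q ++ [:: goto e]) (goto e :: s2) _ _ ler rep1.
    move=> /(_ _ _)/fin; apply; last 2 first.
    * by rewrite cE -?catA; do 6 rewrite /= -?catA.
    * by simp_sizes; rewrite /or /oq; lia.
    * by rewrite szL /e; lia.
    * rewrite cE.
      have -> : or + code_size r = size (s1 ++ ICase i o.+1 oq or :: compile o.+1 p ++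
        goto e :: compile oq q ++ goto e :: compile or r).
        by simp_sizes; rewrite /or /oq; lia.
      set u := _ ++ _; set v := _ ++ _ :: _.
      have -> : u = v ++ goto e :: s2 by rewrite /u /v -?catA; do 6 rewrite /= -?catA.
      by rewrite nth_cat ltnn subnn.
  + have rep1 : represents (step c) o.+1 (cells_of sg).
      apply: step_case rep _ lei i0 _ _; [by lia| |by rewrite szL /e /or /oq; lia].
      by rewrite /cells_of sgi.
    have := IH _ _ (s1 ++ [:: ICase i o.+1 oq or])
      (goto e :: compile oq q ++ goto e :: compile or r ++ goto e :: s2) _ _ lep rep1.
    move=> /(_ _ _)/fin; apply; last 2 first.
    * by rewrite cE -?catA; do 6 rewrite /= -?catA.
    * by simp_sizes; lia.
    * by rewrite szL /e /or /oq; lia.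
    * rewrite cE.
      have -> : o.+1 + code_size p = size (s1 ++ ICase i o.+1 oq or :: compile o.+1 p).
        by simp_sizes; lia.
      set u := _ ++ _; set v := _ ++ _ :: _.
      have -> : u = v ++ goto e :: compile oq q ++ goto e :: compile or r ++ goto e :: s2.
        by rewrite /u /v -?catA; do 6 rewrite /= -?catA.
      by rewrite nth_cat ltnn subnn.
  + have rep1 : represents (step c) oq (cells_of sg).
      apply: step_case rep _ lei i0 _ _; [by lia| |by rewrite szL /e /or /oq; lia].
      by rewrite /cells_of sgi.
    have := IH _ _ (s1 ++ ICase i o.+1 oq or :: compile o.+1 p ++ [:: goto e])
      (goto e :: compile or r ++ goto e :: s2) _ _ leq rep1.
    move=> /(_ _ _)/fin; apply; last 2 first.
    * by rewrite cE -?catA; do 6 rewrite /= -?catA.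
    * by simp_sizes; rewrite /oq; lia.
    * by rewrite szL /e /or; lia.
    * rewrite cE.
      have -> : oq + code_size q = size (s1 ++ ICase i o.+1 oq or :: compile o.+1 p ++
        goto e :: compile oq q).
        by simp_sizes; rewrite /oq; lia.
      set u := _ ++ _; set v := _ ++ _ :: _.
      have -> : u = v ++ goto e :: compile or r ++ goto e :: s2.
        by rewrite /u /v -?catA; do 6 rewrite /= -?catA.
      by rewrite nth_cat ltnn subnn.
- move=> i p sg sgi c o s1 s2 cE oE; rewrite geq_max => /andP[lei lep] rep.
  have szL : L = o + (code_size p).+2 + size s2.
    by rewrite /L cE; simp_sizes; lia.
  have ltoL : o < L by lia.
  have i0 : nth (goto 0) code o = ICase i o.+1 o.+1 (o + (code_size p).+2).
    by rewrite cE oE nth_cat ltnn subnn.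
  apply: (step_case rep ltoL lei i0); last by lia.
  by rewrite /cells_of sgi.
- move=> i p sg1 sg2 sg3 t1 t2 sgi _ IH1 _ IH2 c o s1 s2 cE oE leK rep.
  have := leK; rewrite geq_max => /andP[lei lep].
  have szL : L = o + (code_size p).+2 + size s2.
    by rewrite /L cE; simp_sizes; lia.
  rewrite -!iterS -!addSn addnC iterD; apply: (IH2 _ _ s1 s2) => //.
  have rep1 : represents (step c) o.+1 (cells_of sg1).
    have ltoL : o < L by lia.
  have i0 : nth (goto 0) code o = ICase i o.+1 o.+1 (o + (code_size p).+2).
    by rewrite cE oE nth_cat ltnn subnn.
  apply: (step_case rep ltoL lei i0); last by lia.
    by rewrite /cells_of; case: (sg1 i) sgi => // -[].
  have rep2 := IH1 _ _ (s1 ++ [:: ICase i o.+1 o.+1 (o + (code_size p).+2)])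
      (goto o :: s2) _ _ lep rep1.
  have {}rep2 : represents (iter t1 (@step _) (step c)) (o.+1 + code_size p) (cells_of sg2).
    apply: rep2; first by rewrite cE -?catA; do 6 rewrite /= -?catA.
    by simp_sizes; lia.
  have ltL : o.+1 + code_size p < L by lia.
  rewrite iterS iterSr; apply: (step_case (i := 0) rep2 ltL) => //.
  + rewrite cE.
    have -> : o.+1 + code_size p =
        size (s1 ++ ICase i o.+1 o.+1 (o + (code_size p).+2) :: compile o.+1 p).
      by simp_sizes; lia.
    set u := _ ++ _; set v := _ ++ _ :: _.
    have -> : u = v ++ goto o :: s2 by rewrite /u /v -?catA; do 6 rewrite /= -?catA.
    by rewrite nth_cat ltnn subnn.
  + by case: cells_of => // -[[]|].
  + by lia.
Qed.

End Machine.

Lemma leading_bitsE (G : finType) (s : seq (cell G)) w :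
  (forall k, nth None s k = nth None [seq Some (inl b) | b <- w] k) ->
  leading_bits s = w.
Proof.
elim: w s => [|b w IH] [|x s] H //=; have := H 0 => //=.
  by move->.
by move=> ->; rewrite IH // => k; have := H k.+1.
Qed.

Lemma exp_poly_bound c : exists k, forall n, (n + 2) ^ c <= poly_bound k n.
Proof.
exists (3 ^ c) => n; rewrite /poly_bound; case: n => [|n].
  by apply: leq_trans (leq_addl _ _); case: (c) => // c'; rewrite leq_exp2r.
have le3 : n.+1 + 2 <= 3 * n.+1 by lia.
apply: leq_trans (leq_addr _ _).
apply: (@leq_trans ((3 * n.+1) ^ c)); first by case: (c) => // c'; rewrite leq_exp2r.
by rewrite expnMn leq_mul2l leq_pexp2l ?orbT // ltnW // ltn_expl.
Qed.

(** A halted configuration is fixed by [step], so an upper bound on the time is enough. The base is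
    [size w + 2] so that powers absorb constants even on the empty word. *)
Lemma prog_polytime (f : seq bool -> seq bool) p c :
  (forall w, exists sg' t, [/\ t <= (size w + 2) ^ c, sg' 0 = f w &
     run p (fun i => if i == 0 then w else [::]) sg' t]) ->
  polytime f.
Proof.
move=> Hp; have [k Hk] := exp_poly_bound c.
exists (stack_machine (stack_bound p) (compile 0 p)), k => w /=.
have [sg' [t [lett fE rp]]] := Hp w.
have rep : represents (init (stack_machine (stack_bound p) (compile 0 p)) w) 0
    (cells_of (fun i => if i == 0 then w else [::])).
  split=> //= i j; rewrite ffunE /cells_of /= -val_eqE /=.
  by case: ((i : nat) == 0).
have := run_compile rp (c := _) (o := 0) (s1 := [::]) (s2 := [::]) _ erefl (leqnn _) rep.
rewrite cats0 => /(_ erefl); set c0 := init _ _ => -[pcE cE].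
have haltd : halting (iter t (@step _) c0).1.
  by rewrite /halting /= pcE size_compile add0n.
have fixd d : iter (d + t) (@step _) c0 = iter t (@step _) c0.
  by elim: d => // d; rewrite addSn iterS => ->; rewrite /step haltd.
have leT := leq_trans lett (Hk (size w)).
rewrite -(subnK leT) fixd; split=> //.
rewrite /output -fE; apply: leading_bitsE => j; exact: cE.
Qed.

(** * Polynomial time with unary numbers *)

Definition run_le p sg sg' T := exists2 t, t <= T & run p sg sg' t.

Lemma run_le_eq p sg sg' sg'' T T' :
  run_le p sg sg' T -> sg' =1 sg'' -> T <= T' -> run_le p sg sg'' T'.
Proof.
by move=> [t tT rp] /funext <- TT'; exists t => //; exact: leq_trans TT'.
Qed.

Lemma run_le_seq p q sg1 sg2 sg3 T1 T2 :
  run_le p sg1 sg2 T1 -> run_le q sg2 sg3 T2 ->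
  run_le (Seq p q) sg1 sg3 (T1 + T2).
Proof.
move=> [t1 le1 r1] [t2 le2 r2]; exists (t1 + t2); first exact: leq_add.
exact: RunSeq r1 r2.
Qed.

Lemma run_le_push i b sg : run_le (Push i b) sg (upd sg i (b :: sg i)) 2.
Proof. by exists 2 => //; exact: RunPush. Qed.

Lemma run_le_pop i sg : run_le (Pop i) sg (upd sg i (behead (sg i))) 1.
Proof. by exists 1 => //; exact: RunPop. Qed.

Lemma run_le_if3 i p q r sg sg' T :
  run_le (if sg i is b :: _ then if b then p else q else r) sg sg' T ->
  run_le (If3 i p q r) sg sg' T.+2.
Proof. by move=> [t tT rp]; exists t.+2 => //; exact: RunIf3. Qed.

(** The loop invariant as a family: [S k] is the store when [k] rounds remain, and the height of the
    tested stack is the counter. *)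
Lemma run_le_while i p (S : nat -> store) n T :
  (forall k, k <= n -> size (S k i) = k) ->
  (forall k, k < n -> run_le p (S k.+1) (S k) T) ->
  run_le (While i p) (S n) (S 0) (n * T.+2 + 1).
Proof.
elim: n => [|n IHn] Hs Hr.
  by exists 1 => //; apply: RunWhileNil; apply/size0nil/Hs.
have [t1 le1 r1] := Hr n (ltnSn n).
have [t2 le2 r2] : run_le (While i p) (S n) (S 0) (n * T.+2 + 1).
  by apply: IHn => k lek; [apply: Hs|apply: Hr]; lia.
exists (t1.+2 + t2); first by rewrite mulSn -addnA leq_add.
by apply: RunWhileCons r1 r2 => nilE; have := Hs n.+1 (leqnn _); rewrite nilE.
Qed.

Definition unary n := nseq n true.

Definition move_all a b := While a (Seq (Pop a) (Push b true)).
Definition clear a := While a (Pop a).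

Ltac upd_cases := rewrite /upd; repeat match goal with
  | |- context [?a == ?b] =>
      let e := fresh in case: (@eqP nat a b) => e;
      [try lia; try (subst a || subst b)|try lia]
  end.

Lemma run_le_move a b sg : a <> b ->
  run_le (move_all a b) sg
    (upd (upd sg a [::]) b (unary (size (sg a)) ++ sg b)) (size (sg a) * 5 + 1).
Proof.
move=> ab; set n := size _.
pose S k := upd (upd sg a (drop (n - k) (sg a))) b (unary (n - k) ++ sg b).
apply: (@run_le_eq _ _ (S 0) _ (n * 5 + 1)) => //; last first.
  by move=> j; rewrite /S subn0 drop_size.
rewrite (_ : sg = S n); last first.
  by apply/funext => j; rewrite /S subnn drop0; upd_cases.
apply: (run_le_while (S := S) (T := 3)) => [k lek|k ltk].
  by rewrite /S; upd_cases; rewrite size_drop -/n; lia.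
apply: run_le_eq (run_le_seq (run_le_pop _ _) (run_le_push _ _ _)) _ _ => // j.
rewrite /S; upd_cases => //.
  by rewrite -cat_cons (_ : n - k = (n - k.+1).+1) //; lia.
by rewrite -drop1 drop_drop; congr drop; lia.
Qed.

Lemma run_le_clear a sg : run_le (clear a) sg (upd sg a [::]) (size (sg a) * 3 + 1).
Proof.
set n := size _; pose S k := upd sg a (drop (n - k) (sg a)).
apply: (@run_le_eq _ _ (S 0) _ (n * 3 + 1)) => //; last first.
  by move=> j; rewrite /S subn0 drop_size.
rewrite (_ : sg = S n); last first.
  by apply/funext => j; rewrite /S subnn drop0; upd_cases.
apply: (run_le_while (S := S) (T := 1)) => [k lek|k ltk].
  by rewrite /S; upd_cases; rewrite size_drop -/n; lia.
apply: run_le_eq (run_le_pop _ _) _ _ => // j.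
by rewrite /S; upd_cases => //; rewrite -drop1 drop_drop; congr drop; lia.
Qed.

Definition insize (x : seq bool) (s : seq nat) := size x + sumn s + 2.

Lemma insize_gt1 x s : 1 < insize x s. Proof. by rewrite /insize; lia. Qed.

(* From two on, powers absorb sums and constants. *)
Definition poly_bounded (f : nat -> nat) := exists c, forall n, 1 < n -> f n <= n ^ c.

Lemma poly_bounded_cst k : poly_bounded (fun=> k).
Proof. by exists k => n n1; apply: ltnW; apply: ltn_expl. Qed.

Lemma poly_bounded_id : poly_bounded id. Proof. by exists 1 => n; rewrite expn1. Qed.

Lemma poly_bounded_mul f g : poly_bounded f -> poly_bounded g -> poly_bounded (fun n => f n * g n).
Proof.
by move=> [c Hc] [d Hd]; exists (c + d) => n n1; rewrite expnD leq_mul ?Hc ?Hd.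
Qed.

Lemma poly_bounded_add f g : poly_bounded f -> poly_bounded g -> poly_bounded (fun n => f n + g n).
Proof.
move=> [c Hc] [d Hd]; exists (c + d).+1 => n n1; rewrite expnS.
apply: leq_trans (_ : 2 * n ^ (c + d) <= _); last by rewrite leq_mul2r n1 orbT.
rewrite mul2n -addnn leq_add //.
  by apply: leq_trans (Hc n n1) _; rewrite leq_exp2l // leq_addr.
by apply: leq_trans (Hd n n1) _; rewrite leq_exp2l // leq_addl.
Qed.

Lemma poly_bounded_exp f c : poly_bounded f -> poly_bounded (fun n => f n ^ c).
Proof.
move=> [d Hd]; exists (d * c) => n n1; rewrite expnM.
by case: c => // c; rewrite leq_exp2r ?Hd.
Qed.

Ltac solve_poly_bounded := repeat first
  [ exact: poly_bounded_cst | exact: poly_bounded_id | apply: poly_bounded_add | apply: poly_bounded_mul | apply: poly_bounded_exp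
  | exact: (@poly_bounded_exp id _ poly_bounded_id) ].

(* Stack 0 is the output, stack 1 holds the input word and stack 2 is a scratch
   copy of it; the registers are the stacks from 3 on. The arguments are in the
   registers [rs], the result goes to [m], and the stacks above [m] are free. *)
Definition computes_at (p : prog) (x : seq bool) (s rs : seq nat) m v T :=
  forall sg : store, 2 < m -> all (fun r => 2 < r < m) rs ->
  [seq sg r | r <- rs] = [seq unary n | n <- s] ->
  sg 1 = x -> sg 2 = [::] -> (forall j, m <= j -> sg j = [::]) ->
  run_le p sg (upd sg m (unary v)) T.

(* Polynomial time in the length of the word and in the values, not the lengths,
   of the arguments: all the numbers are in unary. *)
Definition ptime (F : seq bool -> seq nat -> nat) :=
  exists (P : seq nat -> nat -> prog) (c : nat), forall x s,
  F x s <= insize x s ^ c /\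
  forall rs m, computes_at (P rs m) x s rs m (F x s) (insize x s ^ c).

Lemma ptime_pb F P (f g : nat -> nat) : poly_bounded f -> poly_bounded g ->
  (forall x s, F x s <= g (insize x s)) ->
  (forall x s rs m, computes_at (P rs m) x s rs m (F x s) (f (insize x s))) ->
  ptime F.
Proof.
move=> [c Hc] [d Hd] HF HP; exists P, (c + d) => x s.
have m1 := insize_gt1 x s; split=> [|rs m sg *].
  apply: leq_trans (HF x s) (leq_trans (Hd _ m1) _).
  by rewrite leq_exp2l // leq_addl.
apply: (run_le_eq (HP x s rs m sg _ _ _ _ _ _)) => //.
by apply: leq_trans (Hc _ m1) _; rewrite leq_exp2l // leq_addr.
Qed.

Lemma eq_ptime F G : F =2 G -> ptime F -> ptime G.
Proof. by move=> FG; rewrite (_ : F = G) //; apply/funext=> x; apply/funext=> s. Qed.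


Lemma upd_id sg i : upd sg i (sg i) = sg.
Proof. by apply/funext => j; rewrite /upd; case: eqP => // ->. Qed.

Lemma upd_upd sg i u v : upd (upd sg i u) i v = upd sg i v.
Proof. by apply/funext => j; rewrite /upd; case: eqP. Qed.

Lemma updE sg i v : upd sg i v i = v. Proof. by rewrite /upd eqxx. Qed.

Lemma upd_neq sg i v j : j <> i -> upd sg i v j = sg j.
Proof. by rewrite /upd => /eqP/negbTE->. Qed.

Lemma ptime_succ F : ptime F -> ptime (fun x s => (F x s).+1).
Proof.
move=> [P [c HP]].
apply: (ptime_pb (P := fun rs m => Seq (P rs m) (Push m true))
  (f := fun n => n ^ c + 2) (g := fun n => n ^ c + 1)); try by solve_poly_bounded.
  by move=> x s; have [] := HP x s; lia.
move=> x s rs m sg H1 H2 H3 H4 H5 H6; have [_ /(_ rs m sg)H] := HP x s.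
apply: run_le_eq (run_le_seq (H _ _ _ _ _ _) (run_le_push _ _ _)) _ _ => //.
by rewrite upd_upd updE.
Qed.

Lemma ptime_cst k : ptime (fun _ _ => k).
Proof.
elim: k => [|k IH]; last exact: ptime_succ.
apply: (ptime_pb (P := fun _ _ => Skip) (poly_bounded_cst 0) (poly_bounded_cst 0)) => // x s rs m sg _ _ _ _ _ Hm.
exists 0 => //; rewrite (_ : upd sg m _ = sg); first exact: RunSkip.
by apply/funext => j; upd_cases => //; rewrite Hm.
Qed.

Lemma size_unary n : size (unary n) = n. Proof. exact: size_nseq. Qed.

Definition copy_to r m :=
  Seq (While r (Seq (Pop r) (Seq (Push m true) (Push m.+1 true)))) (move_all m.+1 r).

Lemma run_le_copy r m sg n : r < m -> sg r = unary n ->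
  sg m = [::] -> sg m.+1 = [::] ->
  run_le (copy_to r m) sg (upd sg m (unary n)) (n * 12 + 2).
Proof.
move=> rm rE mE m1E.
pose S k := upd (upd (upd sg r (unary k)) m (unary (n - k))) m.+1 (unary (n - k)).
have H1 : run_le (While r (Seq (Pop r) (Seq (Push m true) (Push m.+1 true))))
    sg (S 0) (n * 7 + 1).
  rewrite {1}(_ : sg = S n); last first.
    by apply/funext => j; rewrite /S subnn; upd_cases.
  apply: (run_le_while (S := S) (T := 5)) => [k lek|k ltk].
    by rewrite /S; upd_cases; rewrite size_unary.
  apply: run_le_eq (run_le_seq (run_le_pop _ _)
    (run_le_seq (run_le_push _ _ _) (run_le_push _ _ _))) _ _ => // j.
  by rewrite /S; upd_cases => //; rewrite (_ : n - k = (n - k.+1).+1) //; lia.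
have m1r : m.+1 <> r by lia.
apply: run_le_eq (run_le_seq H1 (run_le_move _ m1r)) _ _.
  move=> j; rewrite /S subn0; upd_cases; rewrite ?size_unary ?cats0 //.
by rewrite /S subn0 updE size_unary; lia.
Qed.


Lemma leq_nth_sumn s i : nth 0 s i <= sumn s.
Proof.
elim: s i => [|n s IH] [|i] //=; first exact: leq_addr.
by apply: leq_trans (IH i) (leq_addl _ _).
Qed.

Lemma ptime_var i : ptime (fun _ s => nth 0 s i).
Proof.
apply: (ptime_pb (P := fun rs m => if i < size rs then copy_to (nth 0 rs i) m else Skip)
  (f := fun n => n * 12 + 2) (g := id)); try by solve_poly_bounded.
  by move=> x s; have := leq_nth_sumn s i; rewrite /insize; lia.
move=> x s rs m sg m2 rsm rsE _ _ Hm.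
have szE : size rs = size s by rewrite -(size_map sg) rsE size_map.
case: ltnP => [lt|le].
  have rE : sg (nth 0 rs i) = unary (nth 0 s i).
    by rewrite -(nth_map 0 [::]) // rsE (nth_map 0) -?szE.
  have /andP[_ rm] := allP rsm _ (mem_nth 0 lt).
  apply: run_le_eq (run_le_copy rm rE (Hm _ _) (Hm _ _)) _ _ => //.
  by have := leq_nth_sumn s i; rewrite /insize; lia.
rewrite nth_default -?szE //.
exists 0 => //; rewrite (_ : upd sg m _ = sg); first exact: RunSkip.
by apply/funext => j; upd_cases => //; rewrite Hm.
Qed.

Lemma map_upd sg m v rs : all (fun r => 2 < r < m) rs ->
  [seq upd sg m v r | r <- rs] = [seq sg r | r <- rs].
Proof. by move=> /allP rsm; apply/eq_in_map => r /rsm ?; rewrite upd_neq //; lia. Qed.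

Lemma all_widen m m' rs : m <= m' -> all (fun r => 2 < r < m) rs ->
  all (fun r => 2 < r < m') rs.
Proof. by move=> mm'; apply: sub_all => r; lia. Qed.

(** The value of [G] becomes a register at [m]; [F] leaves its result at [m.+1], which is moved down
    once [m] is cleared, so that only the result remains. *)
Lemma ptime_let F G : ptime G -> ptime F -> ptime (fun x s => F x (G x s :: s)).
Proof.
move=> [P [c HP]] [Q [d HQ]].
apply: (ptime_pb (P := fun rs m => Seq (P rs m) (Seq (Q (m :: rs) m.+1)
    (Seq (clear m) (move_all m.+1 m))))
  (f := fun n => n ^ c + ((n + n ^ c) ^ d + ((n ^ c * 3 + 1) + ((n + n ^ c) ^ d * 5 + 1))))
  (g := fun n => (n + n ^ c) ^ d)); try by solve_poly_bounded.
  move=> x s; have [Gle _] := HP x s; have [Fle _] := HQ x (G x s :: s).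
  apply: leq_trans Fle _; case: d {HQ} => // d; rewrite leq_exp2r //.
  by move: Gle; rewrite /insize /=; lia.
move=> x s rs m sg m2 rsm rsE E1 E2 Hm.
have [Gle /(_ rs m sg m2 rsm rsE E1 E2 Hm) Grun] := HP x s.
have [Fle Frun0] := HQ x (G x s :: s).
set g := G x s in Gle Grun Fle Frun0 *; set f := F x _ in Fle Frun0 *.
have mle : insize x (g :: s) ^ d <= (insize x s + insize x s ^ c) ^ d.
  case: d {HQ} Fle Frun0 => // d _ _; rewrite leq_exp2r //.
  by move: Gle; rewrite /insize /=; lia.
have Frun : run_le (Q (m :: rs) m.+1) (upd sg m (unary g))
   (upd (upd sg m (unary g)) m.+1 (unary f)) ((insize x s + insize x s ^ c) ^ d).
  apply: (run_le_eq (Frun0 _ _ (upd sg m (unary g)) _ _ _ _ _ _)) mle => //.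
  - by lia.
  - by rewrite /= m2 ltnSn; apply: all_widen rsm.
  - by rewrite /= updE map_upd ?rsE.
  - by rewrite upd_neq //; lia.
  - by rewrite upd_neq //; lia.
  - by move=> j lej; rewrite upd_neq ?Hm //; lia.
have nem : m.+1 <> m by lia.
apply: run_le_eq (run_le_seq Grun (run_le_seq Frun
  (run_le_seq (run_le_clear _ _) (run_le_move _ nem)))) _ _.
- by move=> j; upd_cases => //; rewrite ?size_unary ?cats0 ?Hm //; lia.
- rewrite !leq_add ?leq_mul //.
    by upd_cases; rewrite size_unary.
  by upd_cases; rewrite size_unary (leq_trans Fle).
Qed.

Lemma ptime_behead F : ptime F -> ptime (fun x s => F x (behead s)).
Proof.
move=> [P [c HP]].
have le s : sumn (behead s) <= sumn s by case: s => //= n s; apply: leq_addl.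
apply: (ptime_pb (P := fun rs m => P (behead rs) m) (f := fun n => n ^ c) (g := fun n => n ^ c));
  try by solve_poly_bounded.
  move=> x s; have [H _] := HP x (behead s); apply: leq_trans H _.
  by case: c {HP} => // c; rewrite leq_exp2r // leq_add2r leq_add2l.
move=> x s rs m sg m2 rsm rsE E1 E2 Hm.
have [_ H] := HP x (behead s).
apply: (run_le_eq (H _ _ sg _ _ _ _ _ _)) => //.
- by case: (rs) rsm => //= ? ? /andP[].
- by rewrite -!behead_map rsE.
- by case: c {HP H} => // c; rewrite leq_exp2r // leq_add2r leq_add2l.
Qed.

Lemma ptime_take k F : ptime F -> ptime (fun x s => F x (take k s)).
Proof.
move=> [P [c HP]].
have le s : sumn (take k s) <= sumn s.
  by elim: s (k) => [|n s IH] [|l] //=; rewrite leq_add2l.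
apply: (ptime_pb (P := fun rs m => P (take k rs) m) (f := fun n => n ^ c) (g := fun n => n ^ c));
  try by solve_poly_bounded.
  move=> x s; have [H _] := HP x (take k s); apply: leq_trans H _.
  by case: c {HP} => // c; rewrite leq_exp2r // leq_add2r leq_add2l.
move=> x s rs m sg m2 rsm rsE E1 E2 Hm.
have [_ H] := HP x (take k s).
apply: (run_le_eq (H _ _ sg _ _ _ _ _ _)) => //.
- by apply/allP => r /mem_take; move: r; apply/allP.
- by rewrite !map_take rsE.
- by case: c {HP H} => // c; rewrite leq_exp2r // leq_add2r leq_add2l.
Qed.

Lemma ptime_comp1 F a : ptime F -> ptime a -> ptime (fun x s => F x [:: a x s]).
Proof.
move=> /(ptime_take 1) HF Ha; apply: eq_ptime (ptime_let Ha HF) => x s.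
by rewrite /= take0.
Qed.

Lemma ptime_comp2 F a b : ptime F -> ptime a -> ptime b -> ptime (fun x s => F x [:: a x s; b x s]).
Proof.
move=> /(ptime_take 2) HF Ha Hb.
apply: eq_ptime (ptime_let Hb (ptime_let (ptime_behead Ha) HF)) => x s.
by rewrite /= take0.
Qed.

(** Bounded recursion in the sense of Cobham: the polynomial bound on all the intermediate values is
    what prevents an iterated polynomial-time step from growing exponentially. *)
Lemma ptime_rec F G N (H : seq bool -> seq nat -> nat -> nat) c0 :
  ptime F -> ptime G -> ptime N ->
  (forall x s, H x s 0 = F x s) ->
  (forall x s i, H x s i.+1 = G x (i :: H x s i :: s)) ->
  (forall x s i, i <= N x s -> H x s i <= insize x s ^ c0) ->
  ptime (fun x s => H x s (N x s)).
Proof.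
move=> [PF [cF HF]] [PG [cG HG]] [PN [cN HN]] H0 HS HB.
pose body (rs : seq nat) m := Seq (Pop m.+1) (Seq (PG (m.+2 :: m :: rs) m.+3)
  (Seq (clear m) (Seq (move_all m.+3 m) (Push m.+2 true)))).
pose T n := 1 + ((n + n ^ cN + n ^ c0) ^ cG + ((n ^ c0 * 3 + 1) + ((n ^ c0 * 5 + 1) + 2))).
apply: (ptime_pb (P := fun rs m => Seq (PF rs m) (Seq (PN rs m.+1)
    (Seq (While m.+1 (body rs m)) (clear m.+2))))
  (f := fun n => n ^ cF + (n ^ cN + ((n ^ cN * (T n + 2) + 1) + (n ^ cN * 3 + 1))))
  (g := fun n => n ^ c0)); try by rewrite /T; solve_poly_bounded.
  by move=> x s; apply: HB.
move=> x s rs m sg m2 rsm rsE E1 E2 Hm.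
have [_ /(_ rs m sg m2 rsm rsE E1 E2 Hm) Frun] := HF x s.
have [Nle Nrun0] := HN x s.
set n := N x s in Nle Nrun0 *; set M := insize x s in Nle Nrun0 Frun *.
have Nrun : run_le (PN rs m.+1) (upd sg m (unary (F x s)))
   (upd (upd sg m (unary (F x s))) m.+1 (unary n)) (M ^ cN).
  apply: (run_le_eq (Nrun0 _ _ (upd sg m (unary (F x s))) _ _ _ _ _ _)) => //.
  - by lia.
  - by apply: all_widen rsm.
  - by rewrite map_upd ?rsE.
  - by rewrite upd_neq //; lia.
  - by rewrite upd_neq //; lia.
  - by move=> j lej; rewrite upd_neq ?Hm //; lia.
(* With [k] rounds to go, [m] holds the current value, [m.+1] the counter and [m.+2] the index,
   which the step function also receives. *)
pose S k := upd (upd (upd sg m (unary (H x s (n - k)))) m.+1 (unary k))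
  m.+2 (unary (n - k)).
have Wrun : run_le (While m.+1 (body rs m))
    (upd (upd sg m (unary (F x s))) m.+1 (unary n)) (S 0) (n * (T M).+2 + 1).
  rewrite (_ : upd _ _ _ = S n); last first.
    by apply/funext => j; rewrite /S subnn H0; upd_cases => //; rewrite Hm //; lia.
  apply: run_le_while => [k lek|k ltk].
    by rewrite /S; upd_cases; rewrite size_unary.
  set i := n - k.+1.
  have iE : n - k = i.+1 by rewrite /i; lia.
  have lein : i <= n by rewrite /i; lia.
  have leHi := HB _ _ _ lein; rewrite -/M in leHi.
  have leHi1 : H x s i.+1 <= M ^ c0 by rewrite /M; apply: HB; rewrite -/n -iE; lia.
  pose sg1 := upd (S k.+1) m.+1 (unary k).
  have run1 : run_le (Pop m.+1) (S k.+1) sg1 1.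
    apply: run_le_eq (run_le_pop _ _) _ _ => // j.
    by rewrite /sg1 /S; upd_cases.
  pose sg2 := upd sg1 m.+3 (unary (H x s i.+1)).
  have run2 : run_le (PG (m.+2 :: m :: rs) m.+3) sg1 sg2 ((M + M ^ cN + M ^ c0) ^ cG).
    have [_ Grun] := HG x (i :: H x s i :: s).
    apply: run_le_eq (Grun _ _ sg1 _ _ _ _ _ _) _ _.
    - by lia.
    - by rewrite /= (all_widen _ rsm) ?andbT; lia.
    - rewrite /= /sg1 /S map_upd; last by apply: all_widen rsm; lia.
      rewrite map_upd; last by apply: all_widen rsm; lia.
      rewrite map_upd; last by apply: all_widen rsm; lia.
      rewrite map_upd // rsE; congr [:: _, _ & _]; rewrite /i; by upd_cases.
    - by rewrite /sg1 /S; upd_cases.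
    - by rewrite /sg1 /S; upd_cases.
    - by move=> j lej; rewrite /sg1 /S; upd_cases => //; rewrite Hm //; lia.
    - by move=> j; rewrite -HS.
    - have Mi : insize x (i :: H x s i :: s) = M + i + H x s i.
        by rewrite /M /insize /=; lia.
      case: (cG) => // c; rewrite leq_exp2r // Mi.
      by rewrite !leq_add // (leq_trans lein).
  have ne : m.+3 <> m by lia.
  apply: run_le_eq (run_le_seq run1 (run_le_seq run2 (run_le_seq (run_le_clear _ _)
   (run_le_seq (run_le_move _ ne) (run_le_push _ _ _))))) _ _.
  - clear E1 E2 => j; rewrite /sg2 /sg1 /S iE; upd_cases => //; rewrite ?size_unary ?cats0 ?Hm //; lia.
  - rewrite /T !leq_add ?leq_mul //.
      by rewrite /sg2 /sg1 /S; upd_cases; rewrite size_unary.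
    by rewrite /sg2 /sg1 /S; upd_cases; rewrite size_unary.
apply: run_le_eq (run_le_seq Frun (run_le_seq Nrun (run_le_seq Wrun (run_le_clear _ _)))) _ _.
- by move=> j; rewrite /S subn0; upd_cases => //; rewrite ?Hm //; lia.
- rewrite !leq_add ?leq_mul //; first by lia.
  by rewrite /S subn0 updE size_unary.
Qed.

Definition xfer a b := Seq (If3 a (Push b true) (Push b false) Skip) (Pop a).
Definition xfer_all a b := While a (xfer a b).

Lemma run_le_xfer a b sg : a <> b ->
  run_le (xfer a b) sg (upd (upd sg b (take 1 (sg a) ++ sg b)) a (behead (sg a))) 5.
Proof.
move=> ab.
have H : run_le (If3 a (Push b true) (Push b false) Skip) sg
   (upd sg b (take 1 (sg a) ++ sg b)) 4.
  apply: run_le_if3; case: (sg a) => [|[] l]; rewrite /= ?take0; try exact: run_le_push.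
  by rewrite upd_id; exists 0 => //; exact: RunSkip.
apply: run_le_eq (run_le_seq H (run_le_pop _ _)) _ _ => // j.
by upd_cases.
Qed.

Lemma take1_drop (x : seq bool) i : take 1 (drop i x) ++ rev (take i x) = rev (take i.+1 x).
Proof.
have [le|lt] := leqP (size x) i; first by rewrite drop_oversize // !take_oversize // ltnW.
by rewrite (drop_nth false) // (take_nth false lt) rev_rcons /= take0.
Qed.

Lemma behead_drop (x : seq bool) i : behead (drop i x) = drop i.+1 x.
Proof. by rewrite -drop1 drop_drop add1n. Qed.

Lemma run_le_xfer_all a b sg : a <> b ->
  run_le (xfer_all a b) sg (upd (upd sg a [::]) b (rev (sg a) ++ sg b))
    (size (sg a) * 7 + 1).
Proof.
move=> ab; set n := size _.
pose S k := upd (upd sg a (drop (n - k) (sg a))) b (rev (take (n - k) (sg a)) ++ sg b).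
apply: (@run_le_eq _ _ (S 0) _ (n * 7 + 1)) => //; last first.
  by move=> j; rewrite /S subn0 drop_size take_size.
rewrite {1}(_ : sg = S n); last first.
  by apply/funext => j; rewrite /S subnn drop0 take0; upd_cases.
apply: (run_le_while (S := S) (T := 5)) => [k lek|k ltk].
  by rewrite /S; upd_cases; rewrite size_drop -/n; lia.
apply: run_le_eq (run_le_xfer _ ab) _ _ => // j.
have nk : n - k = (n - k.+1).+1 by lia.
by rewrite /S nk; upd_cases; rewrite ?behead_drop ?catA ?take1_drop.
Qed.

(** Reading the word consumes stack 1. The bits go to stack 2 in reverse order, and a second
    transfer restores them. *)
Lemma ptime_len : ptime (fun x _ => size x).
Proof.
apply: (ptime_pb (P := fun rs m => Seq (While 1 (Seq (xfer 1 2) (Push m true))) (xfer_all 2 1))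
  (f := fun n => (n * 9 + 1) + (n * 7 + 1)) (g := fun n => n)); try by solve_poly_bounded.
  by move=> x s; rewrite /insize; lia.
move=> x s rs m sg m2 rsm _ E1 E2 Hm; set n := size x.
have n12 : 1 <> 2 by [].
have n21 : 2 <> 1 by [].

pose S k := upd (upd (upd sg 1 (drop (n - k) x)) 2 (rev (take (n - k) x))) m (unary (n - k)).
have H1 : run_le (While 1 (Seq (xfer 1 2) (Push m true))) sg (S 0) (n * 9 + 1).
  rewrite {1}(_ : sg = S n); last first.
    by apply/funext => j; rewrite /S subnn drop0 take0; upd_cases; rewrite ?E1 ?E2 // Hm.
  apply: (run_le_while (S := S) (T := 7)) => [k lek|k ltk].
    by rewrite /S; upd_cases; rewrite size_drop -/n; lia.
  apply: run_le_eq (run_le_seq (run_le_xfer _ n12) (run_le_push _ _ _)) _ _ => // j.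
  have nk : n - k = (n - k.+1).+1 by lia.
  by rewrite /S nk; clear E1 E2; upd_cases; rewrite ?behead_drop ?take1_drop.
apply: run_le_eq (run_le_seq H1 (run_le_xfer_all _ n21)) _ _ => //.
  move=> j; rewrite /S subn0 drop_size take_size; upd_cases; by rewrite ?revK ?cats0 ?E1 ?E2.
by rewrite /S subn0 take_size; upd_cases; rewrite size_rev /insize; lia.
Qed.

Lemma ptime_bit0 : ptime (fun x s => nth false x (nth 0 s 0)).
Proof.
have [P [c HP]] := ptime_var 0.
apply: (ptime_pb (P := fun rs m => Seq (P rs m) (Seq (While m (Seq (Pop m) (xfer 1 2)))
    (Seq (If3 1 (Push m true) Skip Skip) (xfer_all 2 1))))
  (f := fun n => n ^ c + ((n ^ c * 8 + 1) + (4 + (n * 7 + 1)))) (g := fun=> 1));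
  try by solve_poly_bounded.
  by move=> x s; case: nth.
move=> x s rs m sg m2 rsm rsE E1 E2 Hm.
have n12 : 1 <> 2 by [].
have n21 : 2 <> 1 by [].

have [le /(_ rs m sg m2 rsm rsE E1 E2 Hm) H1] := HP x s.
set i := nth 0 s 0 in le H1 *.
pose S k := upd (upd (upd sg 1 (drop (i - k) x)) 2 (rev (take (i - k) x))) m (unary k).
have H2 : run_le (While m (Seq (Pop m) (xfer 1 2))) (upd sg m (unary i)) (S 0) (i * 8 + 1).
  rewrite {1}(_ : upd _ _ _ = S i); last first.
    by apply/funext => j; rewrite /S subnn drop0 take0; upd_cases; rewrite ?E1 ?E2.
  apply: (run_le_while (S := S) (T := 6)) => [k lek|k ltk].
    by rewrite /S; upd_cases; rewrite size_unary.
  apply: run_le_eq (run_le_seq (run_le_pop _ _) (run_le_xfer _ n12)) _ _ => // j.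
  have nk : i - k = (i - k.+1).+1 by lia.
  by rewrite /S nk; clear E1 E2; upd_cases; rewrite ?behead_drop ?take1_drop.
pose sg3 := upd (S 0) m (unary (nth false x i)).
have H3 : run_le (If3 1 (Push m true) Skip Skip) (S 0) sg3 4.
  apply: run_le_if3.
  have -> : S 0 1 = drop i x by rewrite /S subn0; upd_cases.
  have bE : nth false x i = head false (drop i x) by rewrite -nth0 nth_drop addn0.
  have Sm : S 0 = upd (S 0) m [::] by apply/funext => j; rewrite /S; upd_cases.
  rewrite /sg3 bE; case: (drop i x) => [|[] l] /=.
  - by rewrite -Sm; exists 0 => //; exact: RunSkip.
  - by apply: run_le_eq (run_le_push _ _ _) _ _ => // j; rewrite /S; upd_cases.
  - by rewrite -Sm; exists 0 => //; exact: RunSkip.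
apply: run_le_eq (run_le_seq H1 (run_le_seq H2 (run_le_seq H3 (run_le_xfer_all _ n21)))) _ _ => //.
  move=> j; rewrite /sg3 /S subn0; upd_cases; by rewrite ?revK ?cat_take_drop ?E1 ?E2.
rewrite !leq_add ?leq_mul //.
rewrite /sg3 /S subn0; upd_cases; rewrite size_rev size_take.
by rewrite /insize; case: ltnP; lia.
Qed.

(** A stack is filled from its bottom, so the output is produced from its last bit to its first: the
    length is computed on stack 3, which then serves both as the loop counter and as the index of
    the bit. Beforehand the input moves from stack 0 to stack 1, through stack 2 to keep its
    order. *)
Lemma ptime_polytime O L : ptime O -> ptime L ->
  polytime (fun x => mkseq (fun i => 0 < O x [:: i]) (L x [::])).
Proof.
move=> [P [c HP]] [Q [d HQ]].
pose body := Seq (Pop 3) (Seq (P [:: 3] 4)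
  (Seq (If3 4 (Push 0 true) (Push 0 false) (Push 0 false)) (clear 4))).
pose f n := (n * 7 + 1) + ((n * 7 + 1) + (n ^ d +
   (n ^ d * (1 + ((n + n ^ d) ^ c + (4 + ((n + n ^ d) ^ c * 3 + 1))) + 2) + 1))).
have [e He] : poly_bounded f by rewrite /f; solve_poly_bounded.
apply: (prog_polytime (p := Seq (xfer_all 0 2) (Seq (xfer_all 2 1)
   (Seq (Q [::] 3) (While 3 body)))) (c := e)) => x.
set M := size x + 2.
set sg0 : store := fun i => if i == 0 then x else [::].
have leM : insize x [::] = M by rewrite /insize /= addn0.
have n02 : 0 <> 2 by []. have n21 : 2 <> 1 by [].
have [Lle Lrun0] := HQ x [::]; set n := L x [::] in Lle Lrun0 *; set out := mkseq _ _.
have xM : size x <= M by rewrite /M leq_addr.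
pose sg1 : store := fun i => if i == 1 then x else [::].
have H1 : run_le (xfer_all 0 2) sg0 (fun i => if i == 2 then rev x else [::]) (M * 7 + 1).
  apply: run_le_eq (run_le_xfer_all _ n02) _ _.
    by rewrite /sg0; case=> [|[|[|j]]] //=; rewrite /upd /= cats0.
  by rewrite /sg0 /= leq_add2r leq_mul2r xM orbT.
have H2 : run_le (xfer_all 2 1) (fun i => if i == 2 then rev x else [::]) sg1 (M * 7 + 1).
  apply: run_le_eq (run_le_xfer_all _ n21) _ _.
    by rewrite /sg1; case=> [|[|[|j]]] //=; rewrite /upd /= cats0 revK.
  by rewrite /= size_rev leq_add2r leq_mul2r xM orbT.
pose S k : store := fun i => if i == 0 then drop k out else if i == 1 then x
  else if i == 3 then unary k else [::].
have szo : size out = n by rewrite size_mkseq.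
have H3 : run_le (Q [::] 3) sg1 (S n) (M ^ d).
  apply: (run_le_eq (Lrun0 [::] 3 sg1 _ _ _ _ _ _)); rewrite ?leM //.
  - by move=> j; rewrite /sg1; case: j => [|[|[|]]].
  - by case=> [|[|[|[|j]]]] //=; rewrite /S /sg1 /upd /= ?drop_oversize ?szo.
have H4 : run_le (While 3 body) (S n) (S 0)
   (n * (1 + ((M + n) ^ c + (4 + ((M + n) ^ c * 3 + 1)))).+2 + 1).
  apply: run_le_while => [k lek|k ltk]; first by rewrite /S /= size_unary.
  have [Ole Orun] := HP x [:: k].
  have mle : insize x [:: k] ^ c <= (M + n) ^ c.
    case: c {HP f He Ole Orun} => // c; rewrite leq_exp2r // /insize /= /M; lia.
  set b := O x [:: k] in Ole Orun.
  have r1 : run_le (Pop 3) (S k.+1) (upd (S k.+1) 3 (unary k)) 1.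
    by apply: run_le_eq (run_le_pop _ _) _ _.
  have r2 : run_le (P [:: 3] 4) (upd (S k.+1) 3 (unary k))
      (upd (upd (S k.+1) 3 (unary k)) 4 (unary b)) ((M + n) ^ c).
    apply: (run_le_eq (Orun _ _ (upd (S k.+1) 3 (unary k)) _ _ _ _ _ _)) mle => //.
    by case=> [|[|[|[|j]]]].
  have r3 : run_le (If3 4 (Push 0 true) (Push 0 false) (Push 0 false))
     (upd (upd (S k.+1) 3 (unary k)) 4 (unary b))
     (upd (upd (S k) 3 (unary k)) 4 (unary b)) 4.
    apply: run_le_if3; rewrite updE.
    have r : run_le (Push 0 (0 < b))
       (upd (upd (S k.+1) 3 (unary k)) 4 (unary b))
       (upd (upd (S k) 3 (unary k)) 4 (unary b)) 2.
      apply: run_le_eq (run_le_push _ _ _) _ _ => // -[|[|[|[|[|j]]]]] //=.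
      rewrite /upd /S /= [RHS](drop_nth false) ?szo //; congr (_ :: _).
      by rewrite nth_mkseq.
    by move: r; case: (b).
  have sz4 : size (upd (upd (S k) 3 (unary k)) 4 (unary b) 4) <= (M + n) ^ c.
    by rewrite updE size_unary (leq_trans Ole).
  apply: run_le_eq (run_le_seq r1 (run_le_seq r2 (run_le_seq r3 (run_le_clear _ _)))) _ _.
    by case=> [|[|[|[|[|j]]]]].
  by rewrite !leq_add // leq_mul.
have [t tT rt] := run_le_seq H1 (run_le_seq H2 (run_le_seq H3 H4)).
exists (S 0), t; split=> //; last by rewrite /S /= drop0.
apply: leq_trans tT (leq_trans _ (He M _)); last by rewrite /M; lia.
have nle : n <= M ^ d by rewrite -leM.
rewrite /f !leq_add // addn2 leq_mul // !ltnS.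
have le : (M + n) ^ c <= (M + M ^ d) ^ c.
  by case: (c) => // c'; rewrite leq_exp2r // leq_add2l.
by rewrite !leq_add // leq_mul.
Qed.

(** * Arithmetic, bounded sums and tests *)

Lemma ptime_bound F : ptime F -> exists2 g, poly_bounded g & forall x s, F x s <= g (insize x s).
Proof.
by move=> [P [c H]]; exists (fun n => n ^ c); [exists c|move=> x s; have [] := H x s].
Qed.

Lemma ptime_prec F G N (H : seq bool -> seq nat -> nat -> nat) g :
  ptime F -> ptime G -> ptime N ->
  (forall x s, H x s 0 = F x s) ->
  (forall x s i, H x s i.+1 = G x (i :: H x s i :: s)) ->
  poly_bounded g -> (forall x s i, i <= N x s -> H x s i <= g (insize x s)) ->
  ptime (fun x s => H x s (N x s)).
Proof.
move=> ptF ptG ptN H0 HS [c Hc] HB; apply: (ptime_rec (c0 := c) ptF ptG ptN) => // x s i lei.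
by apply: leq_trans (HB x s i lei) (Hc _ (insize_gt1 _ _)).
Qed.

Lemma ptime_pred F : ptime F -> ptime (fun x s => (F x s).-1).
Proof.
move=> ptF; have [g pbg gE] := ptime_bound ptF.
apply: (ptime_prec (F := fun _ _ => 0) (G := fun _ s => nth 0 s 0)
  (H := fun x s i => i.-1) (ptime_cst 0) (ptime_var 0) ptF _ _ pbg) => //.
by move=> x s i lei; have := gE x s; lia.
Qed.

Lemma ptime_add F G : ptime F -> ptime G -> ptime (fun x s => F x s + G x s).
Proof.
move=> ptF ptG; have [f pbf fE] := ptime_bound ptF; have [g pbg gE] := ptime_bound ptG.
apply: (ptime_prec (G := fun _ s => (nth 0 s 1).+1)
  (H := fun x s i => F x s + i) ptF (ptime_succ (ptime_var 1)) ptG _ _ (poly_bounded_add pbf pbg)) => /=.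
- by move=> x s; rewrite addn0.
- by move=> x s i; rewrite addnS.
- by move=> x s i lei; rewrite leq_add // (leq_trans lei).
Qed.

Lemma ptime_sub F G : ptime F -> ptime G -> ptime (fun x s => F x s - G x s).
Proof.
move=> ptF ptG; have [f pbf fE] := ptime_bound ptF.
apply: (ptime_prec (G := fun _ s => (nth 0 s 1).-1)
  (H := fun x s i => F x s - i) ptF (ptime_pred (ptime_var 1)) ptG _ _ pbf) => /=.
- by move=> x s; rewrite subn0.
- by move=> x s i; rewrite subnS.
- by move=> x s i lei; apply: leq_trans (leq_subr _ _) _.
Qed.

Lemma ptime_mul F G : ptime F -> ptime G -> ptime (fun x s => F x s * G x s).
Proof.
move=> ptF ptG; have [f pbf fE] := ptime_bound ptF; have [g pbg gE] := ptime_bound ptG.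
apply: (ptime_prec (H := fun x s i => F x s * i) (ptime_cst 0)
  (ptime_add (ptime_behead (ptime_behead ptF)) (ptime_var 1)) ptG _ _ (poly_bounded_mul pbf pbg)) => /=.
- by move=> x s; rewrite muln0.
- by move=> x s i; rewrite mulnS.
- by move=> x s i lei; rewrite leq_mul // (leq_trans lei).
Qed.

(** The arguments of a recursion step are the index, the accumulator and the parameters; the summand
    of a bounded sum must not see the accumulator. *)
Lemma ptime_skip1 F : ptime F -> ptime (fun x s => F x (take 1 s ++ drop 2 s)).
Proof.
move=> [P [c HP]].
have le s : sumn (take 1 s ++ drop 2 s) <= sumn s.
  by case: s => [|a [|b s]] //=; rewrite ?take0 ?drop0 /= leq_add2l leq_addl.
apply: (ptime_pb (P := fun rs m => P (take 1 rs ++ drop 2 rs) m)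
  (f := fun n => n ^ c) (g := fun n => n ^ c)); try by solve_poly_bounded.
  move=> x s; have [H _] := HP x (take 1 s ++ drop 2 s); apply: leq_trans H _.
  by case: c {HP} => // c; rewrite leq_exp2r // leq_add2r leq_add2l.
move=> x s rs m sg m2 rsm rsE E1 E2 Hm.
have [_ H] := HP x (take 1 s ++ drop 2 s).
apply: (run_le_eq (H _ _ sg _ _ _ _ _ _)) => //.
- by apply/allP => r; rewrite mem_cat => /orP[/mem_take|/mem_drop]; move: r; apply/allP.
- by rewrite !map_cat !map_take !map_drop rsE.
- by case: c {HP H} => // c; rewrite leq_exp2r // leq_add2r leq_add2l.
Qed.

Lemma ptime_sum (N : seq bool -> seq nat -> nat) (f : seq bool -> seq nat -> nat -> nat) :
  ptime N -> ptime (fun x s => f x (behead s) (nth 0 s 0)) ->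
  ptime (fun x s => \sum_(0 <= i < N x s) f x s i).
Proof.
move=> ptN Hf_ptime; have [g pbg gE] := ptime_bound ptN; have [h [c hE] fE] := ptime_bound Hf_ptime.
have pbb : poly_bounded (fun n => g n * (n + g n) ^ c) by solve_poly_bounded.
apply: (ptime_prec (H := fun x s n => \sum_(0 <= i < n) f x s i) (ptime_cst 0)
  (ptime_add (ptime_var 1) (ptime_skip1 Hf_ptime)) ptN _ _ pbb) => /=.
- by move=> x s; rewrite big_geq.
- by move=> x s i; rewrite big_nat_recr //= ?take0 ?drop0 addnC.
- move=> x s n len; apply: leq_trans (_ : \sum_(0 <= i < n) (insize x s + g (insize x s)) ^ c <= _).
    rewrite big_nat [leqRHS]big_nat; apply: leq_sum => i /andP[_ lti].
    apply: leq_trans (fE x (i :: s)) (leq_trans (hE _ (insize_gt1 _ _)) _).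
    have le : insize x (i :: s) <= insize x s + g (insize x s).
      by have := gE x s; move: lti len; rewrite /insize /=; lia.
    by case: (c) => // c'; rewrite leq_exp2r.
  by rewrite sum_nat_const_nat subn0 leq_mul2r (leq_trans len) ?orbT.
Qed.

(** Replaces a compound argument by a variable. Under a sum the arguments are shifted by [behead],
    and [ptime_step] follows this shift for variables only. *)
Lemma ptime_1 (g : seq bool -> nat -> nat) : ptime (fun x s => g x (nth 0 s 0)) ->
  forall a, ptime a -> ptime (fun x s => g x (a x s)).
Proof. by move=> Hg a Ha; exact: ptime_comp1 Hg Ha. Qed.

Lemma ptime_2 (g : seq bool -> nat -> nat -> nat) :
  ptime (fun x s => g x (nth 0 s 0) (nth 0 s 1)) ->
  forall a b, ptime a -> ptime b -> ptime (fun x s => g x (a x s) (b x s)).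
Proof. by move=> Hg a b Ha Hb; exact: ptime_comp2 Hg Ha Hb. Qed.

Lemma ptime_bit F : ptime F -> ptime (fun x s => nth false x (F x s)).
Proof. by move=> HF; exact: (ptime_1 (g := fun x i => nth false x i) ptime_bit0 HF). Qed.

Lemma ptime_nth_behead i k : ptime (fun _ s => nth 0 (iter k behead s) i).
Proof.
apply: eq_ptime (ptime_var (k + i)) => x s.
by elim: k i => //= k IH i; rewrite nth_behead -IH addSnnS.
Qed.

Lemma ptime_le F G : ptime F -> ptime G -> ptime (fun x s => F x s <= G x s).
Proof.
move=> ptF ptG; apply: eq_ptime (ptime_sub (ptime_cst 1) (ptime_sub ptF ptG)) => x s.
by case: leqP => ?; lia.
Qed.

Lemma ptime_lt F G : ptime F -> ptime G -> ptime (fun x s => F x s < G x s).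
Proof. by move=> ptF ptG; exact: ptime_le (ptime_succ ptF) ptG. Qed.

Lemma ptime_neg (b : seq bool -> seq nat -> bool) : ptime (fun x s => b x s) -> ptime (fun x s => ~~ b x s).
Proof. by move=> Hb; apply: eq_ptime (ptime_sub (ptime_cst 1) Hb) => x s; case: (b x s). Qed.

Lemma ptime_and (b c : seq bool -> seq nat -> bool) :
  ptime (fun x s => b x s) -> ptime (fun x s => c x s) -> ptime (fun x s => b x s && c x s).
Proof. by move=> Hb Hc; apply: eq_ptime (ptime_mul Hb Hc) => x s; case: (b x s); case: (c x s). Qed.

Lemma ptime_or (b c : seq bool -> seq nat -> bool) :
  ptime (fun x s => b x s) -> ptime (fun x s => c x s) -> ptime (fun x s => b x s || c x s).
Proof.
move=> Hb Hc; apply: eq_ptime (ptime_lt (ptime_cst 0) (ptime_add Hb Hc)) => x s.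
by case: (b x s); case: (c x s).
Qed.

Lemma ptime_eq F G : ptime F -> ptime G -> ptime (fun x s => F x s == G x s).
Proof.
move=> ptF ptG; apply: eq_ptime (ptime_and (ptime_le ptF ptG) (ptime_le ptG ptF)) => x s.
by rewrite eqn_leq.
Qed.

Lemma ptime_if (b : seq bool -> seq nat -> bool) F G :
  ptime (fun x s => b x s) -> ptime F -> ptime G -> ptime (fun x s => if b x s then F x s else G x s).
Proof.
move=> Hb HF HG.
apply: eq_ptime (ptime_add (ptime_mul Hb HF) (ptime_mul (ptime_neg Hb) HG)) => x s.
by case: (b x s); rewrite ?mul1n ?mul0n ?addn0.
Qed.

Lemma ptime_ifb (b : seq bool -> seq nat -> bool) (F G : seq bool -> seq nat -> bool) :
  ptime (fun x s => b x s) -> ptime (fun x s => F x s) -> ptime (fun x s => G x s) ->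
  ptime (fun x s => if b x s then F x s else G x s).
Proof. by move=> Hb HF HG; apply: eq_ptime (ptime_if Hb HF HG) => x s; case: (b x s). Qed.

(** A hook for [ptime_step], redefined once division and its companions are available. *)
Ltac ptime_user := fail.

Ltac ptime_step := match goal with
  | |- ptime (fun _ s => nth 0 s ?i) => exact: ptime_var
  | |- ptime (fun _ s => nth 0 (behead s) ?i) => exact: (ptime_nth_behead i 1)
  | |- ptime (fun _ s => nth 0 (behead (behead s)) ?i) => exact: (ptime_nth_behead i 2)
  | |- ptime (fun _ s => nth 0 (behead (behead (behead s))) ?i) => exact: (ptime_nth_behead i 3)
  | |- ptime (fun _ s => nth 0 (behead (behead (behead (behead s)))) ?i) => exact: (ptime_nth_behead i 4)
  | |- ptime (fun _ _ => ?k) => exact: ptime_cst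
  | |- ptime (fun x _ => size x) => exact: ptime_len
  | |- _ => assumption
  | |- _ => ptime_user
  | |- ptime (fun x s => nat_of_bool (nth false x _)) => apply: ptime_bit
  | |- ptime (fun x s => _.+1) => apply: ptime_succ
  | |- ptime (fun x s => _.-1) => apply: ptime_pred
  | |- ptime (fun x s => addn _ _) => apply: ptime_add
  | |- ptime (fun x s => subn _ _) => apply: ptime_sub
  | |- ptime (fun x s => muln _ _) => apply: ptime_mul
  | |- ptime (fun x s => \sum_(0 <= i < _) _) => apply: ptime_sum
  | |- ptime (fun x s => nat_of_bool (leq _.+1 _)) => apply: ptime_lt
  | |- ptime (fun x s => nat_of_bool (leq _ _)) => apply: ptime_le
  | |- ptime (fun x s => nat_of_bool (~~ _)) => apply: ptime_neg
  | |- ptime (fun x s => nat_of_bool (_ && _)) => apply: ptime_and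
  | |- ptime (fun x s => nat_of_bool (_ || _)) => apply: ptime_or
  | |- ptime (fun x s => nat_of_bool (_ == _)) => apply: ptime_eq
  | |- ptime (fun x s => nat_of_bool (if _ then _ else _)) => apply: ptime_ifb
  | |- ptime (fun x s => if _ then _ else _) => apply: ptime_if
  end.

Ltac ptime_solve := repeat ptime_step.

Lemma count_lt_sum n m : \sum_(0 <= i < n) (i < m) = minn n m.
Proof.
elim: n => [|n IH]; first by rewrite big_geq // min0n.
by rewrite big_nat_recr //= IH; case: ltnP; lia.
Qed.

Lemma ptime_div F G : ptime F -> ptime G -> ptime (fun x s => F x s %/ G x s).
Proof.
move=> HF HG; apply: (ptime_2 (g := fun _ a b => a %/ b)) => //.
(* The quotient is the number of positive multiples of the divisor up to the dividend; the first
   factor gives the value 0 for a zero divisor. *)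
apply: (eq_ptime (F := fun _ s => (0 < nth 0 s 1) *
   \sum_(0 <= i < nth 0 s 0) (i.+1 * nth 0 s 1 <= nth 0 s 0))); last by ptime_solve.
move=> _ s; case: (posnP (nth 0 s 1)) => [->|b0]; first by rewrite divn0.
rewrite mul1n; under eq_bigr do rewrite -leq_divRL //.
by rewrite count_lt_sum; apply/minn_idPr; apply: leq_div.
Qed.

Lemma ptime_mod F G : ptime F -> ptime G -> ptime (fun x s => F x s %% G x s).
Proof.
move=> HF HG.
apply: (eq_ptime (F := fun x s => F x s - F x s %/ G x s * G x s)).
  by move=> x s; rewrite {1}(divn_eq (F x s) (G x s)) addKn.
by apply: ptime_sub => //; apply: ptime_mul => //; apply: ptime_div.
Qed.

Lemma ptime_odd F : ptime F -> ptime (fun x s => odd (F x s)).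
Proof.
by move=> HF; apply: eq_ptime (ptime_mod HF (ptime_cst 2)) => x s; rewrite modn2.
Qed.

Lemma ptime_exp F k : ptime F -> ptime (fun x s => F x s ^ k).
Proof.
move=> HF; elim: k => [|k IH]; first by apply: eq_ptime (ptime_cst 1) => x s; rewrite expn0.
by apply: eq_ptime (ptime_mul HF IH) => x s; rewrite expnS.
Qed.

Lemma ptime_iter_half F G : ptime F -> ptime G -> ptime (fun x s => iter (G x s) half (F x s)).
Proof.
move=> HF HG; have [g pbg gE] := ptime_bound HF.
apply: (ptime_prec (H := fun x s i => iter i half (F x s)) HF
  (ptime_div (ptime_var 1) (ptime_cst 2)) HG _ _ pbg) => //= x s i.
  by rewrite divn2.
move=> _; apply: leq_trans (gE x s); elim: i => //= i IH; lia.
Qed.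

Lemma ptime_table (l : seq nat) F : ptime F -> ptime (fun x s => nth 0 l (F x s)).
Proof.
move=> HF; elim: l F HF => [|a l IH] F HF.
  by apply: eq_ptime (ptime_cst 0) => x s; rewrite nth_nil.
apply: (eq_ptime (F := fun x s => if F x s == 0 then a else nth 0 l (F x s).-1)).
  by move=> x s; case: (F x s).
by apply: ptime_if; [ptime_solve|ptime_solve|apply/IH/ptime_pred].
Qed.

Lemma ptime_tableb (l : seq bool) F : ptime F -> ptime (fun x s => nth false l (F x s)).
Proof.
move=> HF; apply: eq_ptime (ptime_table [seq nat_of_bool b | b <- l] HF) => x s.
by elim: l (F x s) => [|a l IH] [|n] /=.
Qed.

Ltac ptime_arith := match goal with
  | |- ptime (fun x s => divn _ _) => apply: ptime_div
  | |- ptime (fun x s => modn _ _) => apply: ptime_mod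
  | |- ptime (fun x s => expn _ _) => apply: ptime_exp
  | |- ptime (fun x s => nat_of_bool (odd _)) => apply: ptime_odd
  | |- ptime (fun x s => iter _ half _) => apply: ptime_iter_half
  end.

Ltac ptime_user ::= ptime_arith.

(** * The bits of an encoded degree sequence *)

Definition bit_length d := \sum_(0 <= k < d) (0 < iter k half d).

Lemma nth_bits d k : nth false (bits d) k = odd (iter k half d).
Proof.
rewrite /bits; have : d <= d by [].
move: {2 3}d => m; elim: m d k => [|m IH] d k.
  rewrite leqn0 => /eqP->; rewrite /= nth_nil.
  by have -> : iter k half 0 = 0 by elim: k => //= k ->.
move=> led /=; case: (eqVneq d 0) => [->|d0].
  rewrite nth_nil; have -> : iter k half 0 = 0 by elim: k => //= k ->.
  by [].
case: k => [|k] /=; first by []. rewrite IH; last by lia.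
by rewrite -iterSr.
Qed.

Lemma size_bits d : size (bits d) = bit_length d.
Proof.
rewrite /bits /bit_length; have : d <= d by [].
move: {2 3 5}d => m; elim: m d => [|m IH] d led; first by rewrite big_geq.
rewrite big_nat_recl //=; case: (eqVneq d 0) => [->|d0].
  rewrite big1 // => i _; have -> : iter i half 0 = 0 by elim: i => //= i ->.
  by [].
rewrite /= IH; last by lia.
rewrite lt0n d0 add1n; congr _.+1; apply: eq_bigr => i _; by rewrite -iterSr.
Qed.

Definition code_len d := 2 * bit_length d + 1.

Definition code_bit d k :=
  (k < 2 * bit_length d) && (if odd k then odd (iter (k %/ 2) half d) else true).

Lemma size_self_delimit w : size (self_delimit w) = 2 * size w + 1.
Proof.
rewrite size_cat /=; congr (_ + _).
by elim: w => //= b w ->; rewrite mulnS.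
Qed.

Lemma nth_self_delimit w k : nth false (self_delimit w) k =
  (k < 2 * size w) && (if odd k then nth false w (k %/ 2) else true).
Proof.
rewrite /self_delimit; elim: w k => [|b w IH] k /=; first by case: k => [|[|k]].
case: k => [|[|k]] /=; rewrite ?mulnS // IH negbK.
by rewrite !ltnS !divn2.
Qed.

Definition code_off (f : nat -> nat) v := \sum_(0 <= u < v) code_len (f u).

(** A disjunction over the entries, written as a sum. The entries whose code ends before [i]
    contribute nothing, because [code_bit] is false past the end. *)
Definition encode_bit (f : nat -> nat) n i :=
  0 < \sum_(0 <= v < n) ((code_off f v <= i) && code_bit (f v) (i - code_off f v)).

Lemma encode_seq_mkseqS f n : encode_seq (mkseq f n.+1) =
  encode_seq (mkseq f n) ++ self_delimit (bits (f n)).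
Proof.
rewrite /encode_seq /mkseq -addn1 iotaD !map_cat flatten_cat /=.
by rewrite add0n cats0.
Qed.

Lemma size_encode_mkseq f n : size (encode_seq (mkseq f n)) = code_off f n.
Proof.
rewrite /code_off; elim: n => [|n IH]; first by rewrite big_geq.
by rewrite encode_seq_mkseqS size_cat IH big_nat_recr //= size_self_delimit size_bits.
Qed.

Lemma code_offS f n : code_off f n.+1 = code_off f n + code_len (f n).
Proof. by rewrite /code_off big_nat_recr. Qed.

Lemma leq_code_off f v n : v <= n -> code_off f v <= code_off f n.
Proof.
elim: n => [|n IH]; first by rewrite leqn0 => /eqP->.
by rewrite leq_eqVlt => /predU1P[-> //|/IH le]; rewrite code_offS (leq_trans le) ?leq_addr.
Qed.

Lemma nth_encode_mkseq f n i :
  nth false (encode_seq (mkseq f n)) i = encode_bit f n i.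
Proof.
rewrite /encode_bit; elim: n => [|n IH]; first by rewrite big_geq // nth_nil.
rewrite encode_seq_mkseqS nth_cat size_encode_mkseq big_nat_recr //=.
case: ltnP => [lt|le]; first by rewrite /= addn0 -IH.
rewrite big_nat big1 ?add0n; last first.
  move=> v /andP[_ ltvn]; rewrite /code_bit.
  have := leq_code_off f ltvn; rewrite code_offS /code_len => le2.
  by have /negbTE-> : ~~ (i - code_off f v < 2 * bit_length (f v)); [lia|rewrite andbF].
rewrite nth_self_delimit size_bits nth_bits /= /code_bit.
by case: (_ && _).
Qed.

Lemma ptime_bit_length F : ptime F -> ptime (fun x s => bit_length (F x s)).
Proof.
move=> HF; apply: (ptime_1 (g := fun _ d => bit_length d)) => //.
by rewrite /bit_length; ptime_solve.
Qed.

Section EncodePtime.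
Variables (f : seq bool -> nat -> nat) (n : seq bool -> seq nat -> nat).
Hypotheses (Hf_ptime : ptime (fun x s => f x (nth 0 s 0))) (Hn_ptime : ptime n).

Local Lemma Hf1_ptime a : ptime a -> ptime (fun x s => f x (a x s)).
Proof. exact: ptime_1. Qed.

Lemma ptime_code_off a : ptime a -> ptime (fun x s => code_off (f x) (a x s)).
Proof.
apply: (ptime_1 (g := fun x v => code_off (f x) v)).
rewrite /code_off /code_len; ptime_solve; apply: ptime_bit_length; apply: Hf1_ptime; ptime_solve.
Qed.

Lemma ptime_code_bit F G : ptime F -> ptime G -> ptime (fun x s => code_bit (F x s) (G x s)).
Proof.
apply: (ptime_2 (g := fun x d k => code_bit d k)).
by rewrite /code_bit; ptime_solve; apply: ptime_bit_length; ptime_solve.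
Qed.

Lemma ptime_encode_bit a : ptime a -> ptime (fun x s => encode_bit (f x) (n x s) (a x s)).
Proof.
move=> Ha_ptime; rewrite /encode_bit; ptime_solve.
- by apply: ptime_code_off; ptime_solve.
- by apply: ptime_behead.
- apply: ptime_code_bit; first by apply: Hf1_ptime; ptime_solve.
  by apply: ptime_sub; [apply: ptime_behead|apply: ptime_code_off; ptime_solve].
Qed.

End EncodePtime.

Lemma encode_seq_polytime (f : seq bool -> nat -> nat) (n : seq bool -> nat) :
  ptime (fun x s => f x (nth 0 s 0)) -> ptime (fun x _ => n x) ->
  polytime (fun x => encode_seq (mkseq (f x) (n x))).
Proof.
move=> Hf_ptime Hn_ptime.
have -> : (fun x => encode_seq (mkseq (f x) (n x))) =
    fun x => mkseq (fun i => 0 < encode_bit (f x) (n x) i) (code_off (f x) (n x)).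
  apply/funext => x; apply: (@eq_from_nth _ false).
    by rewrite size_mkseq size_encode_mkseq.
  move=> i lti; rewrite nth_encode_mkseq nth_mkseq -?size_encode_mkseq //.
  by case: encode_bit.
apply: (ptime_polytime (O := fun x s => encode_bit (f x) (n x) (nth 0 s 0))
  (L := fun x _ => code_off (f x) (n x))).
  by apply: (ptime_encode_bit (n := fun x _ => n x)) => //; ptime_solve.
by apply: ptime_code_off.
Qed.

Lemma bool_polytime (b : seq bool -> bool) : ptime (fun x _ => b x) ->
  polytime (fun x => [:: b x]).
Proof.
move=> Hb_ptime; have := ptime_polytime Hb_ptime (ptime_cst 1).
congr (polytime _); apply/funext => x /=; rewrite /mkseq /=.
by case: (b x).
Qed.

(** * Hypergraphs as predicates on increasing triples *)

Definition tdeg n (h : nat -> nat -> nat -> bool) v :=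
  \sum_(0 <= c < n) \sum_(0 <= b < c) \sum_(0 <= a < b)
    h a b c * ((v == a) + (v == b) + (v == c)).

Section Triples.
Variable n : nat.
Let T := ('I_n * 'I_n * 'I_n)%type.
Implicit Type t : T.

Definition sorted3 t := (t.2 < t.1.2) && (t.1.2 < t.1.1).
Definition set_of3 t : {set 'I_n} := [set t.2; t.1.2; t.1.1].

Lemma sum3_ord (F : nat -> nat -> nat -> nat) :
  \sum_(0 <= c < n) \sum_(0 <= b < c) \sum_(0 <= a < b) F a b c =
  \sum_(t | sorted3 t) F t.2 t.1.2 t.1.1.
Proof.
rewrite big_mkord.
transitivity (\sum_(c < n) \sum_(b < n | b < c) \sum_(a < n | a < b) F a b c).
  apply: eq_bigr => c _.
  rewrite (big_nat_widen 0 c n) ?(ltnW (ltn_ord c)) // big_mkord.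
  apply: eq_bigr => b _.
  by rewrite (big_nat_widen 0 b n) ?(ltnW (ltn_ord b)) // big_mkord.
rewrite pair_big_dep pair_big_dep /=; apply: eq_bigl => t.
by rewrite /sorted3 andbC.
Qed.

Lemma tdeg_ord h (v : 'I_n) : tdeg n h v =
  \sum_(t | sorted3 t) h t.2 t.1.2 t.1.1 * (v \in set_of3 t).
Proof.
rewrite /tdeg sum3_ord; apply: eq_bigr => t.
move=> /andP[lt1 lt2]; congr (_ * _); rewrite !inE -!val_eqE /=; lia.
Qed.

Lemma set_of3_inj : {in sorted3 &, injective set_of3}.
Proof.
move=> [[c b] a] [[c' b'] a']; rewrite !unfold_in /sorted3 /= => /andP[ab bc] /andP[ab' bc'] /setP E.
have E1 := E a; have E2 := E c; have E3 := E a'; have E4 := E c'; have E5 := E b.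
rewrite !inE /= -!val_eqE /= !eqxx ?orbT /= in E1 E2 E3 E4 E5.
have aa : a = a' :> nat by clear E2 E4 E5; lia.
have cc : c = c' :> nat by clear E1 E3 E5; lia.
have bb : b = b' :> nat by clear E1 E2 E3 E4; lia.
by congr (_, _, _); apply: val_inj.
Qed.

Lemma card_set_of3 t : sorted3 t -> #|set_of3 t| = 3.
Proof.
case: t => [[c b] a] /andP[/= ab bc]; rewrite /set_of3 /= -finset.setUA !cardsU1 cards1 !inE -!val_eqE /=.
by rewrite !(ltn_eqF ab) ?(ltn_eqF bc) ?(ltn_eqF (ltn_trans ab bc)).
Qed.

Lemma set_of3_surj (e : {set 'I_n}) : #|e| = 3 -> exists2 t, sorted3 t & set_of3 t = e.
Proof.
move=> e3; have : size (enum e) = 3 by rewrite -cardE.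
have so : sorted ltn [seq val i | i <- enum e].
  apply: (subseq_sorted ltn_trans (s2 := [seq val i | i <- enum 'I_n])).
    by apply: map_subseq; rewrite enumT; apply: filter_subseq.
  by rewrite val_enum_ord iota_ltn_sorted.
case E : (enum e) so => [|a [|b [|c [|]]]] //= /and3P[ab bc _] _.
exists (c, b, a); first by rewrite /sorted3 /= ab.
by apply/setP => i; rewrite -[RHS]mem_enum E !inE orbA.
Qed.

End Triples.

Lemma realizableP D : realizable D <->
  exists h, forall v, v < size D -> tdeg (size D) h v = nth 0 D v.
Proof.
set n := size D; split=> [[E [uE dE]]|[h hE]].
  (* The arguments of [h] are naturals rather than ordinals, so the edge is described by its
     members. *)
  pose h a b c := [exists e in E, [forall i : 'I_n, (i \in e) ==
    [|| i == a :> nat, i == b :> nat | i == c :> nat]]].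
  have hS (t : 'I_n * 'I_n * 'I_n) : h t.2 t.1.2 t.1.1 = (set_of3 t \in E).
    apply/existsP/idP => [[e /andP[eE /forallP eP]]|tE].
      suff <- : e = set_of3 t by [].
      by apply/setP => i; rewrite (eqP (eP i)) !inE orbA.
    by exists (set_of3 t); rewrite tE; apply/forallP => i; rewrite !inE orbA.
  exists h => v ltv; rewrite -[v]/(val (Ordinal ltv)) -dE tdeg_ord /degree -sum1_card.
  set w := Ordinal ltv.
  have EE : E = [set set_of3 t | t in [set t | sorted3 t && (set_of3 t \in E)]].
    apply/setP => e; apply/idP/imsetP => [eE|[t]]; last by rewrite inE => /andP[_ tE] ->.
    by have [t st tE] := set_of3_surj (uE _ eE); exists t; rewrite // inE st tE.
  under eq_bigr do rewrite hS.
  transitivity (\sum_(e in E) (w \in e)); last first.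
    by rewrite big_mkcond [RHS]big_mkcond; apply: eq_bigr => e _; rewrite !inE; case: (e \in E); case: (w \in e).
  rewrite {2}EE big_imset /=; last first.
    by move=> t t'; rewrite !inE => /andP[st _] /andP[st' _]; apply: set_of3_inj.
  rewrite big_mkcond [RHS]big_mkcond; apply: eq_bigr => t _.
  by rewrite [t \in _]inE; case: sorted3 => //=; case: (_ \in E); rewrite ?mul1n.
pose A := [set t : 'I_n * 'I_n * 'I_n | sorted3 t && h t.2 t.1.2 t.1.1].
exists [set set_of3 t | t in A]; split=> [e /imsetP[t]|v].
  by rewrite inE => /andP[st _] ->; apply: card_set_of3.
rewrite -hE // tdeg_ord /degree -sum1_card.
transitivity (\sum_(e in [set set_of3 t | t in A]) (v \in e)).
  by rewrite big_mkcond [RHS]big_mkcond; apply: eq_bigr => e _; rewrite !inE; case: (e \in _); case: (v \in e).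
rewrite big_imset /=; last first.
  by move=> t t'; rewrite !inE => /andP[st _] /andP[st' _]; apply: set_of3_inj.
rewrite big_mkcond [RHS]big_mkcond; apply: eq_bigr => t _.
by rewrite [t \in _]inE; case: sorted3 => //=; case: (h _ _ _); rewrite ?mul1n.
Qed.

Lemma sum_pred1 n (F : nat -> nat) v :
  \sum_(0 <= a < n) F a * (v == a) = (v < n) * F v.
Proof.
elim: n => [|n IH]; first by rewrite big_geq.
rewrite big_nat_recr //= IH ltnS [v <= n]leq_eqVlt.
by case: eqP => [->|_]; rewrite ?ltnn ?muln1 ?mul1n ?muln0 ?addn0.
Qed.

Lemma tdegE n h v : v < n -> tdeg n h v = \sum_(0 <= c < n) \sum_(0 <= b < c)
  ((v < b) * h v b c + ((b < v) && (v < c)) * h b v c + (c < v) * h b c v).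
Proof.
move=> vn; rewrite /tdeg.
have -> : \sum_(0 <= c < n) \sum_(0 <= b < c) \sum_(0 <= a < b)
    h a b c * ((v == a) + (v == b) + (v == c)) =
  \sum_(0 <= c < n) \sum_(0 <= b < c) ((v < b) * h v b c) +
  \sum_(0 <= c < n) \sum_(0 <= b < c) (\sum_(0 <= a < b) h a b c) * (v == b) +
  \sum_(0 <= c < n) (\sum_(0 <= b < c) \sum_(0 <= a < b) h a b c) * (v == c).
  rewrite -!big_split; apply: eq_bigr => c _ /=.
  rewrite big_distrl -!big_split; apply: eq_bigr => b _ /=.
  rewrite -(sum_pred1 b (fun a => h a b c)) !big_distrl -!big_split.
  by apply: eq_bigr => a _ /=; rewrite !mulnDr.
rewrite sum_pred1 vn mul1n.
under [X in _ + X + _]eq_bigr do rewrite sum_pred1.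
have wid (F : nat -> nat -> nat) : \sum_(0 <= b < v) \sum_(0 <= a < b) F b a =
    \sum_(0 <= c < n) \sum_(0 <= b < c) (c < v) * F c b.
  rewrite (big_nat_widen _ _ _ _ _ (ltnW vn)) big_mkcond /=.
  by apply: eq_bigr => c _; case: ltnP => _; [apply: eq_bigr => b _; rewrite mul1n|rewrite big1].
rewrite wid -!big_split; apply: eq_bigr => c _ /=.
rewrite 2!big_split /=; congr (_ + _ + _); case: ltnP => [vc|_]; last first.
  by rewrite mul0n big1 // => b _; rewrite andbF.
rewrite mul1n (big_nat_widen _ _ _ _ _ (ltnW vc)) big_mkcond /=.
by apply: eq_bigr => b _; rewrite andbT; case: ltnP; rewrite ?mul1n.
Qed.

Definition sym3 (h : nat -> nat -> nat -> bool) :=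
  (forall a b c, h a b c = h b a c) /\ (forall a b c, h a b c = h a c b).

Lemma tdeg_sym n h v : v < n -> sym3 h ->
  tdeg n h v = \sum_(0 <= c < n) \sum_(0 <= b < c) [&& b != v, c != v & h v b c].
Proof.
move=> vn [h1 h2]; rewrite tdegE //; apply: eq_bigr => c _.
rewrite big_nat [RHS]big_nat; apply: eq_bigr => b /andP[_ bc].
have <- : h v b c = h b v c by rewrite h1.
have <- : h v b c = h b c v by rewrite h1 h2.
by case: (h v b c); lia.
Qed.

Lemma count_pairs n v :
  \sum_(0 <= c < n) \sum_(0 <= b < c) ((b != v) && (c != v)) = 'C(n - (v < n), 2).
Proof.
elim: n => [|n IH]; first by rewrite big_geq.
rewrite big_nat_recr //= IH.
have cnt m : \sum_(0 <= b < m) (b != v) = m - (v < m).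
  elim: m => [|m IHm]; first by rewrite big_geq.
  by rewrite big_nat_recr //= IHm; lia.
have [<-|nv] := eqVneq n v.
  by rewrite big1 ?addn0 => [|i _]; rewrite ?andbF // ltnn ltnSn subn0 subn1.
under eq_bigr do rewrite andbT.
rewrite cnt; have [vn|nv'] := ltnP v n; last first.
  have -> : (v < n.+1) = false by lia.
  by rewrite !subn0 binS bin1.
rewrite (_ : v < n.+1) ?ltnS ?(ltnW vn) // !subn1 /=.
by case: n vn {IH nv} => // n _; rewrite binS bin1.
Qed.

Lemma tdeg_complement n h v : v < n ->
  tdeg n (fun a b c => ~~ h a b c) v + tdeg n h v = 'C(n.-1, 2).
Proof.
move=> vn; have -> : n.-1 = n - (v < n) by rewrite vn subn1.
rewrite -count_pairs.
transitivity (tdeg n (fun _ _ _ => true) v); last first.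
  rewrite tdeg_sym //; apply: eq_bigr => c _; apply: eq_bigr => b _.
  by rewrite andbT.
rewrite /tdeg -big_split; apply: eq_bigr => c _ /=.
rewrite -big_split; apply: eq_bigr => b _ /=.
rewrite -big_split; apply: eq_bigr => a _ /=.
by case: (h a b c); lia.
Qed.

(** * Membership in NP *)

Lemma eq_tdeg n h h' v :
  (forall a b c, a < b -> b < c -> c < n -> h a b c = h' a b c) ->
  tdeg n h v = tdeg n h' v.
Proof.
move=> E; rewrite /tdeg big_nat [RHS]big_nat; apply: eq_bigr => c /andP[_ cn].
rewrite big_nat [RHS]big_nat; apply: eq_bigr => b /andP[_ bc].
rewrite big_nat [RHS]big_nat; apply: eq_bigr => a /andP[_ ab].
by rewrite E.
Qed.

(* A certificate is the list of the edges as a bit table. The verifier compares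
   the encoding of its degrees with the input: no number needs to be decoded. *)
Definition word_len (x : seq bool) :=
  \sum_(0 <= i < size x) (\sum_(0 <= k < i.+1) ~~ nth false x (2 * k) == 0).

Definition cert_len x := size x - (2 * word_len x + 1).

(** The integer cube root: a certificate for [n] vertices is a table of [n ^ 3] bits. *)
Definition cert_n x := \sum_(0 <= k < cert_len x) (k.+1 ^ 3 <= cert_len x).

Definition cert_h x a b c :=
  nth false x (2 * word_len x + 1 + ((a * cert_n x + b) * cert_n x + c)).

Definition cert_deg x v := tdeg (cert_n x) (cert_h x) v.

Definition verifier x :=
  (code_off (cert_deg x) (cert_n x) == word_len x) &&
  (\sum_(0 <= i < word_len x)
     ~~ (encode_bit (cert_deg x) (cert_n x) i == nth false x (2 * i + 1) :> nat) == 0).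

Lemma ptime_word_len : ptime (fun x _ => word_len x).
Proof. by rewrite /word_len; ptime_solve. Qed.

Lemma ptime_cert_len : ptime (fun x _ => cert_len x).
Proof. by rewrite /cert_len; ptime_solve; exact: ptime_word_len. Qed.

Lemma ptime_cert_n : ptime (fun x _ => cert_n x).
Proof. by rewrite /cert_n; ptime_solve; exact: ptime_cert_len. Qed.

Lemma ptime_cert_deg : ptime (fun x s => cert_deg x (nth 0 s 0)).
Proof.
rewrite /cert_deg /tdeg /cert_h; ptime_solve; first [exact: ptime_cert_n|exact: ptime_word_len].
Qed.

Lemma verifier_polytime : polytime (fun x => [:: verifier x]).
Proof.
apply: bool_polytime; rewrite /verifier; ptime_solve; try exact: ptime_word_len.
  exact: (ptime_code_off (f := cert_deg) (a := fun x _ => cert_n x) ptime_cert_deg ptime_cert_n).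
exact: (ptime_encode_bit (f := cert_deg) (n := fun x _ => cert_n x)
  ptime_cert_deg ptime_cert_n (ptime_var 0)).
Qed.

Section EncodePair.
Variables w y : seq bool.
Let x := encode_pair w y.

Lemma nth_encode_pair i : nth false x i =
  if i < 2 * size w + 1 then nth false (self_delimit w) i else nth false y (i - (2 * size w + 1)).
Proof. by rewrite /x /encode_pair nth_cat size_self_delimit. Qed.

Lemma nth_encode_pair_odd i : i < size w -> nth false x (2 * i + 1) = nth false w i.
Proof.
move=> iw; rewrite nth_encode_pair nth_self_delimit !ifT; last 2 first.
- by rewrite oddD mul2n odd_double.
- by lia.
rewrite (_ : 2 * i + 1 < 2 * size w); last by lia.
by rewrite [2 * i]mulnC divnMDl // divn_small // addn0.
Qed.

(** The even positions of a self-delimited word are its continuation flags, and the first one which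
    is false is at [2 * size w]: counting the prefixes of true flags recovers the length. *)
Lemma word_len_encode_pair : word_len x = size w.
Proof.
have szx : size x = 2 * size w + 1 + size y by rewrite size_cat size_self_delimit.
transitivity (\sum_(0 <= i < size x) (i < size w)); last first.
  by rewrite count_lt_sum szx; apply/minn_idPr; lia.
have nE k : k <= size w -> nth false x (2 * k) = (k < size w).
  move=> kw; rewrite nth_encode_pair ifT; last by lia.
  rewrite nth_self_delimit mul2n odd_double andbT; lia.
apply: eq_bigr => i _; congr nat_of_bool; apply/idP/idP => [/eqP s0|iw].
  rewrite ltnNge; apply/negP => wi; move: s0; rewrite -[i.+1]subn0.
  rewrite (big_cat_nat (n := size w)) //=; last by lia.
  by rewrite (@big_ltn _ _ _ (size w)) ?nE ?ltnn //=; lia.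
rewrite big_nat big1 // => k /andP[_ ki].
by rewrite nE ?(leq_trans ki) // ltnW // (leq_trans ki).
Qed.

Lemma cert_len_encode_pair : cert_len x = size y.
Proof.
rewrite /cert_len word_len_encode_pair /x /encode_pair size_cat size_self_delimit; lia.
Qed.

Lemma verifier_encode_pair : verifier x =
  (w == encode_seq (mkseq (cert_deg x) (cert_n x))).
Proof.
rewrite /verifier word_len_encode_pair; set f := cert_deg x; set n := cert_n x.
apply/andP/eqP => [[/eqP sz /eqP s0]|wE].
  apply: (@eq_from_nth _ false) => [|i iw]; first by rewrite size_encode_mkseq.
  rewrite nth_encode_mkseq -nth_encode_pair_odd //.
  have := s0; rewrite (bigD1_seq i) ?mem_index_iota ?iota_uniq //= -/x.
  by case: encode_bit; case: nth.
split; first by rewrite {1}wE size_encode_mkseq.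
apply/eqP; rewrite big_nat big1 // => i /andP[_ iw].
by rewrite nth_encode_pair_odd // {1}wE nth_encode_mkseq eqxx.
Qed.

Lemma cert_n_encode_pair n : size y = n ^ 3 -> cert_n x = n.
Proof.
move=> szy; rewrite /cert_n cert_len_encode_pair szy.
under eq_bigr do rewrite leq_exp2r //.
rewrite count_lt_sum; apply/minn_idPr.
by case: (n) => // n'; rewrite -[leqLHS]expn1 leq_pexp2l.
Qed.

End EncodePair.

Lemma leq_code_off_id f n : n <= code_off f n.
Proof. by elim: n => // n IH; rewrite code_offS /code_len; lia. Qed.

(** Each entry takes at least one bit, so [n <= size w] and the table of [n ^ 3] bits is short
    enough. Conversely an accepted table yields degrees with the same encoding as the input, and the
    encoding is injective. *)
Lemma HDS3_in_NP (R : realType) (c1 c2 : R) : in_NP (HDS3 c1 c2).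
Proof.
exists verifier, 3; split; first exact: verifier_polytime.
move=> w [D Dcl wE]; split=> [[D' [cl rD] wE']|[y ley]]; last first.
  rewrite verifier_encode_pair => /eqP wE'.
  set x := encode_pair w y in wE'; exists D => //; split=> //.
  have -> : D = mkseq (cert_deg x) (cert_n x) by apply: encode_seq_inj; rewrite -wE.
  by apply/realizableP; exists (cert_h x) => v; rewrite size_mkseq => vn; rewrite nth_mkseq.
have [h hE] := (realizableP D').1 rD; set n := size D' in hE.
pose y := mkseq (fun i => h (i %/ n %/ n) ((i %/ n) %% n) (i %% n)) (n ^ 3).
have szy : size y = n ^ 3 by rewrite size_mkseq.
have len : n <= size w.
  rewrite wE' -[in encode_seq _](mkseq_nth 0 D') size_encode_mkseq.
  exact: leq_code_off_id.
exists y.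
  rewrite szy /poly_bound; have := len; rewrite -(@leq_exp2r _ _ 3) //; lia.
have nE : cert_n (encode_pair w y) = n by exact: cert_n_encode_pair.
rewrite verifier_encode_pair nE; apply/eqP; rewrite [LHS]wE'; congr encode_seq.
apply: (@eq_from_nth _ 0) => [|v vn]; first by rewrite size_mkseq.
rewrite nth_mkseq // -hE // /cert_deg nE; apply: eq_tdeg => a b c ab bc cn.
have n0 : 0 < n by lia.
have lt : (a * n + b) * n + c < n ^ 3.
  have : a * n + b < n * n by nia.
  by rewrite !expnS expn0 muln1 => ?; nia.
rewrite /cert_h nE word_len_encode_pair nth_encode_pair ifF; last by lia.
rewrite addKn nth_mkseq // divnMDl // (divn_small cn) addn0 divnMDl // divn_small ?addn0; last by lia.
by rewrite !modnMDl !modn_small //; lia.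
Qed.

(** * Threshold hypergraphs *)

Lemma eq_sum_leq n (f g : nat -> nat) : (forall i, i < n -> f i <= g i) ->
  \sum_(0 <= i < n) f i = \sum_(0 <= i < n) g i -> forall i, i < n -> f i = g i.
Proof.
elim: n => // n IH le; rewrite !big_nat_recr //= => E.
have les : \sum_(0 <= i < n) f i <= \sum_(0 <= i < n) g i.
  by rewrite big_nat [leqRHS]big_nat; apply: leq_sum => i /andP[_ lti]; apply: le; apply: ltnW.
have len := le n (ltnSn n).
have E1 : \sum_(0 <= i < n) f i = \sum_(0 <= i < n) g i by lia.
have E2 : f n = g n by lia.
move=> i; rewrite ltnS leq_eqVlt => /predU1P[->|lti] //.
by apply: IH => // k ltk; apply: le; apply: ltnW.
Qed.

Definition sum3 n (F : nat -> nat -> nat -> nat) :=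
  \sum_(0 <= c < n) \sum_(0 <= b < c) \sum_(0 <= a < b) F a b c.

Lemma eq_sum3 n F G : (forall a b c, a < b -> b < c -> c < n -> F a b c = G a b c) ->
  sum3 n F = sum3 n G.
Proof.
move=> E; rewrite /sum3 big_nat [RHS]big_nat; apply: eq_bigr => c /andP[_ cn].
rewrite big_nat [RHS]big_nat; apply: eq_bigr => b /andP[_ bc].
rewrite big_nat [RHS]big_nat; apply: eq_bigr => a /andP[_ ab].
by rewrite E.
Qed.

Lemma sum3D n F G : sum3 n (fun a b c => F a b c + G a b c) = sum3 n F + sum3 n G.
Proof.
rewrite /sum3 -big_split; apply: eq_bigr => c _ /=.
by rewrite -big_split; apply: eq_bigr => b _ /=; rewrite -big_split.
Qed.

Lemma sum3M n F k : sum3 n (fun a b c => k * F a b c) = k * sum3 n F.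
Proof.
rewrite /sum3 big_distrr; apply: eq_bigr => c _ /=.
by rewrite big_distrr; apply: eq_bigr => b _ /=; rewrite big_distrr.
Qed.

Lemma eq_sum3_leq n F G : (forall a b c, a < b -> b < c -> c < n -> F a b c <= G a b c) ->
  sum3 n F = sum3 n G -> forall a b c, a < b -> b < c -> c < n -> F a b c = G a b c.
Proof.
move=> le E a b c ab bc cn.
have lea b' c' : b' < c' -> c' < n ->
    \sum_(0 <= a < b') F a b' c' <= \sum_(0 <= a < b') G a b' c'.
  move=> bc' cn'; rewrite big_nat [leqRHS]big_nat.
  by apply: leq_sum => a' /andP[_ ab']; apply: le.
have leb c' : c' < n -> \sum_(0 <= b < c') \sum_(0 <= a < b) F a b c' <=
    \sum_(0 <= b < c') \sum_(0 <= a < b) G a b c'.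
  move=> cn'; rewrite big_nat [leqRHS]big_nat.
  by apply: leq_sum => b' /andP[_ bc']; apply: lea.
have Ec := eq_sum_leq leb E cn.
have Eb := eq_sum_leq (fun b bc => lea b c bc cn) Ec bc.
exact: (eq_sum_leq (fun a ab => le a b c ab bc cn) Eb ab).
Qed.

Lemma sum_wt_tdeg n h (wt : nat -> nat) :
  \sum_(0 <= v < n) wt v * tdeg n h v =
  sum3 n (fun a b c => h a b c * (wt a + wt b + wt c)).
Proof.
under eq_bigr do rewrite /tdeg big_distrr /=.
rewrite exchange_big_nat /=; rewrite /sum3 big_nat [RHS]big_nat.
apply: eq_bigr => c /andP[_ cn]; under eq_bigr do rewrite big_distrr /=.
rewrite exchange_big_nat /= big_nat [RHS]big_nat.
apply: eq_bigr => b /andP[_ bc]; under eq_bigr do rewrite big_distrr /=.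
rewrite exchange_big_nat /= big_nat [RHS]big_nat.
apply: eq_bigr => a /andP[_ ab].
transitivity (h a b c * (\sum_(0 <= v < n) wt v * (a == v) +
   \sum_(0 <= v < n) wt v * (b == v) + \sum_(0 <= v < n) wt v * (c == v))).
  rewrite -!big_split big_distrr /=; apply: eq_bigr => v _.
  by rewrite mulnCA -!mulnDr [a == v]eq_sym [b == v]eq_sym [c == v]eq_sym.
rewrite !sum_pred1 cn (ltn_trans bc cn) (ltn_trans ab (ltn_trans bc cn)).
by rewrite !mul1n.
Qed.

Lemma sum_tdeg n h : \sum_(0 <= v < n) tdeg n h v = 3 * sum3 n h.
Proof.
have := sum_wt_tdeg n h (fun=> 1); under eq_bigr do rewrite mul1n.
by move->; rewrite -sum3M; apply: eq_sum3 => a b c _ _ _; rewrite mulnC.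
Qed.

(* The functional [sum (3 wt v - thr) d(v)] is maximised exactly by the
   hypergraphs which contain all the triples of weight above [thr] and none of
   weight below; hence a degree sequence on which it takes the maximal value
   forces everything but the ties. *)
Lemma threshold_forced n (wt : nat -> nat) thr (h0 h : nat -> nat -> nat -> bool)
    (r : nat -> nat) :
  (forall a b c, thr < wt a + wt b + wt c -> h0 a b c) ->
  (forall a b c, wt a + wt b + wt c < thr -> ~~ h0 a b c) ->
  3 * \sum_(0 <= v < n) wt v * r v = thr * \sum_(0 <= v < n) r v ->
  (forall v, v < n -> tdeg n h v = tdeg n h0 v + r v) ->
  forall a b c, a < b -> b < c -> c < n -> wt a + wt b + wt c <> thr ->
  h a b c = h0 a b c.
Proof.
move=> gt lt bal hE a b c ab bc cn neq.
have X : sum3 n (fun a b c => h a b c * (wt a + wt b + wt c)) =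
    sum3 n (fun a b c => h0 a b c * (wt a + wt b + wt c)) +
    \sum_(0 <= v < n) wt v * r v.
  rewrite -!sum_wt_tdeg -big_split big_nat [RHS]big_nat.
  by apply: eq_bigr => v /andP[_ vn]; rewrite hE // mulnDr.
have Y : 3 * sum3 n h = 3 * sum3 n h0 + \sum_(0 <= v < n) r v.
  rewrite -!sum_tdeg -big_split big_nat [RHS]big_nat.
  by apply: eq_bigr => v /andP[_ vn]; rewrite hE.
(* Each triple satisfies (h - h0)(weight - thr) <= 0, strictly if h and h0 differ off a tie. The
   terms are rearranged to avoid subtraction; equality of the sums then forces equality of all the
   terms. *)
have E : sum3 n (fun a b c => h a b c * (wt a + wt b + wt c) + thr * h0 a b c) =
    sum3 n (fun a b c => h0 a b c * (wt a + wt b + wt c) + thr * h a b c).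
  rewrite !sum3D !sum3M X; move: bal Y.
  set A := \sum_(0 <= v < n) _; set B := \sum_(0 <= v < n) _.
  set S := sum3 n h; set S0 := sum3 n h0 => bal Y.
  have : thr * (3 * S) = thr * (3 * S0) + 3 * A by rewrite Y bal mulnDr.
  by rewrite !mulnA ![thr * 3]mulnC -!mulnA -mulnDr => /eqP; rewrite eqn_mul2l /= => /eqP ->; lia.
have := eq_sum3_leq _ E ab bc cn.
have le a' b' c' : h a' b' c' * (wt a' + wt b' + wt c') + thr * h0 a' b' c' <=
    h0 a' b' c' * (wt a' + wt b' + wt c') + thr * h a' b' c'.
  case: (ltngtP (wt a' + wt b' + wt c') thr) => [/[dup] ? /lt /negbTE->|/[dup] ? /gt ->|->].
  - by case: (h a' b' c'); lia.
  - by case: (h a' b' c'); lia.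
  - by rewrite [_ * thr]mulnC addnC leq_add // mulnC.
move=> /(_ (fun a b c _ _ _ => le a b c)).
case: (ltngtP (wt a + wt b + wt c) thr) => [/[dup] ? /lt /negbTE->|/[dup] ? /gt ->|//].
  by case: (h a b c) => //; lia.
by case: (h a b c) => //; lia.
Qed.

(** * Exact cover as a degree sequence *)

Section Gadget.

(* The sets [j < J] and the elements [i < C]; an exact cover has [N] sets. *)
Variables (J C N : nat) (mem : nat -> nat -> bool).

(* The vertices are p_{j,i} ([pv]), q_{j,i} ([qv]), for [j < J] and [i <= C], the
   tips t_{i,a,b} ([tv]), and the bulk classes A and S, in this order. The set [j]
   owns the wheel of the p_{j,i} and q_{j,i}, which have degree 1 and whose edges
   are {p_{j,i}, q_{j,i}, t_{i,a,1}}, used if [j] is chosen, and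
   {p_{j,i}, q_{j,i+1}, t_{i,a,0}}, used if it is not, where [i] is taken modulo
   [C.+1] and [a = msel i j]. The element [C], which is in no set, makes the sums
   of the weights along the two covers of a wheel equal. [cnt i a] and [sel i a]
   count all the sets, and the chosen ones, with [msel i j = a]. *)

Definition msel i j := (i < C) && mem i j.
Definition need i : nat := i < C.
Definition cntT i := \sum_(0 <= j < J) msel i j.
Definition cnt i (a : bool) := if a then cntT i else J - cntT i.
Definition sel i (a : bool) := if a then need i else N - need i.

Arguments cnt : simpl never.
Arguments sel : simpl never.

Definition rad1 := 2 * C + 2.
Definition rad2 := rad1 * rad1.
Definition ZZ := J * rad2.
Definition YY := ZZ + rad2.
Definition LL := 6 * YY + 1.

(** The upper digit names the element and the kind of set. The lower digit makes [nx i b + om i a b]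
    independent of [b]: it is i + 1 = (i + 1) + 0 for i < C, and C + 0 = 0 + C at the place where
    the wheel closes. *)
Definition om i (a b : bool) : nat :=
  (2 * i + a) * rad1 + (if i < C then nat_of_bool b else if b then 0 else C).

Definition gp := J * C.+1.
Definition gg := 2 * gp + 4 * C.+1.

Definition pv j i := j * C.+1 + i.
Definition qv j i := gp + (j * C.+1 + i).
Definition tv i (a b : bool) := 2 * gp + (i * 4 + (2 * a + b)).
Definition nx i (b : bool) := if b then i else if i == C then 0 else i.+1.

Variables (nA nS Lq rr : nat).

(** The fine weight of a p vertex is [ZZ] minus what its q vertex, beyond [YY], and its tip add, so
    that the edges of the wheels have the fine weight [ZZ + YY]. In the bulk, 0 on A and [ZZ + YY]
    on S give the same sum to the triples with two vertices in A. *)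
Definition finew v :=
  if v < gp then
    ZZ - (v %/ C.+1 * rad2 + v %% C.+1 + om (v %% C.+1) (msel (v %% C.+1) (v %/ C.+1)) true)
  else if v < 2 * gp then YY + ((v - gp) %/ C.+1 * rad2 + (v - gp) %% C.+1)
  else if v < gg then
    om ((v - 2 * gp) %/ 4) (odd ((v - 2 * gp) %/ 2)) (odd (v - 2 * gp))
  else if v < gg + nA then 0 else ZZ + YY.

Definition cls v := if v < 2 * gp then 5 else if v < gg then 2 else if v < gg + nA then 6 else 0.

(* [LL] dominates the fine weights, so that a tie has classes of sum 12: these are
   (5, 5, 2) and (6, 6, 0), and no other triple which meets the gadget has sum 12.
   The fine weights are written in base [rad1]; [YY] separates p from q. *)
Definition wt v := cls v * LL + finew v.
Definition thr := 12 * LL + (ZZ + YY).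
Definition attr v := if (gg <= v) && (v < gg + nA) then v - gg else 0.

(** A circulant choice of ties: the S vertex has [attr] 0, so a pair of A vertices is joined to all
    of S or to none of it, according to the sum of their indices modulo [Lq]. This gives the density
    [rr / Lq]. *)
Definition bulk_tie a b c := [&& wt a + wt b + wt c == thr,
  gg <= a, gg <= b, gg <= c & (attr a + attr b + attr c) %% Lq < rr].
Definition h0 a b c := (thr < wt a + wt b + wt c) || bulk_tie a b c.

Definition rdeg v :=
  if v < 2 * gp then 1
  else if v < gg then
    if odd (v - 2 * gp) then sel ((v - 2 * gp) %/ 4) (odd ((v - 2 * gp) %/ 2))
    else cnt ((v - 2 * gp) %/ 4) (odd ((v - 2 * gp) %/ 2)) -
         sel ((v - 2 * gp) %/ 4) (odd ((v - 2 * gp) %/ 2))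
  else 0.

Definition nn := gg + nA + nS.
Definition dseq v := tdeg nn h0 v + rdeg v.

Definition exact_cover := exists X : nat -> bool,
  (forall i, i < C -> \sum_(0 <= j < J) (X j && mem i j) = 1) /\
  \sum_(0 <= j < J) X j = N.

Lemma gg_ge4 : 4 <= gg.
Proof. by rewrite /gg; lia. Qed.

Lemma pv_div j i : i <= C -> pv j i %/ C.+1 = j.
Proof. by move=> iC; rewrite /pv divnMDl // divn_small // addn0. Qed.

Lemma pv_mod j i : i <= C -> pv j i %% C.+1 = i.
Proof. by move=> iC; rewrite /pv modnMDl modn_small. Qed.

Lemma pv_lt j i : j < J -> i <= C -> pv j i < gp.
Proof. by rewrite /pv /gp; nia. Qed.

Lemma tv_div4 i a b : (tv i a b - 2 * gp) %/ 4 = i.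
Proof. by rewrite /tv addKn divnMDl // divn_small ?addn0 //; case: a; case: b. Qed.

Lemma tv_div2 i a b : odd ((tv i a b - 2 * gp) %/ 2) = a.
Proof.
rewrite /tv addKn (_ : i * 4 + _ = (i * 2 + a) * 2 + b); last by lia.
rewrite divnMDl // divn_small; last by case: b.
by rewrite addn0 oddD oddM andbF; case: a.
Qed.

Lemma tv_odd i a b : odd (tv i a b - 2 * gp) = b.
Proof. by rewrite /tv addKn !oddD !oddM /= andbF; case: a; case: b. Qed.

Lemma tv_lt i a b : i <= C -> tv i a b < gg.
Proof. by rewrite /tv /gg; case: a; case: b; lia. Qed.

Lemma tv_ge i a b : 2 * gp <= tv i a b.
Proof. by rewrite /tv leq_addr. Qed.

Lemma fine_pv j i : j < J -> i <= C ->
  finew (pv j i) = ZZ - (j * rad2 + i + om i (msel i j) true).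
Proof. by move=> jJ iC; rewrite /finew pv_lt // pv_div // pv_mod. Qed.

Lemma fine_qv j i : j < J -> i <= C -> finew (qv j i) = YY + (j * rad2 + i).
Proof.
move=> jJ iC; have := pv_lt jJ iC; have := pv_div j iC; have := pv_mod j iC.
rewrite /finew /qv -/(pv j i) addKn => -> -> ltp.
have -> : (gp + pv j i < gp) = false by lia.
by have -> : (gp + pv j i < 2 * gp) by lia.
Qed.

Lemma fine_tv i a b : i <= C -> finew (tv i a b) = om i a b.
Proof.
move=> iC; have ge := tv_ge i a b; have lt := tv_lt a b iC.
rewrite /finew; have -> : (tv i a b < gp) = false by lia.
by have -> : (tv i a b < 2 * gp) = false; [lia|rewrite lt tv_div4 tv_div2 tv_odd].
Qed.

Lemma om_lt i' i a b : i' <= C -> i <= C -> i' + om i a b < rad2.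
Proof.
move=> iC' iC; have h : (2 * i + a) * rad1 <= (2 * C + 1) * rad1.
  by rewrite leq_mul2r; apply/orP; right; case: a; lia.
have : (if i < C then nat_of_bool b else if b then 0 else C) + i' <= 2 * C.
  by case: ifP => ?; case: b; lia.
by rewrite /om /rad2 /rad1 in h *; nia.
Qed.

Lemma leq_rad2_ZZ j : j < J -> j.+1 * rad2 <= ZZ.
Proof. by move=> jJ; rewrite /ZZ leq_mul2r jJ orbT. Qed.

Lemma wt_tie j i b : j < J -> i <= C ->
  wt (pv j i) + wt (qv j (nx i b)) + wt (tv i (msel i j) b) = thr.
Proof.
move=> jJ iC; have nC : nx i b <= C by rewrite /nx; case: b => //; case: (eqVneq i C); lia.
have lp := pv_lt jJ iC; have lq := pv_lt jJ nC.
have lt := tv_lt (msel i j) b iC; have ge := tv_ge i (msel i j) b.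
rewrite /wt fine_pv // fine_qv // fine_tv //.
have -> : cls (pv j i) = 5 by rewrite /cls ifT //; lia.
have -> : cls (qv j (nx i b)) = 5 by rewrite /cls /qv -/(pv j _) ifT //; lia.
have -> : cls (tv i (msel i j) b) = 2 by rewrite /cls ifF ?lt //; lia.
have := leq_rad2_ZZ jJ; have := om_lt (msel i j) true iC iC.
have E : nx i b + om i (msel i j) b = i + om i (msel i j) true.
  rewrite /om /nx; case: (b) => //.
  by case: (ltngtP i C) iC => //= [?|->] _; lia.
rewrite mulSn /thr => l1 l2; lia.
Qed.


Lemma radix_inj r x y u v : u < r -> v < r -> x * r + u = y * r + v -> x = y /\ u = v.
Proof.
move=> ur vr E; have r0 : 0 < r by lia.
have := congr1 (fun z => z %/ r) E; rewrite !divnMDl // !divn_small // !addn0 => xy.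
by split=> //; move: E; rewrite xy => /addnI.
Qed.

(** Three fine weights therefore stay below [LL = 6 * YY + 1]. *)
Lemma fine_le v : finew v <= 2 * YY.
Proof.
have h : ZZ <= YY by rewrite /YY leq_addr.
rewrite /finew; case: ltnP => v1; first by apply: leq_trans (leq_subr _ _) _; lia.
case: ltnP => v2.
  have lt : (v - gp) %/ C.+1 < J by rewrite ltn_divLR // -/gp; lia.
  have := leq_rad2_ZZ lt; rewrite mulSn => le.
  have le2 : (v - gp) %% C.+1 <= C by rewrite -ltnS ltn_mod.
  by have := om_lt false false le2 (leq0n C); rewrite /YY; lia.
case: ltnP => v3; last by case: ifP; lia.
have lt : (v - 2 * gp) %/ 4 <= C.
  by rewrite -ltnS ltn_divLR //; move: v3; rewrite /gg; lia.
by have := om_lt (odd ((v - 2 * gp) %/ 2)) (odd (v - 2 * gp)) (leq0n C) lt; rewrite /YY; lia.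
Qed.

Lemma tie_split a b c : wt a + wt b + wt c = thr ->
  cls a + cls b + cls c = 12 /\ finew a + finew b + finew c = ZZ + YY.
Proof.
have fa := fine_le a; have fb := fine_le b; have fc := fine_le c.
rewrite /wt /thr => E; apply: (@radix_inj LL); rewrite ?mulnDl; rewrite /LL in E *; try lia.
have : ZZ <= YY by rewrite /YY leq_addr.
lia.
Qed.

(** The weights have no unintended coincidence: the classes, then [YY], then the digits in base
    [rad2] and [rad1] decode a tie into a set, an element and one of its two edges. *)
Lemma tie_gadget a b c : a < b -> b < c -> a < gg -> wt a + wt b + wt c = thr ->
  exists j i be, [/\ j < J, i <= C, a = pv j i, b = qv j (nx i be) & c = tv i (msel i j) be].
Proof.
move=> ab bc ag /tie_split[Ec Ef].
have [a2 b2 c2 cg] : [/\ a < 2 * gp, b < 2 * gp, 2 * gp <= c & c < gg].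
  move: Ec; rewrite /cls.
  by do 9 (try case: ltnP => ?); try lia; move=> _; split; lia.
have r0 : 0 < rad2 by rewrite /rad2 /rad1; lia.
set z := c - 2 * gp.
have i3C : z %/ 4 <= C by rewrite -ltnS ltn_divLR // /z; move: cg; rewrite /gg; lia.
have cE : c = tv (z %/ 4) (odd (z %/ 2)) (odd z).
  have := modn2 z; have := modn2 (z %/ 2); rewrite /tv /z; lia.
have fc : finew c = om (z %/ 4) (odd (z %/ 2)) (odd z) by rewrite cE fine_tv.
have fcl := om_lt (odd (z %/ 2)) (odd z) (leq0n C) i3C; rewrite -fc add0n in fcl.
(* Otherwise [a] and [b] are both q vertices, with fine weights of sum at least [2 * YY], above
   [ZZ + YY]. *)
have ap : a < gp.
  rewrite ltnNge; apply/negP => ga; move: Ef; rewrite {1 2}/finew.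
  have -> : (a < gp) = false by lia.
  have -> : (b < gp) = false by lia.
  rewrite a2 b2 /YY; move: ((a - gp) %/ _ * _ + _) ((b - gp) %/ _ * _ + _) => u v; lia.
(* Otherwise [a] and [b] are both p vertices, with fine weights of sum at most [2 * ZZ], and a tip
   adds less than [rad2], the difference of [YY] and [ZZ]. *)
have bp : gp <= b.
  rewrite leqNgt; apply/negP => gb; move: Ef; rewrite {1 2}/finew ap gb /YY.
  by move: (_ %/ _ * _ + _ + om _ _ _) (_ %/ _ * _ + _ + om _ _ _) => u v; lia.
have C0 : 0 < C.+1 by [].
set j := a %/ C.+1; set i := a %% C.+1.
have jJ : j < J by rewrite /j ltn_divLR.
have iC : i <= C by rewrite -ltnS ltn_mod.
have aE : a = pv j i by rewrite /pv -divn_eq.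
set j' := (b - gp) %/ C.+1; set i' := (b - gp) %% C.+1.
have jJ' : j' < J by rewrite /j' ltn_divLR // -/gp; lia.
have iC' : i' <= C by rewrite -ltnS ltn_mod.
have bE : b = qv j' i' by rewrite /qv -divn_eq; lia.
have fa : finew a = ZZ - (j * rad2 + i + om i (msel i j) true) by rewrite {1}aE fine_pv.
have fb : finew b = YY + (j' * rad2 + i') by rewrite {1}bE fine_qv.
have l1 := om_lt (msel i j) true iC iC.
have l2 := leq_rad2_ZZ jJ; rewrite mulSn in l2.
have l3 := om_lt (odd (z %/ 2)) (odd z) iC' i3C.
have [jj E1] : j' = j /\ i' + om (z %/ 4) (odd (z %/ 2)) (odd z) = i + om i (msel i j) true.
  by apply: (radix_inj l3 l1); move: Ef; rewrite fa fb fc; lia.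
have b1 (i0 : nat) (be : bool) k : k <= C ->
    (if i0 < C then nat_of_bool be else if be then 0 else C) + k < rad1.
  by move=> kC; rewrite /rad1; case: ifP => ?; case: be; lia.
have [E2 E3] : 2 * (z %/ 4) + odd (z %/ 2) = 2 * i + msel i j /\
    (if z %/ 4 < C then nat_of_bool (odd z) else if odd z then 0 else C) + i' =
    (if i < C then 1 else 0) + i.
  apply: (radix_inj (b1 _ _ _ iC') (b1 i true i iC)).
  by move: E1; rewrite /om; case: ifP => _; case: ifP => _; lia.
have iE : z %/ 4 = i by move: E2; case: (odd _); case: (msel _ _); lia.
have sE : odd (z %/ 2) = msel i j by move: E2; rewrite iE; case: (odd _); case: (msel _ _) => //; lia.
exists j, i, (odd z); split=> //; last by rewrite {1}cE iE sE.
rewrite {1}bE jj; congr qv; move: E3; rewrite iE /nx; case: (odd z).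
  by case: ifP; lia.
by case: (eqVneq i C) => ?; case: ifP; lia.
Qed.

Definition gtie a b c := (wt a + wt b + wt c == thr) && (a < gg).

Lemma nx_le i be : i <= C -> nx i be <= C.
Proof. by move=> iC; rewrite /nx; case: be => //; case: (eqVneq i C); lia. Qed.

Lemma gg_le : gg <= nn. Proof. by rewrite /nn -addnA leq_addr. Qed.

(** The ties of the gadget correspond bijectively to the triples of a set, an element and a side:
    [tie_gadget] is surjectivity and [wt_tie] shows that each of these is a tie. *)
Lemma gtie_sum (F : nat -> nat -> nat -> nat) :
  sum3 nn (fun a b c => gtie a b c * F a b c) =
  \sum_(0 <= j < J) \sum_(0 <= i < C.+1)
    (F (pv j i) (qv j (nx i true)) (tv i (msel i j) true) +
     F (pv j i) (qv j (nx i false)) (tv i (msel i j) false)).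
Proof.
rewrite /sum3 sum3_ord.
have vlt (k : 'I_J * 'I_C.+1 * bool) :
    [/\ pv k.1.1 k.1.2 < gp, qv k.1.1 (nx k.1.2 k.2) < 2 * gp,
     tv k.1.2 (msel k.1.2 k.1.1) k.2 < gg & gp <= qv k.1.1 (nx k.1.2 k.2)].
  have iC : k.1.2 <= C by rewrite -ltnS.
  have l1 := pv_lt (ltn_ord k.1.1) iC; have l2 := pv_lt (ltn_ord k.1.1) (nx_le k.2 iC).
  split=> //; first by rewrite /qv -/(pv _ _); lia.
    exact: tv_lt.
  by rewrite /qv leq_addr.
have gpg : 2 * gp <= gg by rewrite /gg leq_addr.
have ggn := gg_le.
have p1 (k : 'I_J * 'I_C.+1 * bool) : pv k.1.1 k.1.2 < nn by case: (vlt k); lia.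
have p2 (k : 'I_J * 'I_C.+1 * bool) : qv k.1.1 (nx k.1.2 k.2) < nn by case: (vlt k); lia.
have p3 (k : 'I_J * 'I_C.+1 * bool) : tv k.1.2 (msel k.1.2 k.1.1) k.2 < nn by case: (vlt k); lia.
pose tri k := (Ordinal (p3 k), Ordinal (p2 k), Ordinal (p1 k)).
have tri_inj : injective tri.
  move=> [[j i] be] [[j' i'] be'] [/= E1 _ E3].
  have iC : i <= C by rewrite -ltnS.
  have iC' : i' <= C by rewrite -ltnS.
  have jj : j = j' by apply: val_inj; rewrite /= -(pv_div j iC) E3 pv_div.
  have ii : i = i' by apply: val_inj; rewrite /= -(pv_mod j iC) E3 pv_mod.
  by rewrite jj ii -(tv_odd i (msel i j) be) E1 tv_odd.
rewrite (eq_bigr (fun t : 'I_nn * 'I_nn * 'I_nn => if gtie t.2 t.1.2 t.1.1 then F t.2 t.1.2 t.1.1 else 0)); last first.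
  by move=> t _; case: gtie; rewrite ?mul1n.
rewrite -big_mkcondr (eq_bigl (fun t => t \in tri @: predT)) /=; last first.
  move=> [[c b] a]; apply/andP/imsetP => [[/andP[/= ab bc] /andP[/eqP wE ag]]|[k _ ->]].
    have [j [i [be [jJ iC aE bE cE]]]] := tie_gadget ab bc ag wE.
    exists (Ordinal jJ, Ordinal (iC : i < C.+1), be) => //.
    by congr (_, _, _); apply: val_inj.
  have [l1 l2 l3 l4] := vlt k; have l5 := tv_ge k.1.2 (msel k.1.2 k.1.1) k.2.
  have iC : k.1.2 <= C by rewrite -ltnS.
  rewrite /sorted3 /gtie /= (wt_tie _ (ltn_ord k.1.1) iC) eqxx.
  split; apply/andP; split=> //=; first exact: leq_trans l1 l4.
    exact: leq_trans l2 l5.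
  by apply: leq_trans l1 _; rewrite /gg; lia.
rewrite big_imset /=; last by move=> ? ? _ _; apply: tri_inj.
rewrite big_mkord.
transitivity (\sum_(j < J) \sum_(i < C.+1) \sum_(be : bool)
   F (pv j i) (qv j (nx i be)) (tv i (msel i j) be)).
  rewrite pair_bigA pair_bigA /=; by apply: eq_bigl => k.
apply: eq_bigr => j _; rewrite big_mkord; apply: eq_bigr => i _.
by rewrite big_bool.
Qed.

Lemma sum_radix n m (F : nat -> nat) :
  \sum_(0 <= v < n * m) F v = \sum_(0 <= j < n) \sum_(0 <= i < m) F (j * m + i).
Proof.
elim: n => [|n IH]; first by rewrite !big_geq.
rewrite big_nat_recr //= -IH mulSnr (big_cat_nat (n := n * m)) ?leq_addr //=.
congr (_ + _); rewrite -{1}[n * m]add0n big_addn addKn.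
by apply: eq_bigr => i _; rewrite addnC.
Qed.

Lemma sum_gadget (F : nat -> nat) : (forall v, gg <= v -> F v = 0) ->
  \sum_(0 <= v < nn) F v =
  \sum_(0 <= j < J) \sum_(0 <= i < C.+1) (F (pv j i) + F (qv j i)) +
  \sum_(0 <= i < C.+1) ((F (tv i false false) + F (tv i false true)) +
                        (F (tv i true false) + F (tv i true true))).
Proof.
move=> F0; have gpg : gp <= 2 * gp by lia.
have gpg2 : 2 * gp <= gg by rewrite /gg leq_addr.
rewrite (big_cat_nat (n := gg)) ?gg_le //= [X in _ + X]big_nat [X in _ + X]big1 ?addn0; last first.
  by move=> v /andP[/F0].
rewrite (big_cat_nat (n := 2 * gp)) //= (big_cat_nat (n := gp)) //=; congr (_ + _).
  have -> : \sum_(gp <= v < 2 * gp) F v = \sum_(0 <= v < gp) F (v + gp).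
    by rewrite -{1}[gp]add0n big_addn (_ : 2 * gp - gp = gp) //; lia.
  rewrite /gp !sum_radix -big_split; apply: eq_bigr => j _ /=.
  by rewrite -big_split; apply: eq_bigr => i _ /=; rewrite /pv /qv /gp [J * _ + _]addnC.
have -> : \sum_(2 * gp <= v < gg) F v = \sum_(0 <= v < C.+1 * 4) F (v + 2 * gp).
  by rewrite -{1}[2 * gp]add0n big_addn (_ : gg - 2 * gp = C.+1 * 4) // /gg; lia.
rewrite sum_radix; apply: eq_bigr => i _.
rewrite !big_nat_recr ?big_geq //= add0n.
by rewrite -addnA; congr (F _ + F _ + (F _ + F _)); rewrite /tv /=; lia.
Qed.

Lemma rdeg_pv j i : j < J -> i <= C -> rdeg (pv j i) = 1.
Proof. by move=> jJ iC; rewrite /rdeg ifT //; have := pv_lt jJ iC; lia. Qed.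

Lemma rdeg_qv j i : j < J -> i <= C -> rdeg (qv j i) = 1.
Proof.
by move=> jJ iC; rewrite /rdeg ifT //; have := pv_lt jJ iC; rewrite /qv /pv; lia.
Qed.

Lemma rdeg_tv i a b : i <= C ->
  rdeg (tv i a b) = if b then sel i a else cnt i a - sel i a.
Proof.
move=> iC; rewrite /rdeg ifF ?tv_lt ?tv_div4 ?tv_div2 ?tv_odd //.
by have := tv_ge i a b; lia.
Qed.

Lemma rdeg_bulk v : gg <= v -> rdeg v = 0.
Proof.
move=> gv; rewrite /rdeg ltnNge (_ : 2 * gp <= v) /=; last by move: gv; rewrite /gg; lia.
by rewrite ltnNge gv.
Qed.

Lemma cntE i a : cnt i a = \sum_(0 <= j < J) (msel i j == a).
Proof.
rewrite /cnt /cntT; case: a; first by apply: eq_bigr => j _; case: msel.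
rewrite -[J in J - _](mul1n J) -[J in 1 * J]subn0 mulnC -sum_nat_const_nat.
have -> : \sum_(0 <= j < J) 1 = \sum_(0 <= j < J) (msel i j == false) + \sum_(0 <= j < J) msel i j.
  by rewrite -big_split; apply: eq_bigr => j _; case: msel.
by rewrite addnK.
Qed.

Lemma cnt_split i : cnt i true + cnt i false = J.
Proof.
rewrite !cntE -big_split /= -[RHS](muln1 J) -[J in RHS]subn0 -sum_nat_const_nat.
by apply: eq_bigr => j _; case: msel.
Qed.

(** Makes the truncated subtraction in [rdeg] an exact one. *)
Hypothesis need_le : forall i a, i <= C -> sel i a <= cnt i a.
Hypothesis N_gt0 : 0 < N.

Lemma sel_split i : sel i true + sel i false = N.
Proof. by rewrite /sel /need subnKC //; case: ltnP. Qed.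

Lemma sum_rdeg : \sum_(0 <= v < nn) rdeg v = 3 * gp.
Proof.
rewrite sum_gadget; last exact: rdeg_bulk.
have -> : \sum_(0 <= j < J) \sum_(0 <= i < C.+1) (rdeg (pv j i) + rdeg (qv j i)) = 2 * gp.
  transitivity (\sum_(0 <= j < J) (2 * C.+1)); last by rewrite sum_nat_const_nat /gp; lia.
  rewrite big_nat [RHS]big_nat; apply: eq_bigr => j /andP[_ jJ].
  rewrite -[C.+1 in RHS]subn0 mulnC -sum_nat_const_nat big_nat [RHS]big_nat.
  by apply: eq_bigr => i /andP[_ iC]; rewrite rdeg_pv ?rdeg_qv.
suff -> : \sum_(0 <= i < C.+1) ((rdeg (tv i false false) + rdeg (tv i false true)) +
   (rdeg (tv i true false) + rdeg (tv i true true))) = gp by lia.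
transitivity (\sum_(0 <= i < C.+1) J); last by rewrite sum_nat_const_nat /gp; lia.
rewrite big_nat [RHS]big_nat; apply: eq_bigr => i /andP[_ iC]; rewrite ltnS in iC.
rewrite !rdeg_tv //=.
by have := need_le true iC; have := need_le false iC; have := cnt_split i; lia.
Qed.

Lemma wt_tip i a : i <= C -> wt (tv i a true) + (if i < C then 0 else C) =
  wt (tv i a false) + (i < C).
Proof.
move=> iC; rewrite /wt !fine_tv // /cls !tv_lt //.
by rewrite ![tv _ _ _ < 2 * gp]ltnNge !tv_ge /= /om; case: (ltnP i C); lia.
Qed.

(** The balance condition of [threshold_forced], proved without any cover at hand. With all the sets
    chosen, the wheels would be covered by ties. Each of the [J - N] sets not chosen replaces its
    tips, which loses 1 at every i < C and gains C at the extra element, hence nothing in total. *)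
Lemma sum_wt_rdeg : 3 * \sum_(0 <= v < nn) wt v * rdeg v = thr * \sum_(0 <= v < nn) rdeg v.
Proof.
rewrite sum_rdeg sum_gadget; last by move=> v /rdeg_bulk->; rewrite muln0.
set A := \sum_(0 <= j < J) _; set B := \sum_(0 <= i < C.+1) _.
suff : A + B = thr * gp by move->; rewrite mulnCA.
(* The weight at the tips if every set were chosen. *)
pose B' := \sum_(0 <= i < C.+1) (cnt i false * wt (tv i false true) + cnt i true * wt (tv i true true)).
have AB' : A + B' = thr * gp.
  have -> : B' = \sum_(0 <= j < J) \sum_(0 <= i < C.+1) wt (tv i (msel i j) true).
    rewrite exchange_big_nat /=; apply: eq_bigr => i _.
    rewrite !cntE !big_distrl -big_split; apply: eq_bigr => j _ /=.
    by case: msel; rewrite /= ?mul1n ?mul0n ?addn0.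
  rewrite /A -big_split /= /gp mulnCA.
  transitivity (\sum_(0 <= j < J) (thr * C.+1)); last by rewrite sum_nat_const_nat subn0.
  rewrite big_nat [RHS]big_nat; apply: eq_bigr => j /andP[_ jJ].
  rewrite -big_split /= -[C.+1 in RHS]subn0 mulnC -sum_nat_const_nat big_nat [RHS]big_nat.
  apply: eq_bigr => i /andP[_ iC]; rewrite ltnS in iC.
  by rewrite rdeg_pv // rdeg_qv // !muln1 -(wt_tie true jJ iC).
suff : B = B' by move=> ->.
have key i : i <= C ->
    wt (tv i false false) * rdeg (tv i false false) + wt (tv i false true) * rdeg (tv i false true) +
    (wt (tv i true false) * rdeg (tv i true false) + wt (tv i true true) * rdeg (tv i true true)) +
    (i < C) * (J - N) =
    cnt i false * wt (tv i false true) + cnt i true * wt (tv i true true) +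
    (if i < C then 0 else C) * (J - N).
  move=> iC; rewrite !rdeg_tv //=.
  have := cnt_split i; have := sel_split i.
  have := need_le true iC; have := need_le false iC; have := wt_tip true iC; have := wt_tip false iC.
  set w00 := wt (tv i false false); set w01 := wt (tv i false true).
  set w10 := wt (tv i true false); set w11 := wt (tv i true true).
  move: (cnt i true) (cnt i false) (sel i true) (sel i false) => c1 c0 s1 s0.
  move: (w00) (w01) (w10) (w11) => u00 u01 u10 u11 e1 e2 /subnKC <- /subnKC <-.
  move: (c1 - s1) (c0 - s0) => d1 d0 sN cJ; rewrite !addKn.
  have -> : J - N = d1 + d0 by lia.
  case: (i < C) e1 e2 => e1 e2; rewrite ?mul0n ?mul1n ?addn0 in e1 e2 *.
    by rewrite e1 e2; lia.
  by rewrite -e1 -e2; lia.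
have S1 : B + C * (J - N) = B' + C * (J - N).
  have <- : \sum_(0 <= i < C.+1) (i < C) * (J - N) = C * (J - N).
    rewrite -big_distrl /=; congr (_ * _).
    by rewrite count_lt_sum; apply/minn_idPr.
  have -> : B' + \sum_(0 <= i < C.+1) (i < C) * (J - N) =
     B' + \sum_(0 <= i < C.+1) (if i < C then 0 else C) * (J - N).
    congr (_ + _); rewrite !big_nat_recr //= ltnn mul0n addn0.
    rewrite [X in _ = X + _]big_nat [X in _ = X + _]big1 ?add0n => [|i /andP[_ ->]] //.
    rewrite big_nat; under eq_bigr => i /andP[_ ->] do rewrite mul1n.
    by rewrite -big_nat sum_nat_const_nat subn0.
  rewrite -!big_split big_nat [RHS]big_nat; apply: eq_bigr => i /andP[_ iC].
  exact: key.
by move/eqP: S1; rewrite eqn_add2r => /eqP.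
Qed.

Definition ind3 (v a b c : nat) := (v == a) + (v == b) + (v == c).

Definition edge_of (y : nat -> nat -> nat -> bool) j i be :=
  y (pv j i) (qv j (nx i be)) (tv i (msel i j) be).

Definition gdeg (y : nat -> nat -> nat -> bool) v := sum3 nn (fun a b c => gtie a b c * (y a b c * ind3 v a b c)).

Lemma gdegE y v : gdeg y v = \sum_(0 <= j < J) \sum_(0 <= i < C.+1)
  (edge_of y j i true * ind3 v (pv j i) (qv j i) (tv i (msel i j) true) +
   edge_of y j i false * ind3 v (pv j i) (qv j (nx i false)) (tv i (msel i j) false)).
Proof. by rewrite /gdeg (gtie_sum (fun a b c => y a b c * ind3 v a b c)). Qed.

Lemma pv_eq j i j' i' : i <= C -> i' <= C -> (pv j i == pv j' i') = (j == j') && (i == i').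
Proof.
move=> iC iC'; apply/eqP/andP => [E|[/eqP-> /eqP->] //]; split; apply/eqP.
  by rewrite -(pv_div j iC) E pv_div.
by rewrite -(pv_mod j iC) E pv_mod.
Qed.

Lemma qv_eq j i j' i' : i <= C -> i' <= C -> (qv j i == qv j' i') = (j == j') && (i == i').
Proof. by move=> iC iC'; rewrite /qv eqn_add2l pv_eq. Qed.

Lemma tv_eq i a b i' a' b' : (tv i a b == tv i' a' b') = [&& i == i', a == a' & b == b'].
Proof.
apply/eqP/and3P => [E|[/eqP-> /eqP-> /eqP->] //]; split; apply/eqP.
- by rewrite -(tv_div4 i a b) E tv_div4.
- by rewrite -(tv_div2 i a b) E tv_div2.
- by rewrite -(tv_odd i a b) E tv_odd.
Qed.

Lemma pv_neq_qv j i j' i' : j < J -> i <= C -> (pv j i == qv j' i') = false.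
Proof. by move=> jJ iC; have := pv_lt jJ iC; rewrite /qv; lia. Qed.

Lemma pv_neq_tv j i i' a b : j < J -> i <= C -> (pv j i == tv i' a b) = false.
Proof. by move=> jJ iC; have := pv_lt jJ iC; have := tv_ge i' a b; lia. Qed.

Lemma qv_neq_tv j i i' a b : j < J -> i <= C -> (qv j i == tv i' a b) = false.
Proof.
by move=> jJ iC; have := pv_lt jJ iC; have := tv_ge i' a b; rewrite /qv -/(pv j i); lia.
Qed.

Lemma sum_pick n (F : nat -> nat) k : k < n -> \sum_(0 <= i < n) F i * (k == i) = F k.
Proof. by move=> kn; rewrite sum_pred1 kn mul1n. Qed.

Lemma gdeg_pv y j0 i0 : j0 < J -> i0 <= C ->
  gdeg y (pv j0 i0) = edge_of y j0 i0 true + edge_of y j0 i0 false.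
Proof.
move=> jJ iC; rewrite gdegE.
transitivity (\sum_(0 <= j < J) (\sum_(0 <= i < C.+1)
   (edge_of y j i true + edge_of y j i false) * (i0 == i)) * (j0 == j)); last first.
  by rewrite sum_pick // sum_pick.
apply: eq_bigr => j _; rewrite big_distrl /= big_nat [RHS]big_nat.
apply: eq_bigr => i /andP[_ lti]; rewrite ltnS in lti.
rewrite /ind3 pv_eq // !pv_neq_qv // !pv_neq_tv // !addn0 -mulnDl -mulnA.
by rewrite mulnC [in RHS]mulnC; case: (j0 == j); case: (i0 == i).
Qed.

(** The inverse of [nx _ false], a rotation of the [C.+1] positions of a wheel. *)
Definition px i := if i == 0 then C else i.-1.

Lemma nx_px i i0 : i <= C -> i0 <= C -> (i0 == nx i false) = (px i0 == i).
Proof.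
by move=> iC iC0; rewrite /nx /px; case: (eqVneq i C); case: (eqVneq i0 0); lia.
Qed.

Lemma px_le i : i <= C -> px i <= C.
Proof. by rewrite /px; case: eqP; lia. Qed.

Lemma gdeg_qv y j0 i0 : j0 < J -> i0 <= C ->
  gdeg y (qv j0 i0) = edge_of y j0 i0 true + edge_of y j0 (px i0) false.
Proof.
move=> jJ iC; rewrite gdegE.
transitivity (\sum_(0 <= j < J) (\sum_(0 <= i < C.+1) edge_of y j i true * (i0 == i) +
   \sum_(0 <= i < C.+1) edge_of y j i false * (px i0 == i)) * (j0 == j)); last first.
  by rewrite sum_pick // !sum_pick // ltnS px_le.
rewrite big_nat [RHS]big_nat; apply: eq_bigr => j /andP[_ ltj].
rewrite -big_split big_distrl /= big_nat [RHS]big_nat.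
apply: eq_bigr => i /andP[_ lti]; rewrite ltnS in lti.
have nC := nx_le false lti.
rewrite /ind3 !qv_eq // ![qv _ _ == pv _ _]eq_sym !pv_neq_qv // !qv_neq_tv //.
rewrite nx_px // !addn0 !add0n mulnDl -!mulnA.
by case: (j0 == j); rewrite ?muln1 ?muln0 ?andbT ?andbF.
Qed.

Lemma gdeg_tv y i0 a0 b0 : i0 <= C ->
  gdeg y (tv i0 a0 b0) = \sum_(0 <= j < J) (msel i0 j == a0) * edge_of y j i0 b0.
Proof.
move=> iC; rewrite gdegE big_nat [RHS]big_nat; apply: eq_bigr => j /andP[_ ltj].
transitivity (\sum_(0 <= i < C.+1) ((msel i j == a0) * edge_of y j i b0) * (i0 == i));
  last by rewrite sum_pick.
rewrite big_nat [RHS]big_nat; apply: eq_bigr => i /andP[_ lti]; rewrite ltnS in lti.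
have nC := nx_le false lti.
have neq_p : (tv i0 a0 b0 == pv j i) = false by rewrite eq_sym pv_neq_tv.
have neq_q k : k <= C -> (tv i0 a0 b0 == qv j k) = false.
  by move=> kC; rewrite eq_sym qv_neq_tv.
rewrite /ind3 neq_p !neq_q // !add0n !tv_eq [a0 == _]eq_sym.
by case: (msel i j == a0); case: (i0 == i); case: (b0); rewrite /= ?muln1 ?muln0 ?addn0 ?mul1n.
Qed.

Lemma vertex_cases (P : nat -> Prop) :
  (forall j i, j < J -> i <= C -> P (pv j i)) ->
  (forall j i, j < J -> i <= C -> P (qv j i)) ->
  (forall i a b, i <= C -> P (tv i a b)) ->
  forall v, v < gg -> P v.
Proof.
move=> Pp Pq Pt v vg.
have C0 : 0 < C.+1 by [].
case: (ltnP v gp) => v1.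
  rewrite (divn_eq v C.+1); apply: Pp; first by rewrite ltn_divLR.
  by rewrite -ltnS ltn_mod.
case: (ltnP v (2 * gp)) => v2.
  have -> : v = qv ((v - gp) %/ C.+1) ((v - gp) %% C.+1) by rewrite /qv -divn_eq; lia.
  apply: Pq; last by rewrite -ltnS ltn_mod.
  by rewrite ltn_divLR // -/gp; lia.
set z := v - 2 * gp.
have -> : v = tv (z %/ 4) (odd (z %/ 2)) (odd z).
  by have := modn2 z; have := modn2 (z %/ 2); rewrite /tv /z; lia.
apply: Pt; rewrite -ltnS ltn_divLR // /z.
by move: vg; rewrite /gg; lia.
Qed.

(** All the triples which are not ties are forced, and a tie outside the gadget contains no gadget
    vertex. Hence the gadget ties used by [h] have exactly the degrees [rdeg]. *)
Lemma realizable_exact_cover h : (forall v, v < nn -> tdeg nn h v = dseq v) -> exact_cover.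
Proof.
move=> hE.
have gt a b c : thr < wt a + wt b + wt c -> h0 a b c by rewrite /h0 => ->.
have lt a b c : wt a + wt b + wt c < thr -> ~~ h0 a b c.
  by move=> l; rewrite /h0 /bulk_tie ltnNge (ltnW l) (ltn_eqF l).
have forced := threshold_forced gt lt sum_wt_rdeg hE.
have gE v : v < gg -> gdeg h v = rdeg v.
  move=> vg; have := hE v (leq_trans vg gg_le).
  rewrite /dseq /tdeg -/(sum3 nn (fun a b c => h a b c * ind3 v a b c)).
  rewrite -/(sum3 nn (fun a b c => h0 a b c * ind3 v a b c)).
  have -> : sum3 nn (fun a b c => h a b c * ind3 v a b c) =
     sum3 nn (fun a b c => h0 a b c * ind3 v a b c) + gdeg h v; last by move/addnI.
  rewrite -sum3D; apply: eq_sum3 => a b c ab bc cn.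
  rewrite /gtie; case: (eqVneq (wt a + wt b + wt c) thr) => [E|/eqP ne] /=.
    case: (ltnP a gg) => ag.
      by rewrite /h0 /bulk_tie E ltnn (leqNgt gg a) ag /= andbF mul0n add0n mul1n.
    have neq u : gg <= u -> (v == u) = false.
      by move=> gu; rewrite (ltn_eqF (leq_trans vg gu)).
    have gb := leq_trans ag (ltnW ab); have gc := leq_trans gb (ltnW bc).
    by rewrite /ind3 !neq // !muln0.
  by rewrite (forced _ _ _ ab bc cn ne) !mul0n addn0.
pose Y j i be := edge_of h j i be.
have Yp j i : j < J -> i <= C -> Y j i true + Y j i false = 1.
  by move=> jJ iC; rewrite -gdeg_pv // gE ?rdeg_pv //; apply: leq_trans (pv_lt jJ iC) _; rewrite /gg; lia.
have Yq j i : j < J -> i <= C -> Y j i true + Y j (px i) false = 1.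
  move=> jJ iC; rewrite -gdeg_qv // gE ?rdeg_qv //.
  by have := pv_lt jJ iC; rewrite /qv /gg -/(pv j i); lia.
(* By the equations at p and q, the choice made at one position passes to the next one: each wheel
   has only its two perfect covers. *)
have YX j i : j < J -> i <= C -> Y j i true = Y j 0 true.
  move=> jJ; elim: i => // i IH iC; rewrite -IH ?(ltnW iC) //.
  have := Yq j i.+1 jJ iC; have := Yp j i jJ (ltnW iC); rewrite /px /=.
  by case: (Y j i true); case: (Y j i false); case: (Y j i.+1 true).
have Yt i a : i <= C -> \sum_(0 <= j < J) (msel i j == a) * Y j 0 true = sel i a.
  move=> iC; have := gE (tv i a true) (tv_lt _ _ iC).
  rewrite gdeg_tv // rdeg_tv // => <-; rewrite big_nat [RHS]big_nat.
  by apply: eq_bigr => j /andP[_ jJ]; rewrite -(YX j i jJ iC).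
exists (fun j => Y j 0 true); split=> [i iC|].
  have := Yt i true (ltnW iC); rewrite /sel /need iC /= => E1; rewrite -[RHS]E1.
  by apply: eq_bigr => j _; rewrite /msel iC; case: (mem i j); case: (Y j 0 true).
(* No set contains the extra element [C], so one of its tips counts all the chosen sets. *)
have := Yt C false (leqnn C); rewrite /sel /need ltnn subn0 => E1; rewrite -[RHS]E1.
by apply: eq_bigr => j _; rewrite /msel ltnn mul1n.
Qed.

Lemma exact_cover_realizable : exact_cover ->
  exists h, forall v, v < nn -> tdeg nn h v = dseq v.
Proof.
move=> [X [X1 XN]].
(* The parity of the tip is the side of the edge, and the quotient of the p vertex is its set. *)
pose y a (b c : nat) := odd (c - 2 * gp) == X (a %/ C.+1).
have yE j i be : i <= C -> edge_of y j i be = (be == X j).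
  by move=> iC; rewrite /edge_of /y tv_odd pv_div.
exists (fun a b c => h0 a b c || gtie a b c && y a b c) => v vn.
have -> : tdeg nn (fun a b c => h0 a b c || gtie a b c && y a b c) v =
    tdeg nn h0 v + gdeg y v.
  rewrite /tdeg /gdeg -!/(sum3 nn _) -sum3D; apply: eq_sum3 => a b c _ _ _.
  rewrite -/(ind3 v a b c) mulnA -mulnDl; congr (_ * _).
  rewrite /h0 /gtie /bulk_tie; case: (ltngtP thr (wt a + wt b + wt c)) => //= _.
  by case: (ltnP a gg) => //=; case: (y a b c) => //; rewrite ?orbF ?addn0.
congr (_ + _); case: (ltnP v gg) => [vg|gv]; last first.
  rewrite rdeg_bulk // gdegE big_nat big1 // => j /andP[_ jJ].
  rewrite big_nat big1 // => i /andP[_ iC]; rewrite ltnS in iC.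
  have nC := nx_le false iC; have gpg : 2 * gp <= gg by rewrite /gg leq_addr.
  have l1 := pv_lt jJ iC; have l2 := pv_lt jJ nC.
  have l3 := tv_lt (msel i j) true iC; have l4 := tv_lt (msel i j) false iC.
  rewrite /ind3 /qv -!/(pv j _).
  have -> : (v == pv j i) = false by lia.
  have -> : (v == gp + pv j i) = false by lia.
  have -> : (v == gp + pv j (nx i false)) = false by lia.
  have -> : (v == tv i (msel i j) true) = false by lia.
  have -> : (v == tv i (msel i j) false) = false by lia.
  by rewrite !muln0.
have X1' i : i <= C -> \sum_(0 <= j < J) (msel i j == true) * (true == X j) = need i.
  rewrite leq_eqVlt => /predU1P[->|iC]; rewrite /need /msel.
    by rewrite ltnn big1.
  rewrite iC -[RHS](X1 i iC); apply: eq_bigr => j _.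
  by case: (mem i j); case: (X j).
have XE i a : i <= C -> \sum_(0 <= j < J) (msel i j == a) * (true == X j) = sel i a.
  move=> iC; case: a; first exact: X1'.
  rewrite /sel -XN -(X1' i iC).
  rewrite -[LHS](addnK (\sum_(0 <= j < J) (msel i j == true) * (true == X j))) -big_split /=.
  by congr (_ - _); apply: eq_bigr => j _; case: msel; case: (X j).
move: v vg {vn}; apply: vertex_cases => [j i jJ iC|j i jJ iC|i a b iC].
- by rewrite gdeg_pv // rdeg_pv // !yE //; case: (X j).
- by rewrite gdeg_qv // rdeg_qv // !yE ?px_le //; case: (X j).
- rewrite gdeg_tv // rdeg_tv //; under eq_bigr do rewrite yE //.
  case: b; first exact: XE.
  rewrite -XE // cntE.
  rewrite -[LHS](addnK (\sum_(0 <= j < J) (msel i j == a) * (true == X j))) -big_split /=.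
  by congr (_ - _); apply: eq_bigr => j _; case: eqP; case: (X j).
Qed.

Lemma dvd3_dseq : 3 %| \sum_(0 <= v < nn) dseq v.
Proof.
by rewrite big_split /= sum_tdeg sum_rdeg -mulnDr dvdn_mulr.
Qed.

(** * Degrees contributed by the bulk *)

Lemma h0_sym : sym3 h0.
Proof.
split=> a b c; rewrite /h0 /bulk_tie.
  rewrite ![wt a + wt b]addnC ![attr a + attr b]addnC.
  by case: (gg <= a); case: (gg <= b).
rewrite ![wt a + wt b + wt c]addnAC ![attr a + attr b + attr c]addnAC.
by case: (gg <= b); case: (gg <= c).
Qed.

Lemma h0_above a b c : 12 < cls a + cls b + cls c -> h0 a b c.
Proof.
move=> lt; rewrite /h0 /thr /wt; apply/orP; left.
have lZ : ZZ <= YY by rewrite /YY leq_addr.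
have lL : ZZ + YY < LL by rewrite /LL; lia.
have : 13 * LL <= (cls a + cls b + cls c) * LL by rewrite leq_mul2r lt orbT.
by rewrite !mulnDl; lia.
Qed.

Lemma h0_below a b c : cls a + cls b + cls c < 12 -> h0 a b c = false.
Proof.
move=> lt; have fa := fine_le a; have fb := fine_le b; have fc := fine_le c.
have lw : wt a + wt b + wt c < thr.
  have : finew a + finew b + finew c < LL by rewrite /LL; lia.
  have : (cls a + cls b + cls c) * LL <= 11 * LL by rewrite leq_mul2r -ltnS lt orbT.
  by rewrite /wt /thr !mulnDl; lia.
by rewrite /h0 /bulk_tie ltnNge (ltnW lw) (ltn_eqF lw).
Qed.

Lemma cls_gadget v : v < gg -> 0 < cls v <= 5.
Proof. by move=> vg; rewrite /cls vg; case: ifP. Qed.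

Lemma cls_A i : i < nA -> cls (gg + i) = 6.
Proof.
move=> iA; rewrite /cls ifF; last by rewrite /gg; lia.
by rewrite ifF ?ltn_add2l ?iA //; lia.
Qed.

Lemma cls_S i : nA <= i -> cls (gg + i) = 0.
Proof.
move=> iA; rewrite /cls ifF; last by rewrite /gg; lia.
by rewrite ifF ?ltn_add2l ?ifF //; lia.
Qed.

Lemma fine_A i : i < nA -> finew (gg + i) = 0.
Proof.
move=> iA; rewrite /finew ifF; last by rewrite /gg; lia.
rewrite ifF; last by rewrite /gg; lia.
by rewrite ifF ?ltn_add2l ?iA //; lia.
Qed.

Lemma fine_S i : nA <= i -> finew (gg + i) = ZZ + YY.
Proof.
move=> iA; rewrite /finew ifF; last by rewrite /gg; lia.
rewrite ifF; last by rewrite /gg; lia.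
by rewrite ifF ?ltn_add2l ?ifF //; lia.
Qed.

Lemma attr_A i : i < nA -> attr (gg + i) = i.
Proof. by move=> iA; rewrite /attr leq_addr ltn_add2l iA addKn. Qed.

Lemma attr_S i : nA <= i -> attr (gg + i) = 0.
Proof. by move=> iA; rewrite /attr leq_addr ltn_add2l ltnNge iA. Qed.

Lemma h0_AAS a b s : a < nA -> b < nA -> nA <= s ->
  h0 (gg + a) (gg + b) (gg + s) = ((a + b) %% Lq < rr).
Proof.
move=> aA bA sA; have E : wt (gg + a) + wt (gg + b) + wt (gg + s) = thr.
  by rewrite /wt (cls_A aA) (cls_A bA) (cls_S sA) (fine_A aA) (fine_A bA) (fine_S sA) /thr; lia.
by rewrite /h0 /bulk_tie E ltnn eqxx !leq_addr (attr_A aA) (attr_A bA) (attr_S sA) addn0.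
Qed.

Definition bulk_deg v := \sum_(0 <= c < nA + nS) \sum_(0 <= b < c)
  [&& gg + b != v, gg + c != v & h0 v (gg + b) (gg + c)].

(** At most [gg * nn] pairs of vertices meet the gadget. *)
Lemma tdeg_bulk v : v < nn -> bulk_deg v <= tdeg nn h0 v <= bulk_deg v + gg * nn.
Proof.
move=> vn; rewrite (tdeg_sym vn h0_sym).
pose f b c : nat := [&& b != v, c != v & h0 v b c].
have fle b c : f b c <= 1 by rewrite /f; case: (_ && _).
have bE : bulk_deg v = \sum_(gg <= c < nn) \sum_(gg <= b < c) f b c.
  have shift m (F : nat -> nat) :
      \sum_(gg <= c < m) F c = \sum_(0 <= c < m - gg) F (gg + c).
    by rewrite -{1}[gg]add0n big_addn; apply: eq_bigr => c _; rewrite addnC.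
  rewrite shift /nn -addnA addKn; apply: eq_bigr => c _.
  by rewrite shift addKn.
rewrite bE -[X in _ <= X <= _]/(\sum_(0 <= c < nn) \sum_(0 <= b < c) f b c).
have -> : \sum_(0 <= c < nn) \sum_(0 <= b < c) f b c =
   \sum_(0 <= c < gg) \sum_(0 <= b < c) f b c +
   (\sum_(gg <= c < nn) \sum_(0 <= b < gg) f b c +
    \sum_(gg <= c < nn) \sum_(gg <= b < c) f b c).
  rewrite (big_cat_nat (n := gg)) ?gg_le //=; congr (_ + _).
  rewrite -big_split big_nat [RHS]big_nat; apply: eq_bigr => c /andP[gc _] /=.
  by rewrite (big_cat_nat (n := gg)).
apply/andP; split; first by lia.
have le1 : \sum_(0 <= c < gg) \sum_(0 <= b < c) f b c <= gg * gg.
  rewrite -[X in _ <= X * _]subn0 -sum_nat_const_nat big_nat [leqRHS]big_nat.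
  apply: leq_sum => c /andP[_ cg]; apply: leq_trans (ltnW cg).
  by rewrite -[leqRHS]muln1 -[X in _ <= X * _]subn0 -sum_nat_const_nat; apply: leq_sum => b _.
have le2 : \sum_(gg <= c < nn) \sum_(0 <= b < gg) f b c <= (nn - gg) * gg.
  rewrite -sum_nat_const_nat; apply: leq_sum => c _.
  by rewrite -[leqRHS]muln1 -[X in _ <= X * _]subn0 -sum_nat_const_nat; apply: leq_sum => b _.
have : gg * nn = gg * gg + (nn - gg) * gg by rewrite -mulnDl subnKC ?gg_le // mulnC.
by lia.
Qed.

Lemma bulk_degE v (f : nat -> nat -> bool) (g : nat -> bool) :
  (forall b c, b < c -> c < nA ->
     [&& gg + b != v, gg + c != v & h0 v (gg + b) (gg + c)] = f b c) ->
  (forall b c, b < nA -> nA <= c ->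
     [&& gg + b != v, gg + c != v & h0 v (gg + b) (gg + c)] = g b) ->
  (forall b c, nA <= b -> nA <= c -> h0 v (gg + b) (gg + c) = false) ->
  bulk_deg v = \sum_(0 <= c < nA) \sum_(0 <= b < c) f b c + nS * \sum_(0 <= b < nA) g b.
Proof.
move=> Hf Hg H0; rewrite /bulk_deg (big_cat_nat (n := nA)) ?leq_addr //=; congr (_ + _).
  rewrite big_nat [RHS]big_nat; apply: eq_bigr => c /andP[_ cA].
  by rewrite big_nat [RHS]big_nat; apply: eq_bigr => b /andP[_ bc]; rewrite Hf.
rewrite -{2}[nS](addKn nA) -sum_nat_const_nat big_nat [RHS]big_nat.
apply: eq_bigr => c /andP[cA _]; rewrite (big_cat_nat (n := nA)) //=.
rewrite [X in _ + X]big_nat [X in _ + X]big1 ?addn0; last first.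
  by move=> b /andP[bA _]; rewrite H0 // !andbF.
by rewrite big_nat [RHS]big_nat; apply: eq_bigr => b /andP[_ bA]; rewrite Hg.
Qed.

Lemma bulk_deg_gadget v : v < gg -> bulk_deg v = 'C(nA, 2).
Proof.
move=> vg; have /andP[c0 c5] := cls_gadget vg.
have ne u : (gg + u != v) by rewrite gtn_eqF // (leq_trans vg) ?leq_addr.
rewrite (@bulk_degE v (fun _ _ => true) (fun _ => false)).
- have -> : \sum_(0 <= b < nA) false = 0 by rewrite big1.
  rewrite muln0 addn0; have -> : 'C(nA, 2) = 'C(nA - (nA.+1 < nA), 2) by rewrite ltnNge leqnSn subn0.
  rewrite -count_pairs; apply: eq_big_nat => c /andP[_ cA].
  apply: eq_big_nat => b /andP[_ bc].
  have -> : b != nA.+1 by lia.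
  by have -> : c != nA.+1 by lia.
- by move=> b c bc cA; rewrite !ne h0_above // (cls_A cA) (cls_A (ltn_trans bc cA)); lia.
- by move=> b c bA cA; rewrite !ne h0_below // (cls_A bA) (cls_S cA); lia.
- by move=> b c bA cA; rewrite h0_below // (cls_S bA) (cls_S cA); lia.
Qed.

Hypothesis rr_le : rr <= Lq.

Lemma count_mod L k r a : r <= L ->
  \sum_(0 <= b < k * L) ((a + b) %% L < r) = k * r.
Proof.
move=> rL; rewrite sum_radix -[k in RHS]subn0 -sum_nat_const_nat.
apply: eq_bigr => j _.
transitivity (\sum_(0 <= i < L) ((a + i) %% L < r)).
  by apply: eq_bigr => i _; rewrite addnCA modnMDl.
case: (posnP L) (rL) => [->|L0 _]; first by rewrite leqn0 big_geq // => /eqP.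
elim: a => [|a IH].
  rewrite -[RHS](minn_idPr rL) -count_lt_sum big_nat [RHS]big_nat.
  by apply: eq_bigr => i /andP[_ iL]; rewrite add0n modn_small.
rewrite -[RHS]IH; case: L L0 {rL IH} => // L _; rewrite [LHS]big_nat_recr // [RHS]big_nat_recl //= addnC.
rewrite addSnnS modnDr addn0; congr (_ + _).
by apply: eq_bigr => i _; rewrite addSnnS.
Qed.

Section BulkCount.
Variable k : nat.
Hypothesis nAE : nA = k * Lq.

(** The circulant count includes the diagonal b = i, which is not a triple; [e] is its contribution,
    over all of S. *)
Lemma bulk_deg_A i : i < nA ->
  exists2 e, e <= nS & bulk_deg (gg + i) + e = 'C(nA.-1, 2) + nS * (k * rr).
Proof.
move=> iA; exists (nS * ((i + i) %% Lq < rr)); first by case: (_ < rr); rewrite ?muln1 ?muln0.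
rewrite (@bulk_degE _ (fun b c => (b != i) && (c != i))
   (fun b => (b != i) && ((i + b) %% Lq < rr))).
- rewrite count_pairs iA subn1 -addnA -mulnDr; congr (_ + _ * _).
  rewrite -(count_mod k i rr_le) -nAE.
  rewrite -[X in _ + X](sum_pick (fun b => ((i + b) %% Lq < rr)) iA) -big_split.
  apply: eq_bigr => b _ /=; rewrite eq_sym.
  by case: (i == b); case: (_ < rr).
- move=> b c bc cA; rewrite !eqn_add2l h0_above ?andbT //.
  by rewrite (cls_A iA) (cls_A cA) (cls_A (ltn_trans bc cA)).
- move=> b c bA cA; rewrite !eqn_add2l h0_AAS //.
  by have -> : c != i by rewrite gtn_eqF // (leq_trans iA).
- by move=> b c bA cA; rewrite h0_below // (cls_S bA) (cls_S cA) (cls_A iA).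
Qed.

(** The count over all b and c meets each pair twice, and [e] is the diagonal. *)
Lemma bulk_deg_S i : nA <= i ->
  exists2 e, e <= nA & 2 * bulk_deg (gg + i) + e = nA * (k * rr).
Proof.
move=> iA; exists (\sum_(0 <= b < nA) ((b + b) %% Lq < rr)).
  rewrite -[leqRHS]muln1 -[X in X * _]subn0 -sum_nat_const_nat.
  by apply: leq_sum => b _; apply: leq_b1.
rewrite (@bulk_degE _ (fun b c => (b + c) %% Lq < rr) (fun b => false)).
- have -> : \sum_(0 <= b < nA) false = 0 by rewrite big1.
  rewrite muln0 addn0; have -> : nA * (k * rr) = \sum_(0 <= c < nA) \sum_(0 <= b < nA) ((c + b) %% Lq < rr).
    rewrite -[X in X * _]subn0 -sum_nat_const_nat; apply: eq_bigr => c _.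
    by rewrite -(count_mod k c rr_le) -nAE.
  elim: (nA) => [|m IH]; first by rewrite !big_geq.
  rewrite !big_nat_recr //= mulnDr addnACA IH.
  have -> : \sum_(0 <= c < m) \sum_(0 <= b < m.+1) ((c + b) %% Lq < rr) =
     \sum_(0 <= c < m) \sum_(0 <= b < m) ((c + b) %% Lq < rr) +
     \sum_(0 <= c < m) ((c + m) %% Lq < rr).
    by rewrite -big_split; apply: eq_bigr => c _; rewrite big_nat_recr.
  have -> : \sum_(0 <= b < m) ((m + b) %% Lq < rr) = \sum_(0 <= c < m) ((c + m) %% Lq < rr).
    by apply: eq_bigr => b _; rewrite addnC.
  by lia.
- move=> b c bc cA; have bA := ltn_trans bc cA; have [h1 h2] := h0_sym.
  have -> : gg + b != gg + i by rewrite eqn_add2l ltn_eqF // (leq_trans bA).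
  have -> : gg + c != gg + i by rewrite eqn_add2l ltn_eqF // (leq_trans cA).
  by rewrite h1 h2 h0_AAS.
- by move=> b c bA cA; rewrite h0_below ?andbF // (cls_A bA) (cls_S cA) (cls_S iA).
- by move=> b c bA cA; rewrite h0_below // (cls_S bA) (cls_S cA) (cls_S iA).
Qed.

Lemma rdeg_le v : rdeg v <= gg.
Proof.
case: (ltnP v gg) => [|/rdeg_bulk-> //]; move: v.
have leJ i a : cnt i a <= J by rewrite -(cnt_split i); case: a; lia.
have Jg : J <= gg by rewrite /gg /gp; nia.
apply: vertex_cases => [j i jJ iC|j i jJ iC|i a b iC].
- by rewrite rdeg_pv // /gg; lia.
- by rewrite rdeg_qv // /gg; lia.
- rewrite rdeg_tv //; have := need_le a iC; have := leJ i a; case: b; lia.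
Qed.

(** The three cases are the gadget, A and S. Degrees are doubled to avoid halves. The term [4 * nn]
    pays for diagonals and for squares in place of binomials, and [4 * gg * nn] for the pairs which
    meet the gadget and for [rdeg]. *)
Lemma dseq_bounds v : v < nn ->
  [\/ nA * nA <= 2 * dseq v + 4 * nn /\ 2 * dseq v <= nA * nA + 4 * gg * nn,
      nA * nA + 2 * nS * (k * rr) <= 2 * dseq v + 4 * nn /\
      2 * dseq v <= nA * nA + 2 * nS * (k * rr) + 4 * gg * nn |
      nA * (k * rr) <= 2 * dseq v + 4 * nn /\
      2 * dseq v <= nA * (k * rr) + 4 * gg * nn].
Proof.
move=> vn; have /andP[l u] := tdeg_bulk vn; have rd := rdeg_le v.
have g0 : 0 < gg by rewrite /gg; lia.
have gn : gg <= gg * nn by rewrite leq_pmulr //; move: vn; lia.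
have bin2' m : 2 * 'C(m, 2) = m * m.-1.
  by rewrite bin2 mul2n halfK oddM; case: m => // m /=; rewrite andNb subn0.
rewrite /dseq; case: (ltnP v gg) => vg.
  constructor 1; move: l u; rewrite bulk_deg_gadget // => l u.
  have sq : 2 * 'C(nA, 2) <= nA * nA <= 2 * 'C(nA, 2) + nA.
    by rewrite bin2'; case: (nA) => [|m] //=; nia.
  have an : nA <= nn by rewrite /nn; lia.
  by split; lia.
have [i iE] : exists i, v = gg + i by exists (v - gg); rewrite subnKC.
subst v; case: (ltnP i nA) => iA.
  constructor 2; have [e le E] := bulk_deg_A iA.
  have sq : 2 * 'C(nA.-1, 2) <= nA * nA <= 2 * 'C(nA.-1, 2) + 4 * nA.
    by rewrite bin2'; case: (nA) => [|[|m]] //=; rewrite !mulSn !mulnS; lia.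
  rewrite rdeg_bulk // addn0; move: l u rd gn sq; rewrite /nn.
  set d := tdeg _ _ _; set B := bulk_deg _; lia.
constructor 3; have [e le E] := bulk_deg_S iA.
by rewrite rdeg_bulk // addn0; move: l u rd gn; rewrite /nn; lia.
Qed.

End BulkCount.

End Gadget.

(** * Tilings as exact covers *)

Section Tiling.

(* Tiles are the numbers below [Om], with the colours of their four sides;
   the cells of the grid are numbered row by row. *)
Variables (Om Kh Kv : nat) (cE cW cN cS : nat -> nat) (allowed : nat -> nat -> bool).
Variables (rows cols : nat).

Definition cells := rows * cols.
(** The elements attached to a cell: one for having a tile, one for the tile being allowed there,
    and one for each colour of the sides to the next column and to the next row. *)
Definition slots := 2 + Kh + Kv.

Definition tiling (tau : nat -> nat) := forall u, u < cells ->
  [/\ tau u < Om, allowed u (tau u),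
      (u %% cols).+1 < cols -> cE (tau u) = cW (tau u.+1) &
      u + cols < cells -> cN (tau u) = cS (tau (u + cols))].

(* The dummy tile [Om] occurs in every constraint except those of slot 0, so
   that it is excluded by counting the tiles. *)
Definition cmem u s v a : bool :=
  if s == 0 then (v == u) && (a < Om)
  else if a == Om then v == u
  else if s == 1 then (v == u) && allowed u a
  else if s < 2 + Kh then
    if (u %% cols).+1 < cols then
      ((v == u) && (cE a == s - 2)) || ((v == u.+1) && ~~ (cW a == s - 2))
    else v == u
  else if u + cols < cells then
    ((v == u) && (cN a == s - (2 + Kh))) || ((v == u + cols) && ~~ (cS a == s - (2 + Kh)))
  else v == u.

Definition tmem i j := cmem (i %/ slots) (i %% slots) (j %/ Om.+1) (j %% Om.+1).

Definition tJ := cells * Om.+1.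
Definition tC := cells * slots.

Hypotheses (cE_lt : forall a, a < Om -> cE a < Kh) (cN_lt : forall a, a < Om -> cN a < Kv).
Hypotheses (Om_gt0 : 0 < Om) (cells_gt2 : 2 < cells).

Lemma slots_gt0 : 0 < slots. Proof. by []. Qed.

Lemma sum_tmem (X : nat -> bool) u s : s < slots ->
  \sum_(0 <= j < tJ) (X j && tmem (u * slots + s) j) =
  \sum_(0 <= v < cells) \sum_(0 <= a < Om.+1) (X (v * Om.+1 + a) && cmem u s v a).
Proof.
move=> ss; rewrite /tJ sum_radix; apply: eq_bigr => v _.
apply: eq_big_nat => a /andP[_ la]; rewrite /tmem.
by rewrite !divnMDl // !modnMDl !modn_small // !divn_small // !addn0.
Qed.

Lemma sum_tmem_tau (tau : nat -> nat) X u s : s < slots ->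
  (forall v, v < cells -> tau v < Om) ->
  (forall v a, v < cells -> a <= Om -> X (v * Om.+1 + a) = (tau v == a)) ->
  \sum_(0 <= j < tJ) (X j && tmem (u * slots + s) j) =
  \sum_(0 <= v < cells) cmem u s v (tau v).
Proof.
move=> ss tO XE; rewrite sum_tmem //; apply: eq_big_nat => v /andP[_ vc].
transitivity (\sum_(0 <= a < Om.+1) cmem u s v a * (tau v == a)).
  apply: eq_big_nat => a /andP[_ la]; rewrite XE //.
  by case: (tau v == a); rewrite ?muln1 ?muln0.
by rewrite sum_pick // ltnW // ltnS tO.
Qed.

Lemma sum_eq1 (A : nat -> bool) u : u < cells ->
  \sum_(0 <= v < cells) ((v == u) && A v) = A u.
Proof.
move=> uc; rewrite -[RHS](sum_pick (fun v => A v) uc); apply: eq_bigr => v _.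
by rewrite eq_sym; case: (u == v); rewrite ?muln1 ?muln0.
Qed.

Lemma sum_eq2 (A B : nat -> bool) u u' : u < cells -> u' < cells -> u != u' ->
  \sum_(0 <= v < cells) (((v == u) && A v) || ((v == u') && B v)) = A u + B u'.
Proof.
move=> uc uc' uu; rewrite -(sum_eq1 A uc) -(sum_eq1 B uc') -big_split.
apply: eq_bigr => v _ /=; case: (eqVneq v u) => [->|_] /=; last by rewrite add0n.
by rewrite (negbTE uu) orbF addn0.
Qed.

Lemma next_lt u : u < cells -> (u %% cols).+1 < cols -> u.+1 < cells.
Proof.
move=> uc ul; rewrite /cells (divn_eq u cols).
have : u %/ cols < rows by rewrite ltn_divLR //; lia.
by nia.
Qed.

(** For a colour c, the cell covers its element if its side is c, and the neighbour covers it if its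
    own side is not c. Together they cover it exactly once when both sides are c or neither is. *)
Lemma sum_cmem (tau : nat -> nat) u s : u < cells ->
  (forall v, v < cells -> tau v < Om) ->
  \sum_(0 <= v < cells) cmem u s v (tau v) =
  if s == 0 then 1
  else if s == 1 then nat_of_bool (allowed u (tau u))
  else if s < 2 + Kh then
    if (u %% cols).+1 < cols then
      (cE (tau u) == s - 2) + ~~ (cW (tau u.+1) == s - 2)
    else 1
  else if u + cols < cells then
    (cN (tau u) == s - (2 + Kh)) + ~~ (cS (tau (u + cols)) == s - (2 + Kh))
  else 1.
Proof.
move=> uc tO.
have cmE v : v < cells -> cmem u s v (tau v) =
  if s == 0 then (v == u) && true
  else if s == 1 then (v == u) && allowed u (tau v)
  else if s < 2 + Kh then
    if (u %% cols).+1 < cols then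
      ((v == u) && (cE (tau v) == s - 2)) || ((v == u.+1) && ~~ (cW (tau v) == s - 2))
    else (v == u) && true
  else if u + cols < cells then
    ((v == u) && (cN (tau v) == s - (2 + Kh))) || ((v == u + cols) && ~~ (cS (tau v) == s - (2 + Kh)))
  else (v == u) && true.
  by move=> vc; have lt := tO v vc; rewrite /cmem lt (ltn_eqF lt) !andbT.
have -> : \sum_(0 <= v < cells) cmem u s v (tau v) = \sum_(0 <= v < cells)
  nat_of_bool (if s == 0 then (v == u) && true
  else if s == 1 then (v == u) && allowed u (tau v)
  else if s < 2 + Kh then
    if (u %% cols).+1 < cols then
      ((v == u) && (cE (tau v) == s - 2)) || ((v == u.+1) && ~~ (cW (tau v) == s - 2))
    else (v == u) && true
  else if u + cols < cells then
    ((v == u) && (cN (tau v) == s - (2 + Kh))) || ((v == u + cols) && ~~ (cS (tau v) == s - (2 + Kh)))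
  else (v == u) && true).
  by apply: eq_big_nat => v /andP[_ vc]; rewrite cmE.
case: (s == 0); first exact: (sum_eq1 (fun _ => true)).
case: (s == 1); first exact: (sum_eq1 (fun v => allowed u (tau v))).
case: (s < 2 + Kh).
  case: ltnP => lc; last exact: (sum_eq1 (fun _ => true)).
  apply: (sum_eq2 (fun v => cE (tau v) == s - 2) (fun v => ~~ (cW (tau v) == s - 2))) => //.
    exact: next_lt.
  by rewrite ltn_eqF.
case: ltnP => lc; last exact: (sum_eq1 (fun _ => true)).
apply: (sum_eq2 (fun v => cN (tau v) == s - (2 + Kh))
  (fun v => ~~ (cS (tau v) == s - (2 + Kh)))) => //.
have : 0 < cols by move: cells_gt2; rewrite /cells; case: cols => //; lia.
by rewrite -[X in X != _]addn0 eqn_add2l eq_sym -lt0n.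
Qed.

Lemma tiling_exact_cover : (exists tau, tiling tau) -> exact_cover tJ tC cells tmem.
Proof.
move=> [tau tt]; have tO v : v < cells -> tau v < Om by move=> /tt[].
exists (fun j => tau (j %/ Om.+1) == j %% Om.+1).
have XE v a : v < cells -> a <= Om ->
    (tau ((v * Om.+1 + a) %/ Om.+1) == (v * Om.+1 + a) %% Om.+1) = (tau v == a).
  by move=> _ aO; rewrite divnMDl // divn_small // addn0 modnMDl modn_small.
split=> [i iC|]; last first.
  rewrite /tJ sum_radix -[RHS]muln1 -[X in X * _]subn0 -sum_nat_const_nat.
  apply: eq_big_nat => v /andP[_ vc].
  rewrite -[RHS](sum_pick (fun=> 1) (ltnW (tO v vc) : tau v < Om.+1)).
  by apply: eq_big_nat => a /andP[_ aO]; rewrite XE // mul1n.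
rewrite (divn_eq i slots); set u := i %/ slots; set s := i %% slots.
have ss : s < slots by rewrite ltn_mod.
have uc : u < cells by rewrite ltn_divLR.
rewrite (sum_tmem_tau u ss tO XE) sum_cmem //.
have [_ al hE vE] := tt u uc.
case: (s == 0) => //; case: (s == 1); first by rewrite al.
case: (s < 2 + Kh).
  by case: ltnP => // lc; rewrite hE //; case: (_ == _).
by case: ltnP => // lc; rewrite vE //; case: (_ == _).
Qed.

Lemma exact_cover_tiling : exact_cover tJ tC cells tmem -> exists tau, tiling tau.
Proof.
move=> [X [X1 XN]].
pose x v a := X (v * Om.+1 + a).
have con u s : u < cells -> s < slots ->
    \sum_(0 <= v < cells) \sum_(0 <= a < Om.+1) (x v a && cmem u s v a) = 1.
  move=> uc ss; rewrite -sum_tmem //; apply: X1.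
  by rewrite /tC; nia.
have row u : u < cells -> \sum_(0 <= a < Om) x u a = 1.
  move=> uc; rewrite -[RHS](con u 0 uc slots_gt0).
  transitivity (\sum_(0 <= v < cells) (\sum_(0 <= a < Om) x v a) * (u == v)).
    by rewrite sum_pick.
  apply: eq_bigr => v _; rewrite big_nat_recr //= /cmem /= ltnn !andbF addn0 big_distrl /=.
  apply: eq_big_nat => a /andP[_ aO]; rewrite aO andbT eq_sym.
  by case: (v == u); case: (x v a).
(* Slot 0 gives each cell one proper tile, which already accounts for all the [cells] sets of the
   cover. *)
have xO u : u < cells -> x u Om = false.
  move=> uc; apply/negbTE/negP => xu.
  have : \sum_(0 <= v < cells) x v Om = 0.
    apply/eqP; rewrite -(eqn_add2l cells) addn0 -[X in X + _]muln1 -[X in X * _ + _]subn0.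
    rewrite -sum_nat_const_nat -big_split /= -[X in _ == X]XN /tJ sum_radix.
    apply/eqP; apply: eq_big_nat => v /andP[_ vc]; rewrite -(row v vc).
    by rewrite [RHS]big_nat_recr.
  rewrite (bigD1_seq u) ?mem_index_iota ?iota_uniq //= xu; lia.
have xtau u : u < cells -> exists2 a, a < Om & forall a', a' <= Om -> x u a' = (a == a').
  move=> uc; have := row u uc.
  case: (boolP [exists a : 'I_Om, x u a]) => [/existsP[a xa] r|/existsPn no]; last first.
    rewrite big_mkord big1 // => a _; by rewrite (negbTE (no a)).
  exists a => // a'; rewrite leq_eqVlt => /predU1P[->|la']; first by rewrite xO // ltn_eqF.
  case: (eqVneq (a : nat) a') => [<-//|ne]; apply/negbTE/negP => xa'.
  move: r; rewrite (bigD1_seq (a : nat)) ?mem_index_iota ?iota_uniq //= xa.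
  rewrite big_mkcond /= (bigD1_seq a') ?mem_index_iota ?iota_uniq //=.
  by rewrite eq_sym ne xa'; lia.
pose tau u := if pselect (u < cells) is left uc then
  sval (cid2 (xtau u uc)) else 0.
have [tO xE] : (forall v, v < cells -> tau v < Om) /\
   (forall v a, v < cells -> a <= Om -> X (v * Om.+1 + a) = (tau v == a)).
  by split=> [v|v a] vc; rewrite /tau; case: pselect => // vc'; case: cid2 => //= b bO; apply.
exists tau => u uc.
have con' s : s < slots -> \sum_(0 <= v < cells) cmem u s v (tau v) = 1.
  move=> ss; rewrite -(sum_tmem_tau u ss tO xE); apply: X1.
  by rewrite /tC; nia.
split; first exact: tO.
- have : 1 < slots by [].
  by move/con'; rewrite sum_cmem //=; case: allowed.
- move=> lc; have lt := cE_lt (tO u uc).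
  have : 2 + cE (tau u) < slots by rewrite /slots; lia.
  move/con'; rewrite sum_cmem //.
  have -> : (2 + cE (tau u) == 0) = false by [].
  have -> : (2 + cE (tau u) == 1) = false by [].
  rewrite ltn_add2l lt lc addKn eqxx.
  by case: (eqVneq (cW (tau u.+1)) (cE (tau u))).
- move=> lc; have lt := cN_lt (tO u uc).
  have : 2 + Kh + cN (tau u) < slots by rewrite /slots; lia.
  move/con'; rewrite sum_cmem //.
  have -> : (2 + Kh + cN (tau u) == 0) = false by [].
  have -> : (2 + Kh + cN (tau u) == 1) = false by [].
  have -> : (2 + Kh + cN (tau u) < 2 + Kh) = false by lia.
  rewrite lc addKn eqxx.
  by case: (eqVneq (cS (tau (u + cols))) (cN (tau u))).
Qed.

(** For [a = true], each element is in some set: this is why the dummy tile exists. For [a = false],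
    an element is only in sets of at most two cells, and [cells > 2] leaves enough others. *)
Lemma tiling_need_le i a : i <= tC -> sel tC cells i a <= cnt tJ tC tmem i a.
Proof.
move=> iC; have cT : cntT tJ tC tmem tC = 0 by rewrite /cntT big1 // => j _; rewrite /msel ltnn.
rewrite /sel /cnt /need; move: iC; rewrite leq_eqVlt => /predU1P[->|iC].
  rewrite ltnn cT !subn0; case: a => //; by rewrite /tJ leq_pmulr.
rewrite iC; set u := i %/ slots; set s := i %% slots.
have ss : s < slots by rewrite ltn_mod.
have uc : u < cells by rewrite ltn_divLR.
have cE' : cntT tJ tC tmem i =
    \sum_(0 <= v < cells) \sum_(0 <= b < Om.+1) cmem u s v b.
  have := sum_tmem (fun=> true) u ss; rewrite -divn_eq => <-.
  by apply: eq_bigr => j _; rewrite /msel iC.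
rewrite cE'; case: a.
  pose b := if s == 0 then 0 else Om.
  have bO : b < Om.+1 by rewrite /b; case: ifP.
  have cb : cmem u s u b.
    rewrite /cmem /b; case: (s == 0); first by rewrite eqxx.
    by rewrite eqxx eqxx.
  rewrite (bigD1_seq u) ?mem_index_iota ?iota_uniq //=.
  by rewrite (bigD1_seq b) ?mem_index_iota ?iota_uniq //= cb.
have [u' cle] : exists u', forall v b, cmem u s v b <= (v == u) + (u' == v).
  exists (if s < 2 + Kh then u.+1 else u + cols) => v b; rewrite /cmem.
  case: (s == 0); first by case: (v == u); case: (_ < _).
  case: (b == Om); first by case: (v == u).
  case: (s == 1); first by case: (v == u); case: allowed.
  rewrite ![_ == v]eq_sym; case: (s < 2 + Kh); case: ifP => _; try by case: (v == u).
    by case: (v == u); case: (v == u.+1); case: (_ == _); case: (_ == _).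
  by case: (v == u); case: (v == u + cols); case: (_ == _); case: (_ == _).
have le : \sum_(0 <= v < cells) \sum_(0 <= b < Om.+1) cmem u s v b <= 2 * Om.+1.
  apply: (@leq_trans (\sum_(0 <= v < cells) (Om.+1 * (u == v) + Om.+1 * (u' == v)))).
    apply: leq_sum => v _; rewrite -mulnDr -[X in X * _]subn0 -sum_nat_const_nat.
    by apply: leq_sum => b _; rewrite [u == v]eq_sym; apply: cle.
  rewrite big_split /= sum_pick // sum_pred1 mul2n -addnn leq_add2l.
  by case: (u' < cells); rewrite ?mul1n ?mul0n.
have : cells - 1 + 2 * Om.+1 <= tJ by rewrite /tJ; nia.
lia.
Qed.

End Tiling.

(** * Computations as tilings *)

Section Tableau.

Variable M : TM.
Let F := {ffun 'I_(extra M).+1 -> option (bool + symb M)}.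
Let St := state M.
Let Act := {ffun 'I_(extra M).+1 -> option (bool + symb M) * move}.

(** A halted machine idles by rewriting what it reads, so that its rows obey the same local rule. *)
Definition act (q : St) (rd : F) : St * Act :=
  if halting q then (q, [ffun i => (rd i, MoveN)]) else trans q rd.

Definition written (a : St * Act) : F := [ffun i => (a.2 i).1].

Definition newl (a : St * Act) (lm l0 lp : F) : F := [ffun i =>
  match (a.2 i).2 with MoveL => lp i | MoveN => l0 i | MoveR => lm i end].

Definition newr (a : St * Act) (rm r0 rp : F) : F := [ffun i =>
  match (a.2 i).2 with MoveL => rm i | MoveN => r0 i | MoveR => rp i end].

(* The tapes relative to their heads: [L k] and [R k] are the cells at distance
   [k] to the left and to the right; [post] is the right part after writing. *)
Definition ccfg := (St * (nat -> F) * (nat -> F))%type.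

Definition post (c : ccfg) k : F :=
  if k is _.+1 then c.2 k else written (act c.1.1 (c.2 0)).

Definition left_of (c : ccfg) k : F := if k is k'.+1 then c.1.2 k' else post c 0.
Definition right_of (c : ccfg) k : F := if k is k'.+1 then post c k' else c.1.2 0.

Definition cstep (c : ccfg) : ccfg :=
  let a := act c.1.1 (c.2 0) in
  (a.1, fun k => newl a (left_of c k) (c.1.2 k) (c.1.2 k.+1),
        fun k => newr a (right_of c k) (post c k) (post c k.+1)).

Definition hcontent (c : config M) : ccfg :=
  (c.1, fun k => [ffun i => nth None (tleft (c.2 i)) k],
        fun k => [ffun i => nth None (tright (c.2 i)) k]).

Lemma hcontent_step c : hcontent (step c) = cstep (hcontent c).
Proof.
have rdE : (hcontent c).2 0 = [ffun i => tread (c.2 i)].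
  by apply/ffunP => i; rewrite !ffunE nth0.
rewrite /step /cstep /left_of /right_of /post /act rdE.
case: (boolP (halting c.1)) => hc /=.
  congr (_, _, _); apply/funext => k; apply/ffunP => i; rewrite !ffunE //=.
  by case: k => [|k]; rewrite ?ffunE //= ?ffunE /= ?ffunE // /tread nth0.
case: (trans _ _) => q a /=.
congr (_, _, _); apply/funext => k; apply/ffunP => i; rewrite !ffunE /=;
  case E : (a i) => [x []] /=; case: k => [|[|k]];
  rewrite /= ?ffunE /= ?ffunE /= ?E /= ?nth_behead ?nth0 //;
  by rewrite ?ffunE /= ?E /= ?nth_behead ?nth0.
Qed.

(** A column holds the cells at one distance from the heads, on both sides and for all the tapes, so
    the heads stay in column 0 and the tapes shift instead. As every column needs the action, each
    tile also carries the state and the symbols read, constant along a row. The triples are the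
    cells at the previous, own and next distance. *)
Definition Tile := (St * F * bool * (F * F * F) * (F * F * F))%type.
Implicit Type x : Tile.

Definition tq x := x.1.1.1.1.
Definition trd x := x.1.1.1.2.
Definition tz x := x.1.1.2.
Definition tlm x := x.1.2.1.1.
Definition tl0 x := x.1.2.1.2.
Definition tlp x := x.1.2.2.
Definition trm x := x.2.1.1.
Definition tr0 x := x.2.1.2.
Definition trp x := x.2.2.
(** [tr0] is the cell after writing, which differs from the cell before writing under the heads
    only. *)
Definition tpre x := if tz x then trd x else tr0 x.
Definition tact x := act (tq x) (trd x).

Definition edgeE x := (tq x, trd x, (tl0 x, tlp x), (tr0 x, trp x)).
Definition edgeW x := (tq x, trd x, (tlm x, tl0 x), (trm x, tr0 x)).
Definition edgeN x :=
  ((tact x).1, newl (tact x) (tlm x) (tl0 x) (tlp x), newr (tact x) (trm x) (tr0 x) (trp x)).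
Definition edgeS x := (tq x, tl0 x, tpre x).

(* The cells of the initial row: a given bit (1, 2), a bit or a blank which is
   followed by blanks (3), a blank (4). *)
Definition init_ok (code : nat) (c d : option (bool + symb M)) : bool :=
  match code with
  | 1 => c == Some (inl true)
  | 2 => c == Some (inl false)
  | 3 => [|| c == Some (inl true), c == Some (inl false) | (c == None) && (d == None)]
  | _ => c == None
  end.

(** [z] marks the column of the heads, where the half-tapes are glued: the cell before the first one
    on either side is the first one on the other side. [acc] asks for the answer true on tape 0, and
    a positive [code] marks the initial row. *)
Definition kind_ok (z acc : bool) (code : nat) x : bool :=
  [&& tz x == z,
      z ==> [&& tr0 x == written (tact x), tlm x == tr0 x & trm x == tl0 x],
      acc ==> (trd x ord0 == Some (inl true)) &
      (0 < code) ==> [&& tq x == start M, tl0 x == [ffun=> None],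
        [forall i, (i != ord0) ==> (tpre x i == None)] &
        init_ok code (tpre x ord0) (trp x ord0)]].

Definition grid_ok T W (code : nat -> nat) (tau : nat -> nat -> Tile) :=
  forall t o, t <= T -> o <= W ->
  [/\ kind_ok (o == 0) ((t == T) && (o == 0)) (if t == 0 then code o else 0) (tau t o),
      o < W -> edgeE (tau t o) = edgeW (tau t o.+1) &
      t < T -> edgeN (tau t o) = edgeS (tau t.+1 o)].

Definition tile_at (c : ccfg) o : Tile :=
  (c.1.1, c.2 0, o == 0, (left_of c o, c.1.2 o, c.1.2 o.+1),
   (right_of c o, post c o, post c o.+1)).

Definition grid_of (c : ccfg) t o := tile_at (iter t cstep c) o.

Lemma tpre_tile_at c o : tpre (tile_at c o) = c.2 o.
Proof. by rewrite /tpre /tile_at /tz /=; case: o. Qed.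

Lemma grid_of_ok T W code (c : ccfg) :
  (forall o, o <= W -> 0 < code o -> [&& c.1.1 == start M, c.1.2 o == [ffun=> None],
        [forall i, (i != ord0) ==> (c.2 o i == None)] &
        init_ok (code o) (c.2 o ord0) (c.2 o.+1 ord0)]) ->
  (iter T cstep c).2 0 ord0 = Some (inl true) ->
  grid_ok T W code (grid_of c).
Proof.
move=> Hc HT t o tT oW; split.
- apply/and4P; split.
  + by rewrite /grid_of /tile_at.
  + by rewrite /grid_of /tile_at; case: o {oW} => //=; rewrite /tr0 /= eqxx /tlm /trm /= !eqxx.
  + by apply/implyP => /andP[/eqP-> _]; rewrite /grid_of /trd /= HT.
  + case: (t == 0) /eqP => // ->; apply/implyP => c0; rewrite tpre_tile_at.
    exact: Hc.
- by move=> _; rewrite /edgeE /edgeW /grid_of.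
- by move=> _; rewrite /edgeN /edgeS tpre_tile_at.
Qed.

(** The last column has no neighbour to check what it guesses beyond it. Such errors move inwards by
    one column per row, so the invariant is restricted to o + t <= W, and [T <= W] keeps column 0
    correct up to the last row. *)
Lemma grid_ok_iter T W code tau (c : ccfg) : grid_ok T W code tau -> T <= W ->
  (forall o, o <= W -> 0 < code o) ->
  c.1.1 = start M -> (forall k, c.1.2 k = [ffun=> None]) ->
  (forall o, o <= W -> c.2 o = tpre (tau 0 o)) ->
  (iter T cstep c).2 0 ord0 = Some (inl true).
Proof.
move=> G TW c0 cq cl cr.
have row t o : t <= T -> o <= W -> tq (tau t o) = tq (tau t 0) /\ trd (tau t o) = trd (tau t 0).
  move=> tT; elim: o => // o IH oW.
  have [_ /(_ oW)] := G t o tT (ltnW oW).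
  by have [<- <-] := IH (ltnW oW); rewrite /edgeE /edgeW => -[-> ->].
have zE t o : t <= T -> o <= W -> tz (tau t o) = (o == 0).
  by move=> tT oW; have [/and4P[/eqP]] := G t o tT oW.
have pre0 t : t <= T -> tpre (tau t 0) = trd (tau t 0).
  by move=> tT; rewrite /tpre zE.
have inv t : t <= T -> forall o, o + t <= W ->
   [/\ tq (tau t o) = (iter t cstep c).1.1, trd (tau t o) = (iter t cstep c).2 0,
       tl0 (tau t o) = (iter t cstep c).1.2 o & tpre (tau t o) = (iter t cstep c).2 o].
  elim: t => [|t IH] tT o oW.
    rewrite addn0 in oW; have [/and4P[_ _ _ /implyP]] := G 0 o tT oW.
    rewrite /= => /(_ (c0 _ oW)) /and4P[/eqP qE /eqP lE _ _] _ _.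
    have [_ ->] := row 0 o tT oW; rewrite -pre0 // -!cr //; split=> //.
      by rewrite qE cq.
    by rewrite lE cl.
  have oW' : o <= W by apply: leq_trans oW; rewrite leq_addr.
  have o0W : 0 + t.+1 <= W by apply: leq_trans oW; rewrite leq_add2r.
  have step_ok o' : o' + t.+1 <= W -> edgeS (tau t.+1 o') =
      ((cstep (iter t cstep c)).1.1, (cstep (iter t cstep c)).1.2 o', (cstep (iter t cstep c)).2 o').
    move=> o'W; have o'W1 : o' <= W by apply: leq_trans o'W; rewrite leq_addr.
    have o'W2 : o' + t <= W by lia.
    have o'W3 : o'.+1 + t <= W by lia.
    have [k1 e1 /(_ tT) <-] := G t o' (ltnW tT) o'W1.
    have o'lt : o' < W by lia.
    set d := iter t cstep c in IH *.
    have [q1 r1 l1 p1] := IH (ltnW tT) o' o'W2.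
    have [q2 r2 l2 p2] := IH (ltnW tT) o'.+1 o'W3.
    have aE : tact (tau t o') = act d.1.1 (d.2 0) by rewrite /tact q1 r1.
    have postE : tr0 (tau t o') = post d o'.
      move: k1 => /and4P[_ k2 _ _]; move: p1 k2 aE; rewrite /tpre zE //; last exact: ltnW.
      by case: (o') => [|o''] //= _ /and3P[/eqP-> _ _] ->.
    have post1E : tr0 (tau t o'.+1) = post d o'.+1.
      by move: p2; rewrite /tpre zE //; exact: ltnW.
    have [lpE rpE] : tlp (tau t o') = d.1.2 o'.+1 /\ trp (tau t o') = post d o'.+1.
      by move: (e1 o'lt); rewrite /edgeE /edgeW -l2 -post1E => -[_ _ _ -> _ ->].
    have [lmE rmE] : tlm (tau t o') = left_of d o' /\ trm (tau t o') = right_of d o'.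
      case: o' {e1 o'lt o'W3 q2 r2 l2 p2 post1E lpE rpE} k1 o'W o'W1 o'W2 q1 r1 l1 p1 aE postE => [|o'] k1 o'W o'W1 o'W2 q1 r1 l1 p1 aE postE.
        by move: k1 => /and4P[_ /= /and3P[_ /eqP-> /eqP->] _ _]; rewrite postE l1.
      have o'W4 : o' + t <= W by lia.
      have [_ e3 _] := G t o' (ltnW tT) (ltnW o'W1).
      have [q3 r3 l3 p3] := IH (ltnW tT) o' o'W4.
      have [k3 _ _] := G t o' (ltnW tT) (ltnW o'W1).
      have post3 : tr0 (tau t o') = post d o'.
        move: k3 => /and4P[_ k3 _ _]; move: p3 k3; rewrite /tpre zE //; try exact: ltnW.
        have aE3 : tact (tau t o') = act d.1.1 (d.2 0) by rewrite /tact q3 r3.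
        by case: (o') aE3 => [|o''] //= aE3 _ /and3P[/eqP-> _ _]; rewrite aE3.
      by move: (e3 o'W1); rewrite /edgeE /edgeW => -[_ _ <- _ <- _]; rewrite l3 post3.
    by rewrite /edgeN aE lmE l1 lpE rmE postE rpE.
  have := step_ok o oW; rewrite /edgeS => -[-> -> ->].
  have [_ ->] := row t.+1 o tT oW'.
  by have := step_ok 0 o0W; rewrite /edgeS -pre0 // => -[_ _ ->].
have T0 : 0 + T <= W by [].
have [_ rE _ _] := inv T (leqnn T) 0 T0.
rewrite -rE; have [/and4P[_ _ /implyP a _] _ _] := G T 0 (leqnn T) (leq0n W).
by apply/eqP/a; rewrite !eqxx.
Qed.

End Tableau.

Lemma leq_poly_bound k n m : n <= m -> poly_bound k n <= poly_bound k m.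
Proof.
move=> nm; rewrite /poly_bound leq_add2r leq_mul2l; apply/orP; right.
by case: k => // k; rewrite leq_exp2r.
Qed.

Lemma head_leading_bits (G : finType) (s : seq (cell G)) b :
  leading_bits s = [:: b] -> nth None s 0 = Some (inl b).
Proof. by case: s => [|[[b'|]|] s] //= [->]. Qed.

Lemma bits_of_cells (G : finType) B (c : nat -> cell G) :
  (forall k, [\/ c k = Some (inl true), c k = Some (inl false) | c k = None]) ->
  (forall k, c k = None -> c k.+1 = None) -> c B = None ->
  exists2 y, size y <= B & forall k, c k = nth None [seq Some (inl b) | b <- y] k.
Proof.
elim: B c => [|B IH] c cb cn cB.
  by exists [::] => // k; rewrite nth_nil; elim: k => // k /cn.
have [c0|c0] : c 0 = None \/ exists b, c 0 = Some (inl b).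
- by case: (cb 0); [right; exists true|right; exists false|left].
- by exists [::] => // k; rewrite nth_nil; elim: k => // k /cn.
have [b bE] := c0.
have [y yB yE] := IH (fun k => c k.+1) (fun k => cb k.+1) (fun k => cn k.+1) cB.
by exists (b :: y) => // -[|k] //=.
Qed.

(** * Acceptance of some certificate as a tableau *)

Section Acceptance.

Variables (M : TM) (V : seq bool -> bool) (kt kc : nat).
Hypothesis MV : computes_in M (poly_bound kt) (fun w => [:: V w]).

Definition cert_bound (w : seq bool) := poly_bound kc (size w).
Definition in_len w := 2 * size w + 1 + cert_bound w.
Definition time w := poly_bound kt (in_len w).
Definition width w := time w + in_len w + 2.

(** The cells of [encode_pair w y]: flags at the even positions, bits of [w] at the odd ones, the
    end flag at [2 * size w], then the free cells of the certificate up to [in_len w], then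
    blanks. *)
Definition init_code (w : seq bool) o :=
  if o < 2 * size w then
    if odd o then if nth false w (o %/ 2) then 1 else 2 else 1
  else if o == 2 * size w then 2 else if o < in_len w then 3 else 4.

Lemma init_code_gt0 w o : 0 < init_code w o.
Proof. by rewrite /init_code; do !case: ifP. Qed.

Lemma accept_head x T : poly_bound kt (size x) <= T ->
  let c := iter T (@step M) (init M x) in
  (nth None (tright (c.2 ord0)) 0 = Some (inl true)) <-> V x.
Proof.
move=> leT; have [haltd outE] := MV x; rewrite /output in outE.
set c0 := iter _ _ _ in haltd outE.
have -> : iter T (@step M) (init M x) = c0.
  rewrite -(subnK leT) iterD -/c0.
  by elim: (T - _) => // d; rewrite iterS => ->; rewrite /step haltd.
rewrite /= (head_leading_bits outE).
by case: (V x); split.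
Qed.

Lemma iter_content T (c : config M) : hcontent (iter T (@step M) c) = iter T (@cstep M) (hcontent c).
Proof. by elim: T => //= T <-; exact: hcontent_step. Qed.

Lemma content_init2 x o : (hcontent (init M x)).2 o =
  [ffun i => if i == ord0 then nth None [seq Some (inl b) | b <- x] o else None].
Proof. by apply/ffunP => i; rewrite !ffunE /=; case: eqP => //=; rewrite nth_nil. Qed.

Lemma cell_encode_pair w y o : o < 2 * size w + 1 ->
  nth None [seq Some (inl b) : cell (symb M) | b <- encode_pair w y] o =
  Some (inl (init_code w o == 1)).
Proof.
move=> ow; have szx : size (encode_pair w y) = 2 * size w + 1 + size y.
  by rewrite size_cat size_self_delimit.
rewrite (nth_map false); last by rewrite szx; lia.
rewrite nth_encode_pair ow nth_self_delimit /init_code; congr (Some (inl _)).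
case: ltnP => [lt|ge] /=; first by case: odd => //; case: nth.
by have -> : o == 2 * size w by lia.
Qed.

Lemma cell_encode_pair_cert w y o :
  nth None [seq Some (inl b) : cell (symb M) | b <- encode_pair w y] (2 * size w + 1 + o) =
  nth None [seq Some (inl b) : cell (symb M) | b <- y] o.
Proof.
rewrite /encode_pair map_cat nth_cat size_map size_self_delimit ltnNge leq_addr /=.
by rewrite addKn.
Qed.

Lemma time_ge w y : size y <= cert_bound w ->
  poly_bound kt (size (encode_pair w y)) <= time w.
Proof.
move=> sy; apply: leq_poly_bound; rewrite size_cat size_self_delimit.
by rewrite /in_len leq_add2l.
Qed.

Lemma accept_grid w :
  (exists2 y, size y <= cert_bound w & V (encode_pair w y)) <->
  exists tau, @grid_ok M (time w) (width w) (init_code w) tau.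
Proof.
split=> [[y sy Vy]|[tau G]].
  set c := hcontent (init M (encode_pair w y)); exists (grid_of c).
  apply: grid_of_ok; last first.
    rewrite /c -iter_content ffunE; exact/(accept_head (time_ge sy)).
  move=> o _ _; apply/and4P; split.
  - by [].
  - by apply/eqP/ffunP => i; rewrite !ffunE nth_nil.
  - by apply/forallP => i; apply/implyP => /negbTE i0; rewrite content_init2 ffunE i0.
  - rewrite !content_init2 !ffunE eqxx.
    case: (ltnP o (2 * size w + 1)) => ow.
      rewrite cell_encode_pair // /init_code; case: ltnP => ow2.
        by case: odd => //; case: nth.
      by have -> : o == 2 * size w by lia.
    rewrite -(subnKC ow) -addnS !cell_encode_pair_cert; set k := o - _.
    rewrite /init_code ltnNge (_ : 2 * size w <= _) /=; last by lia.
    rewrite (_ : _ == 2 * size w = false); last by lia.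
    case: (ltnP k (size y)) => ky.
      rewrite ifT; last by rewrite /in_len; lia.
      by rewrite (nth_map false) //; case: nth.
    rewrite !nth_default ?size_map //; last by lia.
    by case: ifP.
have TW : time w <= width w by rewrite /width; lia.
have rowk o : o <= width w -> tpre (tau 0 o) = [ffun i => if i == ord0 then tpre (tau 0 o) ord0 else None]
   /\ init_ok (init_code w o) (tpre (tau 0 o) ord0) (trp (tau 0 o) ord0).
  move=> oW; have [/and4P[_ _ _ /implyP]] := G 0 o (leq0n _) oW.
  rewrite /= init_code_gt0 => /(_ isT) /and4P[_ _ /forallP p io] _ _; split=> //.
  by apply/ffunP => i; rewrite ffunE; case: eqP => [->//|/eqP i0]; exact/eqP/(implyP (p i)).
have nextE o : o < width w -> tpre (tau 0 o.+1) = trp (tau 0 o).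
  move=> oW; have [_ /(_ oW)] := G 0 o (leq0n _) (ltnW oW).
  have [/and4P[/eqP z1 _ _ _] _ _] := G 0 o.+1 (leq0n _) oW.
  by rewrite /tpre z1 /edgeE /edgeW => -[_ _ _ _ _ ->].
(* The certificate is read off the free cells of the initial row; being bits followed by blanks,
   they spell a word. *)
pose cl k := if 2 * size w + 1 + k <= width w then tpre (tau 0 (2 * size w + 1 + k)) ord0 else None.
have code3 k : k < cert_bound w -> init_code w (2 * size w + 1 + k) = 3.
  move=> kB; rewrite /init_code ifF; last by lia.
  rewrite ifF; last by lia.
  by rewrite ifT // /in_len; lia.
have code4 k : cert_bound w <= k -> init_code w (2 * size w + 1 + k) = 4.
  move=> kB; rewrite /init_code ifF; last by lia.
  rewrite ifF; last by lia.
  by rewrite ifF // /in_len; lia.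
have [|||y yB yE] := @bits_of_cells (symb M) (cert_bound w) cl.
- move=> k; rewrite /cl; case: ifP => [kW|]; last by constructor 3.
  have [_] := rowk _ kW; case: (ltnP k (cert_bound w)) => kB.
    by rewrite code3 // => /or3P[/eqP->|/eqP->|/andP[/eqP-> _]]; [constructor 1|constructor 2|constructor 3].
  by rewrite code4 // => /eqP->; constructor 3.
- move=> k; rewrite /cl; case: (ltnP (2 * size w + 1 + k) (width w)) => kW; last first.
    by move=> _; rewrite ifF //; lia.
  rewrite (ltnW kW) (addnS (2 * size w + 1) k) kW nextE // => c0.
  have [_] := rowk _ (ltnW kW); case: (ltnP k (cert_bound w)) => kB.
    by rewrite code3 // /init_ok c0 => /andP[_ /eqP].
  move=> _; have [_] := rowk _ kW; rewrite -(nextE _ kW) -(addnS (2 * size w + 1) k).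
  rewrite code4; last by lia.
  by move/eqP.
- rewrite /cl; case: ifP => // kW.
  by have [_] := rowk _ kW; rewrite code4 // => /eqP.
exists y => //; apply/(accept_head (time_ge yB)).
set x := encode_pair w y.
have := @grid_ok_iter M _ _ _ _ (hcontent (init M x)) G TW.
rewrite -iter_content ffunE; apply.
- by move=> o _; apply: init_code_gt0.
- by [].
- by move=> k; apply/ffunP => i; rewrite !ffunE nth_nil.
- move=> o oW; rewrite content_init2; have [rE io] := rowk o oW; rewrite rE.
  apply/ffunP => i; rewrite !ffunE; case: ifP => // _.
  case: (ltnP o (2 * size w + 1)) => ow.
    rewrite cell_encode_pair //; move: io; rewrite /init_code; case: ltnP => ow2.
      by case: odd; [case: nth|] => /eqP ->.
    have -> : o == 2 * size w by lia.
    by move=> /eqP ->.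
  rewrite -(subnKC ow) cell_encode_pair_cert -yE /cl ifT ?subnKC //.
Qed.

End Acceptance.

(** * The gadget in polynomial time *)

Section GadgetPtime.

Variables (jj cc nc : seq bool -> nat) (mm : seq bool -> nat -> nat -> bool).
Variables (na ns : seq bool -> nat) (Lq rr : nat).
Hypotheses (Hj_ptime : ptime (fun x _ => jj x)) (Hc_ptime : ptime (fun x _ => cc x))
  (Hn_ptime : ptime (fun x _ => nc x)) (Hna_ptime : ptime (fun x _ => na x)) (Hns_ptime : ptime (fun x _ => ns x))
  (Hm_ptime : forall a b, ptime a -> ptime b -> ptime (fun x s => mm x (a x s) (b x s))).

Lemma ptime_msel a b : ptime a -> ptime b -> ptime (fun x s => msel (cc x) (mm x) (a x s) (b x s)).
Proof. by move=> Ha Hb; rewrite /msel; ptime_solve; apply: Hm_ptime. Qed.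

Lemma ptime_cntT a : ptime a -> ptime (fun x s => cntT (jj x) (cc x) (mm x) (a x s)).
Proof.
apply: (ptime_1 (g := fun x i => cntT (jj x) (cc x) (mm x) i)).
by rewrite /cntT; ptime_solve; apply: ptime_msel; ptime_solve.
Qed.

Lemma ptime_rad1 : ptime (fun x _ => rad1 (cc x)).
Proof. by rewrite /rad1; ptime_solve. Qed.

Lemma ptime_rad2 : ptime (fun x _ => rad2 (cc x)).
Proof. by rewrite /rad2; ptime_solve; exact: ptime_rad1. Qed.

Lemma ptime_ZZ : ptime (fun x _ => ZZ (jj x) (cc x)).
Proof. by rewrite /ZZ; ptime_solve; exact: ptime_rad2. Qed.

Lemma ptime_YY : ptime (fun x _ => YY (jj x) (cc x)).
Proof. by rewrite /YY; ptime_solve; [exact: ptime_ZZ|exact: ptime_rad2]. Qed.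

Lemma ptime_gp : ptime (fun x _ => gp (jj x) (cc x)).
Proof. by rewrite /gp; ptime_solve. Qed.

Lemma ptime_gg : ptime (fun x _ => gg (jj x) (cc x)).
Proof. by rewrite /gg; ptime_solve; exact: ptime_gp. Qed.

Lemma ptime_LL : ptime (fun x _ => LL (jj x) (cc x)).
Proof. by rewrite /LL; ptime_solve; exact: ptime_YY. Qed.

Lemma ptime_om a (b d : seq bool -> seq nat -> bool) :
  ptime a -> ptime (fun x s => b x s) -> ptime (fun x s => d x s) ->
  ptime (fun x s => om (cc x) (a x s) (b x s) (d x s)).
Proof. by move=> Ha Hb Hd; rewrite /om; ptime_solve; exact: ptime_rad1. Qed.

Ltac ptime_gadget := first [exact: ptime_rad2 | exact: ptime_ZZ | exact: ptime_YY | exact: ptime_gp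
  | exact: ptime_gg | exact: ptime_LL].

Lemma ptime_fine a : ptime a -> ptime (fun x s => finew (jj x) (cc x) (mm x) (na x) (a x s)).
Proof.
apply: (ptime_1 (g := fun x v => finew (jj x) (cc x) (mm x) (na x) v)).
rewrite /finew; ptime_solve; try ptime_gadget.
  by apply: ptime_om; ptime_solve; apply: ptime_msel; ptime_solve.
by apply: ptime_om; ptime_solve; ptime_gadget.
Qed.

Lemma ptime_cls a : ptime a -> ptime (fun x s => cls (jj x) (cc x) (na x) (a x s)).
Proof. by move=> Ha; rewrite /cls; ptime_solve; ptime_gadget. Qed.

Lemma ptime_wt a : ptime a -> ptime (fun x s => wt (jj x) (cc x) (mm x) (na x) (a x s)).
Proof.
by move=> Ha; rewrite /wt; ptime_solve; [exact: ptime_cls|ptime_gadget|exact: ptime_fine].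
Qed.

Lemma ptime_thr : ptime (fun x _ => thr (jj x) (cc x)).
Proof. by rewrite /thr; ptime_solve; ptime_gadget. Qed.

Lemma ptime_attr a : ptime a -> ptime (fun x s => attr (jj x) (cc x) (na x) (a x s)).
Proof. by move=> Ha; rewrite /attr; ptime_solve; ptime_gadget. Qed.

Lemma ptime_h0 a b d : ptime a -> ptime b -> ptime d ->
  ptime (fun x s => h0 (jj x) (cc x) (mm x) (na x) Lq rr (a x s) (b x s) (d x s)).
Proof.
move=> Ha Hb Hd; rewrite /h0 /bulk_tie; ptime_solve;
  first [exact: ptime_thr | exact: ptime_wt | exact: ptime_attr | ptime_gadget].
Qed.

Lemma ptime_rdeg a : ptime a -> ptime (fun x s => rdeg (jj x) (cc x) (nc x) (mm x) (a x s)).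
Proof.
apply: (ptime_1 (g := fun x v => rdeg (jj x) (cc x) (nc x) (mm x) v)).
rewrite /rdeg /cnt /sel /need; ptime_solve; try ptime_gadget;
  by apply: ptime_cntT; ptime_solve; ptime_gadget.
Qed.

Lemma ptime_nn : ptime (fun x _ => nn (jj x) (cc x) (na x) (ns x)).
Proof. by rewrite /nn; ptime_solve; ptime_gadget. Qed.

Lemma ptime_dseq : ptime (fun x s =>
  dseq (jj x) (cc x) (nc x) (mm x) (na x) (ns x) Lq rr (nth 0 s 0)).
Proof.
rewrite /dseq /tdeg; ptime_solve; first [exact: ptime_nn | apply: ptime_h0; ptime_solve | apply: ptime_rdeg; ptime_solve].
Qed.

End GadgetPtime.

(** * From a verifier to a degree sequence *)

Section Reduction.

Variables (M : TM) (V : seq bool -> bool) (kt kc : nat).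
Hypothesis MV : computes_in M (poly_bound kt) (fun w => [:: V w]).

Definition tile0 : Tile M :=
  (start M, [ffun=> None], false, ([ffun=> None], [ffun=> None], [ffun=> None]),
   ([ffun=> None], [ffun=> None], [ffun=> None])).

Definition nOm := #|{: Tile M}|.
Definition tileOf a : Tile M := nth tile0 (enum {: Tile M}) a.

Definition rE a : nat := nat_of_ord (enum_rank (@edgeE M (tileOf a))).
Definition rW a : nat := nat_of_ord (enum_rank (@edgeW M (tileOf a))).
Definition rN a : nat := nat_of_ord (enum_rank (@edgeN M (tileOf a))).
Definition rS a : nat := nat_of_ord (enum_rank (@edgeS M (tileOf a))).
Let F := {ffun 'I_(extra M).+1 -> option (bool + symb M)}.
Definition nKh := #|{: state M * F * (F * F) * (F * F)}|.
Definition nKv := #|{: state M * F * F}|.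

(** The machine is fixed, so the colours and the local conditions are constant tables, whatever
    their size. *)
Definition tabE := mkseq rE nOm.
Definition tabW := mkseq rW nOm.
Definition tabN := mkseq rN nOm.
Definition tabS := mkseq rS nOm.
Definition tabA := mkseq (fun x =>
  kind_ok (odd (x %/ nOm)) (odd (x %/ nOm %/ 2)) (x %/ nOm %/ 4) (tileOf (x %% nOm))) (20 * nOm).

Definition rows w := (time kt kc w).+1.
Definition cols w := (width kt kc w).+1.

(* The arguments of [kind_ok] packed into a number below 20. *)
Definition kind w u :=
  (u %% cols w == 0) + 2 * ((u %/ cols w == time kt kc w) && (u %% cols w == 0)) +
  4 * (if u %/ cols w == 0 then init_code kc w (u %% cols w) else 0).

Definition allowedw w u a := nth false tabA (kind w u * nOm + a).

Lemma nOm_gt0 : 0 < nOm. Proof. by apply/card_gt0P; exists tile0. Qed.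

Lemma rank_lt (x : Tile M) : enum_rank x < nOm. Proof. exact: ltn_ord. Qed.

Lemma tileOf_rank (x : Tile M) : tileOf (enum_rank x) = x.
Proof. exact: nth_enum_rank. Qed.

Lemma init_code_le w u : init_code kc w u <= 4.
Proof. by rewrite /init_code; do !case: ifP. Qed.

Lemma allowedE w u a : a < nOm -> allowedw w u a =
  kind_ok (u %% cols w == 0) ((u %/ cols w == time kt kc w) && (u %% cols w == 0))
    (if u %/ cols w == 0 then init_code kc w (u %% cols w) else 0) (tileOf a).
Proof.
move=> aO; rewrite /allowedw /kind.
set z := _ == 0; set b := _ && z; set c := if _ then _ else _.
have c4 : c <= 4 by rewrite /c; case: ifP => // _; exact: init_code_le.
have kE : (z + 2 * b + 4 * c) %/ 2 = b + 2 * c.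
  rewrite (_ : z + 2 * b + 4 * c = (b + 2 * c) * 2 + z); last by lia.
  by rewrite divnMDl // divn_small ?addn0 //; case: (z).
rewrite nth_mkseq; last by case: (z) (b) => -[]; nia.
rewrite divnMDl ?nOm_gt0 // (divn_small aO) addn0 modnMDl (modn_small aO).
congr kind_ok.
- by rewrite !oddD /=; case: (odd c); case: (z); case: (b).
- by rewrite kE !oddD /=; case: (odd c); case: (b).
- rewrite (_ : 4 = 2 * 2) // divnMA kE (_ : b + 2 * c = c * 2 + b); last by lia.
  by rewrite divnMDl // divn_small ?addn0 //; case: (b).
Qed.

Definition wtiling w := tiling nOm (nth 0 tabE) (nth 0 tabW) (nth 0 tabN) (nth 0 tabS)
  (allowedw w) (rows w) (cols w).

Lemma grid_tiling w :
  (exists tau, @grid_ok M (time kt kc w) (width kt kc w) (init_code kc w) tau) <->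
  exists tau, wtiling w tau.
Proof.
split=> [[tau G]|[tau tt]].
  pose rk t i : nat := enum_rank (tau t i).
  exists (fun u => rk (u %/ cols w) (u %% cols w)) => u uc.
  have tT : u %/ cols w <= time kt kc w by rewrite -ltnS ltn_divLR.
  have oW : u %% cols w <= width kt kc w by rewrite -ltnS ltn_mod.
  have [k1 h1 v1] := G _ _ tT oW.
  split; first exact: rank_lt.
  - by rewrite allowedE ?rank_lt // tileOf_rank.
  - move=> /= lc; have lc' : u %% cols w < width kt kc w by rewrite -ltnS.
    have := h1 lc'.
    have -> : u.+1 %/ cols w = u %/ cols w.
      by rewrite {1}(divn_eq u (cols w)) -addnS divnMDl // (divn_small lc) addn0.
    have -> : u.+1 %% cols w = (u %% cols w).+1.
      by rewrite {1}(divn_eq u (cols w)) -addnS modnMDl (modn_small lc).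
    by rewrite !nth_mkseq ?rank_lt // /rE /rW !tileOf_rank => ->.
  - move=> /= lc.
    have E1 : (u + cols w) %/ cols w = (u %/ cols w).+1.
      by rewrite divnDr ?divnn // addn1.
    rewrite E1 modnDr; have /v1 : u %/ cols w < time kt kc w.
      by have : (u + cols w) %/ cols w < rows w; [rewrite ltn_divLR|rewrite E1].
    by rewrite !nth_mkseq ?rank_lt // /rN /rS !tileOf_rank => ->.
exists (fun t i => tileOf (tau (t * cols w + i))) => t i tT iW.
have iW' : i < cols w by [].
have E1 : (t * cols w + i) %/ cols w = t by rewrite divnMDl // divn_small // addn0.
have E2 : (t * cols w + i) %% cols w = i by rewrite modnMDl modn_small.
have uc : t * cols w + i < cells (rows w) (cols w) by rewrite /cells /rows; nia.
have [tO al hE vE] := tt _ uc.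
split.
- by move: al; rewrite allowedE // E1 E2.
- move=> iw; have := hE; rewrite E2 ltnS => /(_ iw).
  have uc' : (t * cols w + i).+1 < cells (rows w) (cols w) by rewrite /cells /rows /cols in iw *; nia.
  have [tO' _ _ _] := tt _ uc'.
  by rewrite !nth_mkseq // /rE /rW addnS => /ord_inj/enum_rank_inj.
- move=> tt'; have uc' : t * cols w + i + cols w < cells (rows w) (cols w).
    by rewrite /cells /rows; nia.
  have [tO' _ _ _] := tt _ uc'.
  have := vE uc'; rewrite !nth_mkseq // /rN /rS mulSn addnAC addnC.
  by rewrite [cols w + _]addnC => /ord_inj/enum_rank_inj; rewrite addnC.
Qed.

Definition redJ w := tJ nOm (rows w) (cols w).
Definition redC w := tC nKh nKv (rows w) (cols w).
Definition redN w := cells (rows w) (cols w).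
Definition redM w := tmem nOm nKh nKv (nth 0 tabE) (nth 0 tabW) (nth 0 tabN) (nth 0 tabS)
  (allowedw w) (rows w) (cols w).

Lemma rE_lt a : a < nOm -> nth 0 tabE a < nKh.
Proof. by move=> aO; rewrite nth_mkseq // /rE ltn_ord. Qed.

Lemma rN_lt a : a < nOm -> nth 0 tabN a < nKv.
Proof. by move=> aO; rewrite nth_mkseq // /rN ltn_ord. Qed.

Lemma cells_gt2 w : 2 < cells (rows w) (cols w).
Proof. by rewrite /cells /rows /cols /width; nia. Qed.

Lemma accept_exact_cover w :
  (exists2 y, size y <= poly_bound kc (size w) & V (encode_pair w y)) <->
  exact_cover (redJ w) (redC w) (redN w) (redM w).
Proof.
rewrite -/(cert_bound kc w); rewrite (accept_grid kc MV w) grid_tiling; split.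
  by move=> tt; exact: (tiling_exact_cover nKh nKv nOm_gt0 (cells_gt2 w) tt).
by move=> ec; exact: (exact_cover_tiling rE_lt rN_lt nOm_gt0 (cells_gt2 w) ec).
Qed.

Lemma ptime_poly_bound k a : ptime a -> ptime (fun x s => poly_bound k (a x s)).
Proof. by move=> Ha; rewrite /poly_bound; ptime_solve. Qed.

Lemma ptime_cert_bound : ptime (fun x _ => cert_bound kc x).
Proof. by apply: ptime_poly_bound; ptime_solve. Qed.

Lemma ptime_in_len : ptime (fun x _ => in_len kc x).
Proof. by rewrite /in_len; ptime_solve; exact: ptime_cert_bound. Qed.

Lemma ptime_time : ptime (fun x _ => time kt kc x).
Proof. by apply: ptime_poly_bound; exact: ptime_in_len. Qed.

Lemma ptime_width : ptime (fun x _ => width kt kc x).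
Proof. by rewrite /width; ptime_solve; [exact: ptime_time|exact: ptime_in_len]. Qed.

Lemma ptime_init_code a : ptime a -> ptime (fun x s => init_code kc x (a x s)).
Proof.
move=> Ha; rewrite /init_code; ptime_solve; first [exact: ptime_in_len | idtac].
Qed.

Lemma ptime_rows : ptime (fun x _ => rows x).
Proof. by rewrite /rows; ptime_solve; exact: ptime_time. Qed.

Lemma ptime_cols : ptime (fun x _ => cols x).
Proof. by rewrite /cols; ptime_solve; exact: ptime_width. Qed.

Lemma ptime_kind a : ptime a -> ptime (fun x s => kind x (a x s)).
Proof.
move=> Ha; rewrite /kind; ptime_solve; try first [exact: ptime_cols | exact: ptime_time].
by apply: ptime_init_code; ptime_solve; exact: ptime_cols.
Qed.

Lemma ptime_allowed a b : ptime a -> ptime b -> ptime (fun x s => allowedw x (a x s) (b x s)).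
Proof.
move=> Ha Hb; rewrite /allowedw; apply: ptime_tableb; ptime_solve; exact: ptime_kind.
Qed.

Lemma ptime_redN : ptime (fun x _ => redN x).
Proof. by rewrite /redN /cells; ptime_solve; [exact: ptime_rows|exact: ptime_cols]. Qed.

Lemma ptime_redJ : ptime (fun x _ => redJ x).
Proof. by rewrite /redJ /tJ; ptime_solve; exact: ptime_redN. Qed.

Lemma ptime_redC : ptime (fun x _ => redC x).
Proof. by rewrite /redC /tC; ptime_solve; exact: ptime_redN. Qed.

Lemma ptime_redM a b : ptime a -> ptime b -> ptime (fun x s => redM x (a x s) (b x s)).
Proof.
apply: (ptime_2 (g := fun x i j => redM x i j)).
have Hn : ptime (fun x _ => cells (rows x) (cols x)) := ptime_redN.
rewrite /redM /tmem /cmem; ptime_solve; try exact: ptime_cols;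
  first [by apply: ptime_allowed; ptime_solve | by apply: ptime_table; ptime_solve].
Qed.

Variables (Lq rr p q K0 : nat).

(** The bulk is at least [K0] times larger than the gadget, A and S are in the ratio p : q, and the
    factor [Lq] makes A a whole number of periods of the circulant. *)
Definition mult w := K0 * gg (redJ w) (redC w).
Definition nAw w := p * mult w * Lq.
Definition nSw w := q * mult w * Lq.
Definition size_red w := nn (redJ w) (redC w) (nAw w) (nSw w).
Definition deg_red w v := dseq (redJ w) (redC w) (redN w) (redM w) (nAw w) (nSw w) Lq rr v.

Lemma ptime_mult : ptime (fun x _ => mult x).
Proof. by rewrite /mult; ptime_solve; exact: (ptime_gg ptime_redJ ptime_redC). Qed.

Lemma ptime_nAw : ptime (fun x _ => nAw x).
Proof. by rewrite /nAw; ptime_solve; exact: ptime_mult. Qed.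

Lemma ptime_nSw : ptime (fun x _ => nSw x).
Proof. by rewrite /nSw; ptime_solve; exact: ptime_mult. Qed.

Lemma ptime_size_red : ptime (fun x _ => size_red x).
Proof. exact: (ptime_nn ptime_redJ ptime_redC ptime_nAw ptime_nSw). Qed.

Lemma ptime_deg_red : ptime (fun x s => deg_red x (nth 0 s 0)).
Proof. exact: (ptime_dseq _ _ ptime_redJ ptime_redC ptime_redN ptime_nAw ptime_nSw ptime_redM). Qed.

Lemma deg_red_need_le w i a : i <= redC w ->
  sel (redC w) (redN w) i a <= cnt (redJ w) (redC w) (redM w) i a.
Proof. exact: (tiling_need_le _ _ _ _ _ nOm_gt0 (cells_gt2 w)). Qed.

Lemma redN_gt0 w : 0 < redN w. Proof. by have := cells_gt2 w; rewrite /redN; lia. Qed.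

Lemma realizable_deg_red w :
  (exists h, forall v, v < size_red w -> tdeg (size_red w) h v = deg_red w v) <->
  (exists2 y, size y <= poly_bound kc (size w) & V (encode_pair w y)).
Proof.
rewrite accept_exact_cover; split=> [[h hE]|ec].
  exact: (realizable_exact_cover (@deg_red_need_le w) (redN_gt0 w) hE).
exact: (exact_cover_realizable _ _ _ _ (redN_gt0 w) ec).
Qed.

Lemma dvd3_deg_red w : 3 %| \sum_(0 <= v < size_red w) deg_red w v.
Proof. exact: (dvd3_dseq _ _ _ _ (@deg_red_need_le w) (redN_gt0 w)). Qed.

End Reduction.

Import Order.TTheory GRing.Theory Num.Theory.

(** * Density parameters *)

Section Density.
Local Open Scope ring_scope.
Variable R : realType.

Lemma rat_fraction (x y : R) : 0 <= x -> x < y -> y <= 1 ->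
  exists m k : nat, [/\ (0 < m < k)%N, x < m%:R / k%:R & m%:R / k%:R < y].
Proof.
move=> x0 xy y1; have [r] := rat_in_itvoo xy; rewrite in_itv /= => /andP[xr ry].
have r0 : 0 < r by rewrite -(ltr0q R) (le_lt_trans x0).
have rE : ratr r = `|numq r|%:R / `|denq r|%:R :> R.
  have -> : `|numq r|%:R = (numq r)%:~R :> R.
    by rewrite -[in RHS](gtz0_abs (_ : 0 < numq r)) // numq_gt0.
  have -> : `|denq r|%:R = (denq r)%:~R :> R.
    by rewrite -[in RHS](gtz0_abs (denq_gt0 r)).
  by [].
exists `|numq r|%N, `|denq r|%N; rewrite -rE; split=> //.
rewrite absz_gt0 numq_eq0 gt_eqF //=.
have d0 : 0 < `|denq r|%:R :> R by rewrite ltr0n absz_gt0 denq_neq0.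
by rewrite -(ltr_nat R) -[X in _ < X]mul1r -ltr_pdivrMr // -rE (lt_le_trans ry).
Qed.

(** Both parameters are only lowered, first [rho] to a rational s above c1 / al^2, then [al] to a
    rational above the square root of c1 / s. The lower condition survives by these choices, the
    upper one by monotonicity. *)
Lemma density_rational (c1 c2 al rho : R) : 0 < c1 -> 0 < al -> al < 1 ->
  rho <= 1 -> c1 < al ^+ 2 * rho -> al ^+ 2 + 2 * al * (1 - al) * rho < c2 ->
  exists p q m k : nat, [/\ (0 < p)%N, (0 < m < k)%N &
    let a := p%:R / (p + q)%:R : R in let s := m%:R / k%:R in
    [/\ 0 < a, a < 1, c1 < a ^+ 2 * s & a ^+ 2 + 2 * a * (1 - a) * s < c2]].
Proof.
move=> c0 a0 a1 r1 h1 h2; have a2 : 0 < al ^+ 2 by rewrite exprn_gt0.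
have [||//|m [k [mk s1 s2]]] := @rat_fraction (c1 / al ^+ 2) rho.
- by rewrite divr_ge0 // ltW.
- by rewrite ltr_pdivrMr // mulrC.
set s := m%:R / k%:R in s1 s2.
have s0 : 0 < s by apply: le_lt_trans s1; rewrite divr_ge0 // ltW.
have h3 : c1 < al ^+ 2 * s by rewrite mulrC -ltr_pdivrMr.
have h4 : al ^+ 2 + 2 * al * (1 - al) * s < c2.
  apply: le_lt_trans h2; rewrite lerD2l ler_wpM2l ?(ltW s2) //.
  by apply: mulr_ge0; lra.
have c1s : 0 <= c1 / s by rewrite divr_ge0 // ltW.
have [|||p [n [/andP[p0 pn] t1 t2]]] := @rat_fraction (Num.sqrt (c1 / s)) al.
- exact: sqrtr_ge0.
- by rewrite -[X in _ < X]ger0_norm ?ltW // -sqrtr_sqr ltr_sqrt // ltr_pdivrMr.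
- exact: ltW.
exists p, (n - p)%N, m, k; rewrite subnKC ?(ltnW pn) //; split=> //=.
rewrite -/s; set a := p%:R / n%:R in t1 t2 *.
have a'0 : 0 < a by apply: le_lt_trans t1; exact: sqrtr_ge0.
have s1' : s < 1 by apply: lt_le_trans r1.
split=> //; first exact: lt_trans a1.
- rewrite -ltr_pdivrMr // -(sqr_sqrtr c1s).
  by rewrite ltr_pXn2r // nnegrE ?sqrtr_ge0 // ltW.
- apply: le_lt_trans h4; rewrite -subr_ge0.
  (* This factorization shows that the upper density increases with [a], as s <= 1. *)
  have -> : al ^+ 2 + 2 * al * (1 - al) * s - (a ^+ 2 + 2 * a * (1 - a) * s) =
     (al - a) * ((al + a) * (1 - s) + s * ((1 - al) + (1 - a))) by ring.
  by apply: mulr_ge0; [lra|apply: addr_ge0; apply: mulr_ge0; lra].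
Qed.

(** Here x is the size of the bulk, g that of the gadget, and d twice a degree. All errors are
    multiples of g x, and K g <= x turns a gap e into e x^2 >= K e g x. The 8 bounds 4 g (g + x);
    the 11 is 8 for 4 (g + x) plus 3 for replacing (g + x)^2 by x^2. *)
Lemma degree_window (c1 c2 l u x g K d : R) :
  0 < c1 -> c1 < 1 -> 0 < c2 -> 4 <= g -> 1 <= K -> K * g <= x ->
  8 <= K * (c2 - u) -> 11 <= K * (l - c1) ->
  l * x ^+ 2 <= d + 4 * (g + x) -> d <= u * x ^+ 2 + 4 * g * (g + x) ->
  c1 * ((g + x - 1) * (g + x - 2)) <= d <= c2 * ((g + x - 1) * (g + x - 2)).
Proof.
move=> c10 c11 c20 g4 K1 Kg hu hl dl du.
have gx : g <= x by apply: le_trans Kg; rewrite -[leLHS]mul1r ler_wpM2r //; lra.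
have x0 : 0 < x by lra.
have g0 : 0 < g by lra.
have gx0 : 0 < g * x by rewrite mulr_gt0.
have key (c e : R) : 0 <= e -> c <= K * e -> c * (g * x) <= e * x ^+ 2.
  move=> e0 ce; apply: (@le_trans _ _ ((K * e) * (g * x))).
    by rewrite ler_wpM2r // ltW.
  rewrite (_ : K * e * (g * x) = e * x * (K * g)); last by ring.
  rewrite (_ : e * x ^+ 2 = e * x * x); last by ring.
  by rewrite ler_wpM2l // mulr_ge0 // ltW.
have e1 : 0 <= c2 - u.
  by rewrite -(pmulr_rge0 _ (lt_le_trans ltr01 K1)); lra.
have e2 : 0 <= l - c1.
  by rewrite -(pmulr_rge0 _ (lt_le_trans ltr01 K1)); lra.
have k1 := key _ _ e1 hu; have k2 := key _ _ e2 hl.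
have gg : g ^+ 2 <= g * x by rewrite expr2 ler_wpM2l // ltW.
have xg : x <= g * x by rewrite -[leLHS]mul1r ler_wpM2r //; lra.
apply/andP; split.
  apply: (@le_trans _ _ (c1 * (g + x) ^+ 2)).
    by rewrite ler_wpM2l ?(ltW c10) //; nra.
  have : c1 * (g + x) ^+ 2 <= c1 * x ^+ 2 + 3 * (g * x).
    rewrite (_ : c1 * (g + x) ^+ 2 = c1 * x ^+ 2 + c1 * (2 * (g * x) + g ^+ 2)); last by ring.
    rewrite lerD2l; apply: (@le_trans _ _ (1 * (2 * (g * x) + g ^+ 2))); last by lra.
    by rewrite ler_wpM2r ?(ltW c11) // addr_ge0 ?sqr_ge0 // mulr_ge0 // ltW.
  by lra.
apply: (@le_trans _ _ (c2 * x ^+ 2)); first by nra.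
by rewrite ler_wpM2l ?(ltW c20) //; nra.
Qed.

End Density.


(** * Hardness for both ranges of densities *)

Local Open Scope ring_scope.

Lemma natr_binS (R : realType) (n : nat) : (0 < n)%N ->
  2 * 'C(n.-1, 2)%:R = (n%:R - 1) * (n%:R - 2) :> R.
Proof.
case: n => // n _ /=; have : (2 * 'C(n, 2) = n * n.-1)%N.
  by rewrite bin2 mul2n halfK oddM; case: n => // n /=; rewrite andNb subn0.
move/(congr1 (fun k => k%:R : R)); rewrite !natrM => ->.
by case: n => [|n] /=; rewrite ?mul0r ?subrr ?mul0r // -![in RHS]natr1; ring.
Qed.

(** Delivers the degrees as a polynomial-time function rather than a reduction, so that they can be
    complemented before being encoded. *)
Lemma hard_degrees (R : realType) (c1 c2 al rho : R) (Q : problem) :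
  0 < c1 -> 0 < al -> al < 1 -> rho <= 1 ->
  c1 < al ^+ 2 * rho -> al ^+ 2 + 2 * al * (1 - al) * rho < c2 -> in_NP Q ->
  exists (n : seq bool -> nat) (D : seq bool -> nat -> nat),
    [/\ ptime (fun x _ => n x), ptime (fun x s => D x (nth 0%N s 0%N)) & forall w,
      [/\ (0 < n w)%N, (3 %| \sum_(0 <= v < n w) D w v)%N,
        forall v, (v < n w)%N ->
          c1 * 'C((n w).-1, 2)%:R <= (D w v)%:R <= c2 * 'C((n w).-1, 2)%:R &
        is_input Q w -> (is_yes Q w <->
          exists h, forall v, (v < n w)%N -> tdeg (n w) h v = D w v)]].
Proof.
move=> c10 a0 a1 r1 h1 h2 [V [kc [[M [kt MV]] HQ]]].
have [p [q [rr [Lq [p0 /andP[rr0 rrL]]]]]] := density_rational c10 a0 a1 r1 h1 h2.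
set a := p%:R / _; set s := rr%:R / _ => -[a'0 a'1 h3 h4].
have Lq0 : (0 < Lq)%N by apply: leq_trans rrL.
have s0 : 0 < s by rewrite divr_gt0 ?ltr0n.
have s1 : s < 1 by rewrite ltr_pdivrMr ?mul1r ?ltr_nat // ltr0n.
set u := a ^+ 2 + _ in h4; set l := a ^+ 2 * s in h3.
have a2 : 0 < a ^+ 2 by rewrite exprn_gt0.
have b0 : 0 <= 2 * a * (1 - a) * s by rewrite !mulr_ge0 ?subr_ge0 ?(ltW a'0) ?(ltW a'1) ?(ltW s0).
have la2 : l <= a ^+ 2 by rewrite /l -[leRHS]mulr1 ler_wpM2l // ltW.
have c20 : 0 < c2 by apply: le_lt_trans h4; rewrite addr_ge0 // ltW.
have l1 : l < 1.
  apply: le_lt_trans la2 _; rewrite expr2; nra.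
(* The summands serve the three requirements on K in [degree_window]. The input does not enter, so
   [K0] is a constant of the reduction. *)
pose K0 := (Num.bound (8 / (c2 - u)) + Num.bound (11 / (l - c1)) + 1)%N.
have K1 : 8 <= K0%:R * (c2 - u).
  rewrite -ler_pdivrMr ?subr_gt0 //; apply: le_trans (ltW (archi_boundP _)) _.
    by rewrite divr_ge0 // subr_ge0 ltW.
  by rewrite ler_nat /K0 -addnA leq_addr.
have K2 : 11 <= K0%:R * (l - c1).
  rewrite -ler_pdivrMr ?subr_gt0 //; apply: le_trans (ltW (archi_boundP _)) _.
    by rewrite divr_ge0 // subr_ge0 ltW.
  by rewrite ler_nat /K0 -addnA addnCA leq_addr.
have K3 : 1 <= K0%:R :> R by rewrite ler1n /K0 addn1.
exists (fun w => size_red M kt kc Lq p q K0 w), (fun w v => deg_red M kt kc Lq rr p q K0 w v).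
split; [exact: ptime_size_red|exact: ptime_deg_red|move=> w].
set n := size_red _ _ _ _ _ _ _ w.
set g := gg (redJ M kt kc w) (redC M kt kc w).
set nA := nAw M kt kc Lq p K0 w; set nS := nSw M kt kc Lq q K0 w.
have nE : n = (g + (nA + nS))%N by rewrite /n /size_red /nn addnA.
have g4 : (4 <= g)%N by exact: gg_ge4.
have n0 : (0 < n)%N by rewrite nE (leq_trans _ (leq_addr _ _)) // (leq_trans _ g4).
split=> //; first exact: dvd3_deg_red.
  move=> v vn; set d := deg_red _ _ _ _ _ _ _ _ _ _.
  pose x : R := (nA + nS)%:R.
  have nSE : (nA + nS = (p + q) * (K0 * g) * Lq)%N.
    by rewrite /nA /nS /nAw /nSw /mult -/g -!mulnA -mulnDl.
  have nAE : nA%:R = a * x.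
    rewrite /x nSE /nA /nAw /mult -/g /a !natrM; field.
    by rewrite -natrD pnatr_eq0 -lt0n addn_gt0 p0.
  have nSE' : nS%:R = (1 - a) * x by rewrite mulrBl mul1r -nAE /x natrD; ring.
  have kE : (p * (K0 * g) * rr)%:R = a * x * s.
    rewrite -nAE /nA /nAw /mult -/g /s !natrM; field.
    by rewrite pnatr_eq0 -lt0n.
  have gx : K0%:R * g%:R <= x.
    rewrite /x nSE -natrM ler_nat -[leqLHS]mul1n -[leqLHS]muln1.
    by rewrite !leq_mul // addn_gt0 p0.
  have x0 : 0 <= x by rewrite /x ler0n.
  have nR : n%:R = g%:R + x :> R by rewrite nE natrD.
  have [dl du] : l * x ^+ 2 <= 2 * d%:R + 4 * (g%:R + x) /\
      2 * d%:R <= u * x ^+ 2 + 4 * g%:R * (g%:R + x).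
    have uE : u = a ^+ 2 + 2 * (1 - a) * (a * s) by rewrite /u; ring.
    have lu : a ^+ 2 <= u by rewrite /u lerDl.
    have mono (e e' : R) : e <= e' -> e * x ^+ 2 <= e' * x ^+ 2.
      by move=> ee; rewrite ler_wpM2r // sqr_ge0.
    have nRE : (nn (redJ M kt kc w) (redC M kt kc w) nA nS)%:R = g%:R + x by rewrite -nR.
    have ub (X : nat) : (2 * d <= X + 4 * g * nn (redJ M kt kc w) (redC M kt kc w) nA nS)%N ->
        2 * d%:R <= X%:R + 4 * g%:R * (g%:R + x) :> R.
      by rewrite -(ler_nat R) natrD !natrM nRE.
    have lb (X : nat) : (X <= 2 * d + 4 * nn (redJ M kt kc w) (redC M kt kc w) nA nS)%N ->
        X%:R <= 2 * d%:R + 4 * (g%:R + x) :> R.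
      by rewrite -(ler_nat R) natrD !natrM nRE.
    have nAk : nA = (p * (K0 * g) * Lq)%N by [].
    have e1 : (nA * nA)%:R = a ^+ 2 * x ^+ 2 :> R by rewrite natrM nAE; ring.
    have e2 : (nA * nA + 2 * nS * (p * (K0 * g) * rr))%:R = u * x ^+ 2 :> R.
      by rewrite natrD e1 2!natrM nSE' kE uE; ring.
    have e3 : (nA * (p * (K0 * g) * rr))%:R = l * x ^+ 2 :> R.
      by rewrite natrM kE nAE /l; ring.
    have := dseq_bounds (@deg_red_need_le M kt kc w) (redN_gt0 kt kc w) (ltnW rrL) nAk vn.
    rewrite -/(deg_red _ _ _ _ _ _ _ _ _ _) -/d -/g => -[] [/lb L /ub U].
    - rewrite e1 in L U; split; first exact: le_trans (mono _ _ la2) L.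
      by apply: le_trans U _; rewrite lerD2r mono.
    - rewrite e2 in L U; split=> //.
      exact: le_trans (mono _ _ (le_trans la2 lu)) L.
    - rewrite e3 in L U; split=> //.
      by apply: le_trans U _; rewrite lerD2r mono // (le_trans la2 lu).
  have := degree_window c10 (lt_trans h3 l1) c20 (_ : 4 <= g%:R) K3 gx K1 K2 dl du.
  rewrite ler_nat => /(_ g4); rewrite -nR -natr_binS // => /andP[B1 B2].
  by apply/andP; split; lra.
move=> inQ; rewrite (HQ w inQ); apply: iff_sym.
exact: realizable_deg_red.
Qed.

Lemma HDS3_hard_of_degrees (R : realType) (c1 c2 : R) (Q : problem) n D :
  ptime (fun x _ => n x) -> ptime (fun x s => D x (nth 0%N s 0%N)) ->
  (forall w, [/\ (3 %| \sum_(0 <= v < n w) D w v)%N,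
        forall v, (v < n w)%N ->
          c1 * 'C((n w).-1, 2)%:R <= (D w v)%:R <= c2 * 'C((n w).-1, 2)%:R &
        is_input Q w -> (is_yes Q w <->
          exists h, forall v, (v < n w)%N -> tdeg (n w) h v = D w v)]) ->
  karp_reducible Q (HDS3 c1 c2).
Proof.
move=> Hn_ptime ptD HD; exists (fun w => encode_seq (mkseq (D w) (n w))).
  exact: encode_seq_polytime.
move=> w inQ; have [d3 bd yes] := HD w; set L := mkseq _ _.
have cl : in_class c1 c2 L.
  split; first by rewrite sumnE big_map -/(index_iota 0 (n w)) -[n w]subn0.
  by move=> d /mapP[v]; rewrite mem_iota add0n size_mkseq => /andP[_ /bd] ? ->.
have rL : realizable L <-> exists h, forall v, (v < n w)%N -> tdeg (n w) h v = D w v.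
  rewrite realizableP size_mkseq; split=> -[h hE]; exists h => v vn; have := hE v vn.
    by rewrite nth_mkseq.
  by rewrite nth_mkseq.
split; first by exists L.
rewrite (yes inQ) -rL; split=> [rE|[L' [_ rE] /encode_seq_inj ->]] //.
by exists L.
Qed.

Lemma HDS3_hard_mid (R : realType) (c1 c2 al rho : R) :
  0 < c1 -> 0 < al -> al < 1 -> rho <= 1 ->
  c1 < al ^+ 2 * rho -> al ^+ 2 + 2 * al * (1 - al) * rho < c2 ->
  NP_hard (HDS3 c1 c2).
Proof.
move=> c10 a0 a1 r1 h1 h2 Q NQ.
have [n [D [Hn_ptime ptD HD]]] := hard_degrees c10 a0 a1 r1 h1 h2 NQ.
by apply: (HDS3_hard_of_degrees Hn_ptime ptD) => w; have [_ ? ? ?] := HD w.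
Qed.

(* Complementing the hypergraph exchanges [(c1, c2)] and [(1 - c2, 1 - c1)]. *)
Lemma HDS3_hard_complement (R : realType) (c1 c2 al rho : R) :
  0 < c1 -> c2 < 1 -> 0 < al -> al < 1 -> rho <= 1 ->
  1 - c2 < al ^+ 2 * rho -> al ^+ 2 + 2 * al * (1 - al) * rho < 1 - c1 ->
  NP_hard (HDS3 c1 c2).
Proof.
move=> c10 c21 a0 a1 r1 h1 h2 Q NQ.
have c20 : 0 < 1 - c2 by rewrite subr_gt0.
have [n [D [Hn_ptime ptD HD]]] := hard_degrees c20 a0 a1 r1 h1 h2 NQ.
(* The degrees of the complement, with the binomial written in operations known to be polynomial. *)
pose D' w v := ((n w).-1 * (n w).-2 %/ 2 - D w v)%N.
have binE m : (m * m.-1 %/ 2 = 'C(m, 2))%N by rewrite bin2 divn2.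
apply: (@HDS3_hard_of_degrees R c1 c2 Q n D') => //.
  by rewrite /D'; ptime_solve.
move=> w; have [n0 d3 bd yes] := HD w; rewrite /D' binE.
set B := 'C(_, 2) in bd *.
have leB v : (v < n w)%N -> (D w v <= B)%N.
  move=> /bd /andP[_ le]; rewrite -(ler_nat R); apply: le_trans le _.
  by rewrite -[leRHS]mul1r ler_wpM2r ?ler0n //; lra.
split.
(* This is the sum of the degrees of the complete hypergraph, in which each edge counts three
   times. *)
- have dB : (3 %| n w * B)%N.
    have := sum_tdeg (n w) (fun _ _ _ => true).
    have -> : (\sum_(0 <= v < n w) tdeg (n w) (fun _ _ _ => true) v = n w * B)%N; last first.
      by move=> ->; rewrite dvdn_mulr.
    rewrite -[X in (X * B)%N]subn0 -sum_nat_const_nat; apply: eq_big_nat => v /andP[_ vn].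
    rewrite /B -(tdeg_complement (fun _ _ _ => false) vn) /= -[LHS]addn0; congr (_ + _)%N.
    by rewrite /tdeg big1 // => c _; rewrite big1 // => b _; rewrite big1.
  rewrite -(dvdn_addl _ d3) -big_split /=.
  rewrite (_ : \sum_(0 <= v < n w) _ = n w * B)%N //.
  rewrite -[X in (X * B)%N]subn0 -sum_nat_const_nat; apply: eq_big_nat => v /andP[_ vn].
  by rewrite subnK // leB.
- move=> v vn; rewrite natrB ?leB //; have := bd v vn.
  by set b : R := B%:R; set d : R := _%:R; lra.
- move=> inQ; rewrite (yes inQ); split=> -[h hE]; exists (fun a b c => ~~ h a b c) => v vn.
    by have := tdeg_complement h vn; rewrite hE // -/B; lia.
  have := tdeg_complement h vn; rewrite hE // -/B; have := leB v vn; lia.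
Qed.

Theorem corollary4p3 (R : realType) (c1 c2 : R)
  (c2_gt0 : 0 < c2) (c2_lt1 : c2 < 1)
  (c1_gt0 : 0 < c1) (c1_lt : c1 < c1star c2) :
  NP_complete (HDS3 c1 c2).
Proof.
split; first exact: HDS3_in_NP.
have [al /andP[a0 a1] [csE _]] := c1star_max c2_gt0 c2_lt1.
move: c1_lt; rewrite csE /Cfun => {csE}.
have a2 : 0 < al ^+ 2 by rewrite exprn_gt0.
have b1 : 0 < 1 - al by rewrite subr_gt0.
have b2 : 0 < (1 - al) ^+ 2 by rewrite exprn_gt0.
have ab : 0 < 2 * al * (1 - al) by rewrite !mulr_gt0.
case: (leP (c2 / 2)) => [_ c1_lt|h1]; first by move: (lt_trans c1_gt0 c1_lt); rewrite ltxx.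
case: (leP (c2 / 2)) => [h2 c1_lt|h2 c1_lt].
  (* The [rho] at which the largest density equals c2. Then al^2 [r1] is the second branch, and
     [r1 <= 1] is its condition on d; the midpoint of c1 / al^2 and [r1] makes both inequalities
     strict. *)
  pose r1 := (c2 - al ^+ 2) / (2 * al * (1 - al)).
  have r1E : al ^+ 2 + 2 * al * (1 - al) * r1 = c2 by rewrite /r1; field; lra.
  have lt1 : c1 / al ^+ 2 < r1.
    rewrite ltr_pdivrMr // (lt_le_trans c1_lt) // le_eqVlt; apply/orP; left.
    by apply/eqP; rewrite /r1; field; lra.
  have r1_le : r1 <= 1 by rewrite ler_pdivrMr //; lra.
  apply: (@HDS3_hard_mid R c1 c2 al ((c1 / al ^+ 2 + r1) / 2)) => //.
  - by lra.
  - by rewrite mulrC -ltr_pdivrMr //; lra.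
  - by rewrite -[ltRHS]r1E ltrD2l ltr_pM2l //; lra.
(* The limits for [rho] in the complementary problem with 1 - al for al. The condition of the third
   branch is [r1 < 1], and c1 below its value is [r1 < r2]. *)
pose r1 := (1 - c2) / (1 - al) ^+ 2.
pose r2 := (1 - c1 - (1 - al) ^+ 2) / (2 * al * (1 - al)).
have r2E : (1 - al) ^+ 2 + 2 * al * (1 - al) * r2 = 1 - c1 by rewrite /r2; field; lra.
have r11 : r1 < 1 by rewrite ltr_pdivrMr // mul1r; lra.
have r12 : r1 < r2.
  rewrite -(ltr_pM2l ab) -(ltrD2l ((1 - al) ^+ 2)) r2E ltrBrDl -ltrBrDr.
  apply: lt_le_trans c1_lt _; rewrite le_eqVlt; apply/orP; left.
  by apply/eqP; rewrite /r1; field; lra.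
have r1m : r1 < Num.min 1 r2 by rewrite lt_min r11.
have m1 : Num.min 1 r2 <= 1 by rewrite ge_min lexx.
have m2 : Num.min 1 r2 <= r2 by rewrite ge_min lexx orbT.
apply: (@HDS3_hard_complement R c1 c2 (1 - al) ((r1 + Num.min 1 r2) / 2)) => //.
- by lra.
- by lra.
- by rewrite mulrC -ltr_pdivrMr // -/r1; lra.
- rewrite (_ : 1 - (1 - al) = al); last by ring.
  rewrite (_ : 2 * (1 - al) * al = 2 * al * (1 - al)); last by ring.
  by rewrite -[ltRHS]r2E ltrD2l ltr_pM2l //; lra.
Qed.
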